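(* At least $\frac12$ of the space $\widehat{\mathrm{Pol}}_3(6;\vec 1)$ of equilateral hexagons consists of unknots; that is, the probability, with respect to the standard measure on $\widehat{\mathrm{Pol}}_3(6;\vec 1)$ (normalized to total mass one), that a random closed equilateral hexagon in $\mathbb{R}^3$ is unknotted is at least $\frac12$.
   Context: A closed equilateral hexagon (up to translation) is a tuple $(\vec e_1,\dots,\vec e_6)$ of unit vectors in $\mathbb{R}^3$ with $\sum_i\vec e_i=\vec 0$; $\mathrm{Pol}_3(6;\vec 1)\subset (S^2)^6$ is the set of these, and $\widehat{\mathrm{Pol}}_3(6;\vec 1)=\mathrm{Pol}_3(6;\vec 1)/\mathrm{SO}(3)$ is the quotient by the diagonal rotation action. The standard measure on $\mathrm{Pol}_3(6;\vec 1)$ is the subspace measure, i.e. the Hausdorff measure of the metric induced on $\mathrm{Pol}_3(6;\vec 1)$ as a subspace of $(S^2)^6$ with the product Riemannian metric. The standard measure on $\widehat{\mathrm{Pol}}_3(6;\vec 1)$ is its pushforward to the quotient. A hexagon is an unknot if the closed polygonal curve in $\mathbb{R}^3$ with these edges is a trivial knot. *)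

(* Defs.v *)
From HB Require Import structures.
From mathcomp Require Import all_boot all_order all_algebra.
From mathcomp Require Import generic_quotient.
From mathcomp Require Import all_classical all_reals all_analysis.

Set Implicit Arguments.
Unset Strict Implicit.
Unset Printing Implicit Defensive.

Import Order.TTheory GRing.Theory Num.Theory.
Import numFieldNormedType.Exports.

Local Open Scope classical_set_scope.
Local Open Scope ring_scope.
Local Open Scope quotient_scope.

Section Hausdorff.
Context {R : realType} {T : Type}.
Variables (d : T -> T -> R) (s : nat).
Local Open Scope ereal_scope.

(* The maximum with 0 only matters for the empty set. *)
Definition diam (A : set T) : \bar R :=
  maxe 0 (ereal_sup [set (d z.1 z.2)%:E | z in A `*` A]).

(* [diam A ^ s], with value 0 on the empty set even when [s = 0]. *)
Definition hausdorff_gauge (A : set T) : \bar R :=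
  if A == set0 then 0 else diam A ^+ s.

Definition delta_cover (delta : R) (A : set T) : set ((set T)^nat) :=
  [set F | A `<=` \bigcup_k F k /\ forall k, diam (F k) <= delta%:E].

Definition hausdorff_delta (delta : R) (A : set T) : \bar R :=
  ereal_inf [set \sum_(k <oo) hausdorff_gauge (F k) | F in delta_cover delta A].

(* The s-dimensional Hausdorff (outer) measure, without the constant
   (volume of the Euclidean s-ball of diameter 1) that some authors put in
   front; it cancels in any ratio of measures. *)
Definition hausdorff (A : set T) : \bar R :=
  ereal_sup [set hausdorff_delta delta A | delta in [set x : R | (0 < x)%R]].

Lemma diam_ge0 A : 0 <= diam A.
Proof. by rewrite /diam le_max lexx. Qed.

Lemma diam0 : diam set0 = 0.
Proof.
rewrite /diam (_ : [set _ | _ in _] = set0) ?ereal_sup0 ?maxeNy//.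
by rewrite -subset0 => _ [z [[]]].
Qed.

Lemma hausdorff_gauge_ge0 A : 0 <= hausdorff_gauge A.
Proof. by rewrite /hausdorff_gauge; case: ifP => // _; exact/expe_ge0/diam_ge0. Qed.

Lemma hausdorff_gauge0 : hausdorff_gauge set0 = 0.
Proof. by rewrite /hausdorff_gauge eqxx. Qed.

Lemma hausdorff_delta_ge0 delta A : 0 <= hausdorff_delta delta A.
Proof.
apply: le_ereal_inf_tmp => _ [F _ <-].
by apply: nneseries_ge0 => *; exact: hausdorff_gauge_ge0.
Qed.

Lemma hausdorff_delta0 delta : (0 < delta)%R -> hausdorff_delta delta set0 = 0.
Proof.
move=> d0; apply/eqP; rewrite eq_le hausdorff_delta_ge0 andbT.
apply: ereal_inf_lbound; exists (fun=> set0); first by split=> // _; rewrite diam0 lee_fin ltW.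
by apply: eseries0 => *; exact: hausdorff_gauge0.
Qed.

Lemma le_hausdorff_delta delta :
  {homo hausdorff_delta delta : A B / A `<=` B >-> A <= B}.
Proof.
move=> A B AB; apply: ereal_inf_le_tmp => _ [F [BF dF] <-].
by exists F => //; split => //; exact: subset_trans BF.
Qed.

Lemma hausdorff_delta_sigma_subadditive delta :
  sigma_subadditive (hausdorff_delta delta).
Proof.
move=> A; have [[i ioo]|] := pselect (exists i, hausdorff_delta delta (A i) = +oo).
  rewrite (eseries_pinfty _ _ ioo) ?leey// => n _.
  by rewrite -ltNye (lt_le_trans _ (hausdorff_delta_ge0 _ _)).
rewrite -forallNE => Aoo.
suff add2e (e : {posnum R}) : hausdorff_delta delta (\bigcup_n A n) <=
    \sum_(i <oo) hausdorff_delta delta (A i) + e%:num%:E.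
  by apply/lee_addgt0Pr => _/posnumP[].
rewrite (le_trans _ (epsilon_trick _ _ _))//; last first.
  by move=> n; exact: hausdorff_delta_ge0.
pose P n (B : (set T)^nat) := delta_cover delta (A n) B /\
  \sum_(k <oo) hausdorff_gauge (B k) <=
    hausdorff_delta delta (A n) + (e%:num / (2 ^ n.+1)%:R)%:E.
have [G PG] : {G : ((set T)^nat)^nat & forall n, P n (G n)}.
  apply: (@choice _ _ P) => n; rewrite /P /hausdorff_delta.
  set S := (X in ereal_inf X); move infS : (ereal_inf S) => iS.
  case: iS infS => [r Sr|Soo|Soo].
  - have en1 : (0 < e%:num / (2 ^ n.+1)%:R)%R by [].
    have /(lb_ereal_inf_adherent en1) : ereal_inf S \is a fin_num by rewrite Sr.
    move=> [x [B AnB muBx] xS].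
    by exists B; split => //; rewrite muBx -Sr; exact/ltW.
  - by have := Aoo n; rewrite /hausdorff_delta Soo.
  - suff : lbound S 0 by move/le_ereal_inf_tmp; rewrite Soo.
    move=> /= _ [B AnB <-].
    by apply: nneseries_ge0 => *; exact: hausdorff_gauge_ge0.
have muG_ge0 x : 0 <= (hausdorff_gauge \o uncurry G) x
  by exact: hausdorff_gauge_ge0.
apply: (@le_trans _ _ (\esum_(i in setT) (hausdorff_gauge \o uncurry G) i)).
  apply: ereal_inf_lbound => /=.
  have /card_esym/ppcard_eqP[f] := card_nat2.
  exists (uncurry G \o f).
    split => [|k]; last by rewrite /=; case: (f k) => a b; exact: (PG a).1.2.
    apply: (@subset_trans _  (\bigcup_n \bigcup_k G n k)) => [t [i _]|].
      by move=> /(PG i).1.1 -[j _ ?]; exists i => //; exists j.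
    move=> t [i _ [j _ Bijt]]; exists (f^-1%FUN (i, j)) => //=.
    by rewrite invK ?inE.
  rewrite -(esum_pred_image (hausdorff_gauge \o uncurry G) _ xpredT)
    ?[fun=> _]set_true//.
  by rewrite image_eq.
rewrite (_ : esum _ _ = \sum_(i <oo) \sum_(j <oo) hausdorff_gauge (G i j));
  last first.
  pose J : nat -> set (nat * nat) := fun i => [set (i, j) | j in setT].
  rewrite (_ : setT = \bigcup_k J k); last first.
    by rewrite predeqE => -[a b]; split => // _; exists a => //; exists b.
  rewrite esum_bigcupT /=; last 2 first.
    - apply/trivIsetP => i j _ _ ij.
      rewrite predeqE => -[n m] /=; split => //= -[] [_] _ [<-{n} _].
      by move=> [m' _] [] /esym/eqP; rewrite (negbTE ij).
    - by move=> /= [n m]; exact: hausdorff_gauge_ge0.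
  rewrite -(image_id [set: nat]) -fun_true esum_pred_image//; last first.
    by move=> n _; apply: esum_ge0 => *; exact: muG_ge0.
  apply: eq_eseriesr => /= j _.
  have Gj_ge0 n : true -> 0 <= hausdorff_gauge (G j n).
    by move=> _; exact: hausdorff_gauge_ge0.
  rewrite -(esum_pred_image (hausdorff_gauge \o uncurry G) (pair j) predT)//=;
    last by move=> ? ? _ _; exact: (@can_inj _ _ _ snd).
  by congr esum; rewrite predeqE => -[a b]; split; move=> [i _ <-]; exists i.
apply: lee_nneseries => [n _ _|n _]; last exact: (PG n).2.
by apply: nneseries_ge0 => m *; exact: (muG_ge0 (n, m)).
Qed.

Lemma hausdorff0 : hausdorff set0 = 0.
Proof.
apply/eqP; rewrite eq_le; apply/andP; split.
  by apply: ge_ereal_sup => _ [e e0 <-]; rewrite hausdorff_delta0.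
by apply: ereal_sup_ubound; exists 1%R => //=; rewrite hausdorff_delta0.
Qed.

Lemma hausdorff_ge0 A : 0 <= hausdorff A.
Proof.
apply: (le_trans (hausdorff_delta_ge0 1 A)).
by apply: ereal_sup_ubound; exists 1%R => /=.
Qed.

Lemma le_hausdorff : {homo hausdorff : A B / A `<=` B >-> A <= B}.
Proof.
move=> A B AB; apply: ge_ereal_sup => _ [e e0 <-].
apply: (le_trans (le_hausdorff_delta e AB)).
by apply: ereal_sup_ubound; exists e.
Qed.

Lemma hausdorff_sigma_subadditive : sigma_subadditive hausdorff.
Proof.
move=> A; apply: ge_ereal_sup => _ [e e0 <-].
apply: (le_trans (hausdorff_delta_sigma_subadditive e A)).
apply: lee_nneseries => [k _ _|k _]; first exact: hausdorff_delta_ge0.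
by apply: ereal_sup_ubound; exists e.
Qed.

HB.instance Definition _ := isOuterMeasure.Build R T hausdorff
  hausdorff0 hausdorff_ge0 le_hausdorff hausdorff_sigma_subadditive.

End Hausdorff.

Definition dot {R : realType} (u v : 'rV[R]_3) : R := \sum_i u 0 i * v 0 i.

(* The rows of the matrix are the edge vectors. *)
Definition is_hexagon {R : realType} (e : 'M[R]_(6, 3)) : bool :=
  [forall i, dot (row i e) (row i e) == 1] && (\sum_i row i e == 0).

Definition pol (R : realType) : Type := {e : 'M[R]_(6, 3) | is_hexagon e}.
HB.instance Definition _ (R : realType) := Choice.on (pol R).

(* The Riemannian distance of the product of six unit spheres; [acos] of the
   inner product is the great-circle distance. *)
Definition pol_dist {R : realType} (e f : pol R) : R :=
  Num.sqrt (\sum_i acos (dot (row i (val e)) (row i (val f))) ^+ 2).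

(* [pol R] has dimension 6 * 2 - 3. *)
Definition pol_measure {R : realType} : set (pol R) -> \bar R :=
  hausdorff pol_dist 9.

Definition is_rotation {R : realType} (Q : 'M[R]_3) : Prop :=
  Q *m Q^T = 1%:M /\ \det Q = 1.

(* Vectors are rows, so [Q] acts by multiplication on the right. *)
Definition rot_rel {R : realType} (e f : pol R) : bool :=
  `[< exists Q : 'M[R]_3, is_rotation Q /\ val f = val e *m Q >].

Lemma rot_rel_refl (R : realType) : reflexive (@rot_rel R).
Proof.
move=> e; apply/asboolP; exists 1%:M; rewrite mulmx1; split=> //.
by split; rewrite ?det1// trmx1 mulmx1.
Qed.

Lemma rot_rel_sym (R : realType) : symmetric (@rot_rel R).
Proof.
suff sub e f : @rot_rel R e f -> rot_rel f e by move=> e f; apply/idP/idP; exact: sub.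
move=> /asboolP[Q [[QQ dQ] fE]]; apply/asboolP; exists Q^T.
rewrite fE -mulmxA QQ mulmx1; do !split; last by rewrite det_tr.
by rewrite trmxK mulmx1C.
Qed.

Lemma rot_rel_trans (R : realType) : transitive (@rot_rel R).
Proof.
move=> f e g /asboolP[P [[PP dP] fE]] /asboolP[Q [[QQ dQ] gE]].
apply/asboolP; exists (P *m Q); rewrite gE fE mulmxA; do !split=> //.
  by rewrite trmx_mul mulmxA -(mulmxA P) QQ mulmx1.
by rewrite det_mulmx dP dQ mulr1.
Qed.

Canonical rot_equiv (R : realType) :=
  EquivRel (@rot_rel R) (@rot_rel_refl R) (@rot_rel_sym R) (@rot_rel_trans R).

Definition hexagon_space (R : realType) := {eq_quot rot_equiv R}.

Definition hexagon_class {R : realType} (e : pol R) : hexagon_space R :=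
  \pi_({eq_quot rot_equiv R}) e.

(* The pushforward of [pol_measure] along the quotient map; like
   [pol_measure] it is an outer measure, defined on all sets and
   countably additive on the Caratheodory-measurable ones. *)
Definition hexagon_measure {R : realType} (B : set (hexagon_space R)) : \bar R :=
  pol_measure (hexagon_class @^-1` B).

(* [hexagon_measure] normalized to total mass one. [fine +oo = 0] and
   [x / 0 = 0], so this is identically 0 if the total mass is 0 or +oo. *)
Definition hexagon_prob {R : realType} (B : set (hexagon_space R)) : R :=
  fine (hexagon_measure B) / fine (hexagon_measure [set: hexagon_space R]).

Definition ambient_isotopy {R : realType}
    (H : R -> 'rV[R]_3 -> 'rV[R]_3) : Prop :=
  [/\ {within `[0, 1]%classic `*` [set: 'rV[R]_3],
         continuous (fun p : R * 'rV[R]_3 => H p.1 p.2)},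
      forall x, H 0 x = x
    & forall t, 0 <= t <= 1 ->
        exists G : 'rV[R]_3 -> 'rV[R]_3,
          [/\ continuous G, cancel (H t) G & cancel G (H t)]].

Definition unit_circle {R : realType} : set 'rV[R]_3 :=
  [set x | x 0 0 ^+ 2 + x 0 1 ^+ 2 = 1 /\ x 0 2%:R = 0].

Definition trivial_knot {R : realType} (K : set 'rV[R]_3) : Prop :=
  exists H : R -> 'rV[R]_3 -> 'rV[R]_3,
    ambient_isotopy H /\ H 1 @` K = unit_circle.

(* The hexagon is placed with its first vertex at the origin. *)
Definition vertex {R : realType} (e : pol R) (k : 'I_6) : 'rV[R]_3 :=
  \sum_(j < 6 | (j < k)%N) row j (val e).

Definition polygon_point {R : realType} (e : pol R) (p : 'I_6 * R) : 'rV[R]_3 :=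
  vertex e p.1 + p.2 *: row p.1 (val e).

(* [(k, s)] with [0 <= s < 1] ranges once over the closed polygonal curve. *)
Definition polygon_param {R : realType} : set ('I_6 * R) :=
  [set p | 0 <= p.2 < 1].

(* A knot is an embedded curve, so a hexagon with self-intersections is not an
   unknot even when its image is a trivial knot (e.g. a triangle traversed
   twice). *)
Definition is_unknot {R : realType} (e : pol R) : Prop :=
  set_inj polygon_param (polygon_point e) /\
  trivial_knot (polygon_point e @` polygon_param).

Definition unknots {R : realType} : set (hexagon_space R) :=
  hexagon_class @` [set e | is_unknot e].

(* Main.v *)
Require Import Defs.
From mathcomp Require Import all_boot all_order all_algebra.
From mathcomp Require Import fingroup perm.
From mathcomp Require Import all_classical all_reals all_analysis.
From mathcomp Require Import measurable_realfun.
From mathcomp Require Import zify ring lra.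

(** Number the edge vectors [e_0, ..., e_5] and let [u] be the cross product of
    [e_0] and [e_1]. Outside a null set the four numbers [u.e_2, ..., u.e_5]
    are nonzero; they add up to zero, because [u.e_0 = u.e_1 = 0]. Suppose that
    their signs do not alternate. A slight tilt of [u] gives a direction [w] in
    which [e_0] and [e_1] rise or fall just as [e_2] does, and then the cyclic
    sequence of the signs of [w.e_j] consists of one block of rising edges and
    one block of falling ones. Such a hexagon has a single local maximum and a
    single local minimum in the direction [w], so that it is an unknot
    ([not_alternating_unknot]). Exchanging [e_2] and [e_3] is an isometry of
    the space of hexagons which keeps [u] and exchanges the first two signs;
    a sequence of four signs and the exchanged one are never both alternating.
    So almost every hexagon is an unknot itself or becomes one by the exchange
    ([unknot_or_swap]), and the total measure is at most twice the measure of
    the unknots ([total_le_twice_unknots]). Dividing needs a total measure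
    which is positive and finite.

    Measure. A grid of mesh [1/n] on the sphere has [O(n ^ 2)] points. Given
    the first four edges, the sum [x] of the last two is known, and the last
    two edges are determined by the direction of [e_4 - e_5], a unit vector
    orthogonal to [x]. Only [O(n / |x|)] grid points come close enough to being
    orthogonal to [x], and [1 / |x|] is integrable over the sphere of [e_3]; so
    [O(n ^ 9)] cells of diameter [O(1/n)] suffice as long as [e_4] and [e_5]
    are not nearly parallel. That holds if [e_4.e_5 <= 0], and every hexagon
    has a pair of edges with nonpositive inner product ([total_finite]). When
    two edges are parallel, or when a triple product of edges vanishes, one
    parameter less is left and [O(n ^ 8)] cells suffice ([degenerate_null]).
    Conversely nine coordinates of the edges, each of them a 1-Lipschitz
    function, take all values in a box, and the image of a set of diameter [l]
    lies in a cube of side [2 l] ([pol_measure_gt0]).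

    Topology. An embedded curve with a single maximum and a single minimum in
    the direction [w] consists of two rising paths with common ends
    ([unimodal_unknot]); each intermediate level meets it in two points. Make
    the height a coordinate [y] in [[-1, 1]], identify the levels with the
    complex plane, and let [(1 - |y|) g(y)] be half the difference of the two
    points, where [g] is continuous and nowhere zero. Translating each level
    moves the midpoint of the two points to 0, and multiplying it by
    [g((1 - t) y) / g(y)] while [t] goes from 0 to 1 deforms [g] into a
    constant ([lens_isotopic_diamond]). The curve becomes the square
    [|x_0| + |x_1| = 1], which a radial isotopy takes to the circle
    ([diamond_isotopic_circle]). *)

Set Implicit Arguments.
Unset Strict Implicit.
Unset Printing Implicit Defensive.

Import Order.TTheory GRing.Theory Num.Theory.
Import numFieldNormedType.Exports.

Local Open Scope classical_set_scope.
Local Open Scope ring_scope.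

(** * Vectors in three-space *)

Section Vectors.
Context {R : realType}.
Implicit Types u v w x : 'rV[R]_3.

Definition vec3 (a b c : R) : 'rV[R]_3 := \row_j [:: a; b; c]`_j.

Lemma vec3E (a b c : R) :
  (vec3 a b c 0 0 = a) * (vec3 a b c 0 1 = b) * (vec3 a b c 0 2%:R = c).
Proof. by rewrite !mxE. Qed.

Lemma forall3 (P : 'I_3 -> Prop) : P 0 -> P 1 -> P 2%:R -> forall i, P i.
Proof.
move=> p0 p1 p2 [[|[|[|//]]] i3].
- by rewrite (_ : Ordinal _ = 0) //; exact: val_inj.
- by rewrite (_ : Ordinal _ = 1) //; exact: val_inj.
- by rewrite (_ : Ordinal _ = 2%:R) //; exact: val_inj.
Qed.

Lemma rV3P u v :
  u 0 0 = v 0 0 -> u 0 1 = v 0 1 -> u 0 2%:R = v 0 2%:R -> u = v.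
Proof. by move=> h0 h1 h2; apply/rowP; elim/forall3. Qed.

Lemma sum3 (V : nmodType) (F : 'I_3 -> V) : \sum_i F i = F 0 + F 1 + F 2%:R.
Proof.
rewrite !big_ord_recl big_ord0 addr0 addrA.
by congr (_ + F _ + F _); exact: val_inj.
Qed.

Lemma dotE u v : dot u v = u 0 0 * v 0 0 + u 0 1 * v 0 1 + u 0 2%:R * v 0 2%:R.
Proof. by rewrite /dot sum3. Qed.

Definition cross u v : 'rV[R]_3 :=
  vec3 (u 0 1 * v 0 2%:R - u 0 2%:R * v 0 1)
       (u 0 2%:R * v 0 0 - u 0 0 * v 0 2%:R)
       (u 0 0 * v 0 1 - u 0 1 * v 0 0).

Definition triple u v w : R := dot (cross u v) w.

Definition vecE := (dotE, @vec3E, mxE).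

Lemma dotC u v : dot u v = dot v u.
Proof. by rewrite !dotE; ring. Qed.

Lemma dotDr u v w : dot u (v + w) = dot u v + dot u w.
Proof. by rewrite !vecE; ring. Qed.

Lemma dotNr u v : dot u (- v) = - dot u v.
Proof. by rewrite !vecE; ring. Qed.

Lemma dotZr u v (a : R) : dot u (a *: v) = a * dot u v.
Proof. by rewrite !vecE; ring. Qed.

Lemma dot0r u : dot u 0 = 0.
Proof. by rewrite !vecE; ring. Qed.

Lemma dotBr u v w : dot u (v - w) = dot u v - dot u w.
Proof. by rewrite dotDr dotNr. Qed.

Lemma dot_sumr u (I : Type) (r : seq I) (P : pred I) (F : I -> 'rV[R]_3) :
  dot u (\sum_(i <- r | P i) F i) = \sum_(i <- r | P i) dot u (F i).
Proof. by apply: (big_morph (dot u)); [exact: dotDr|exact: dot0r]. Qed.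

Lemma dot_ge0 u : 0 <= dot u u.
Proof. by rewrite dotE -!expr2 !addr_ge0 // sqr_ge0. Qed.

Lemma dot_eq0 u : dot u u = 0 -> u = 0.
Proof.
move=> /eqP; rewrite dotE -!expr2 !paddr_eq0 ?addr_ge0 ?sqr_ge0 // !sqrf_eq0.
by case/andP => /andP[/eqP h0 /eqP h1] /eqP h2; apply: rV3P; rewrite mxE.
Qed.

Lemma dot_gt0 u : u != 0 -> 0 < dot u u.
Proof.
by move=> u0; rewrite lt0r dot_ge0 andbT; apply: contra u0 => /eqP/dot_eq0->.
Qed.

Lemma lagrange_id u v :
  dot (cross u v) (cross u v) = dot u u * dot v v - dot u v ^+ 2.
Proof. by rewrite /cross !vecE; ring. Qed.

Lemma coord_le_norm u j : `|u 0 j| <= `|u|.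
Proof.
rewrite /Num.Def.normr/= mx_normrE.
exact: (le_bigmax _ (fun ij : 'I_1 * 'I_3 => `|u ij.1 ij.2|) (0, j)).
Qed.

Lemma norm_leP u (r : R) : 0 <= r -> (forall j, `|u 0 j| <= r) -> `|u| <= r.
Proof.
move=> r0 ur; rewrite [leLHS]/Num.Def.normr/= mx_normrE (bigmax_le _ r0)//=.
by move=> [i j] _; rewrite ord1.
Qed.

Lemma norm_attained u : exists j, `|u| = `|u 0 j|.
Proof.
have [->|u0] := eqVneq u 0; first by exists 0; rewrite mxE !normr0.
have /mx_norm_neq0[[i j] /= uij] : mx_norm u != 0.
  by apply: contra u0 => /eqP/mx_norm_eq0 ->.
by exists j; rewrite [LHS]uij (ord1 i).
Qed.

Lemma dot_le_norm u v : `|dot u v| <= 3 * (`|u| * `|v|).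
Proof.
have h j : `|u 0 j * v 0 j| <= `|u| * `|v|.
  by rewrite normrM ler_pM // coord_le_norm.
rewrite dotE (le_trans (ler_normD _ _)) //.
have := ler_normD (u 0 0 * v 0 0) (u 0 1 * v 0 1).
by move: (h 0) (h 1) (h 2%:R); lra.
Qed.

Lemma norm_sqr_le u : `|u| ^+ 2 <= dot u u.
Proof.
have [j ->] := norm_attained u; rewrite real_normK ?num_real // dotE -!expr2.
move: (sqr_ge0 (u 0 0)) (sqr_ge0 (u 0 1)) (sqr_ge0 (u 0 2%:R)).
by elim/forall3: j; lra.
Qed.

Lemma norm_le_unit u : dot u u = 1 -> `|u| <= 1.
Proof.
by move=> u1; rewrite -(@ler_pXn2r _ 2) ?nnegrE // expr1n -u1 norm_sqr_le.
Qed.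

Lemma dot_unit_itv u v : dot u u = 1 -> dot v v = 1 -> -1 <= dot u v <= 1.
Proof.
move=> u1 v1; have := lagrange_id u v; rewrite u1 v1.
have := dot_ge0 (cross u v) => ? ?.
by rewrite -ler_norml -(@ler_pXn2r _ 2) ?nnegrE // real_normK ?num_real //; lra.
Qed.

(** By the mean value theorem [sin t = t cos c] with [c < t], which is enough
    while [cos t > 1/2]; after that [sin t] exceeds [1/2]. *)
Lemma sin_ge_quarter (t : R) : 0 <= t <= pi / 2 -> t / 4 <= sin t.
Proof.
case/andP; rewrite le_eqVlt => /predU1P[<- _|t0 tpi]; first by rewrite sin0 mul0r.
have pi2 := pihalf_lt2 R; have pi0 := pi_gt0 R.
have st : 0 <= sin t by rewrite sin_ge0_pi // ltW //=; lra.
have [ct|ct] := leP (cos t) (1 / 2).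
  have ct0 : 0 <= cos t by rewrite cos_ge0_pihalf //; apply/andP; split; lra.
  have := sin2cos2 t; nra.
have [c] := @MVT R sin cos 0 t t0 (fun (y : R) _ => is_derive_sin y)
  (continuous_subspaceT (@continuous_sin R)).
rewrite in_itv /= sin0 subr0 subr0 => /andP[c0 ctt] ->.
have : cos t < cos c.
  by rewrite ltr_cos // in_itv /=; apply/andP; split; lra.
nra.
Qed.

Lemma sin_le_id (t : R) : 0 <= t -> sin t <= t.
Proof.
rewrite le_eqVlt => /predU1P[<-|t0]; first by rewrite sin0.
have [c _] := @MVT R sin cos 0 t t0 (fun (y : R) _ => is_derive_sin y)
  (continuous_subspaceT (@continuous_sin R)).
rewrite sin0 subr0 subr0 => ->; have := cos_le1 c; nra.
Qed.

Lemma dot_subE u v : dot u u = 1 -> dot v v = 1 ->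
  dot (u - v) (u - v) = 2 * (1 - dot u v).
Proof. by rewrite !vecE => *; lra. Qed.

(** A chord subtending the angle [t] has length [2 sin (t/2)]. Through this
    identity great-circle distances are comparable to distances of
    coordinates. *)
Lemma chord_sin u v : dot u u = 1 -> dot v v = 1 ->
  0 <= acos (dot u v) / 2 <= pi / 2 /\
  dot (u - v) (u - v) = 4 * sin (acos (dot u v) / 2) ^+ 2.
Proof.
move=> u1 v1; have [] := acos_def (dot_unit_itv u1 v1).
set t := acos _ => /andP[t0 tpi] ct; split; first by apply/andP; split; lra.
rewrite dot_subE // -ct {1}(_ : t = (t / 2) *+ 2); last by rewrite mulr2n; lra.
by rewrite cos_mulr2n cos2sin2 mulr2n; lra.
Qed.

Lemma chord_le_acos u v : dot u u = 1 -> dot v v = 1 ->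
  dot (u - v) (u - v) <= acos (dot u v) ^+ 2.
Proof.
move=> u1 v1; have [/andP[t0 tpi] ->] := chord_sin u1 v1.
set t := acos _ in t0 tpi *.
have := sin_le_id t0; have : 0 <= sin (t / 2) by rewrite sin_ge0_pi //; lra.
nra.
Qed.

Lemma acos_le_chord u v : dot u u = 1 -> dot v v = 1 ->
  acos (dot u v) ^+ 2 <= 16 * dot (u - v) (u - v).
Proof.
move=> u1 v1; have [tb ->] := chord_sin u1 v1.
set t := acos _ in tb *.
by have := sin_ge_quarter tb; case/andP: tb => t0 _; nra.
Qed.

End Vectors.

(** * Hausdorff measure *)

Section HausdorffBasics.
Context {R : realType} {T : Type} (d : T -> T -> R) (s : nat).
Local Open Scope ereal_scope.
Implicit Types (A B : set T).

Lemma lee_pexpe (n : nat) (x y : \bar R) : 0 <= x -> x <= y -> x ^+ n <= y ^+ n.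
Proof.
move=> x0 xy; elim: n => [|n ih]; first by rewrite !expe0.
by rewrite !expeS lee_pmul // expe_ge0.
Qed.

Lemma diam_le (A : set T) (rho : R) : (0 <= rho)%R ->
  (forall x y, A x -> A y -> (d x y <= rho)%R) -> diam d A <= rho%:E.
Proof.
move=> rho0 h; rewrite /diam ge_max lee_fin rho0 /=.
by apply: ge_ereal_sup => _ [[x y] [/= Ax Ay] <-]; rewrite lee_fin h.
Qed.

Lemma gauge_le (A : set T) (rho : R) : (0 <= rho)%R ->
  (forall x y, A x -> A y -> (d x y <= rho)%R) ->
  hausdorff_gauge d s A <= (rho ^+ s)%:E.
Proof.
move=> rho0 h; rewrite /hausdorff_gauge; case: ifP => _.
  by rewrite lee_fin exprn_ge0.
by rewrite EFin_expe; apply: lee_pexpe; [exact: diam_ge0|exact: diam_le].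
Qed.

(** Every upper bound on a measure comes from finitely many cells of diameter
    at most [rho], with [rho] arbitrarily small. Enumerating [P] turns them
    into a sequence; the cells beyond the enumeration are empty and contribute
    nothing. *)
Lemma hausdorff_le_cover A (M : R) :
  (forall delta : R, (0 < delta)%R -> exists (W : finType) (P : pred W)
     (F : W -> set T) (rho : R),
    [/\ (0 <= rho <= delta)%R,
        forall x, A x -> exists2 w, P w & F w x,
        forall w x y, P w -> F w x -> F w y -> (d x y <= rho)%R
      & (#|P|%:R * rho ^+ s <= M)%R]) ->
  hausdorff d s A <= M%:E.
Proof.
move=> h; apply: ge_ereal_sup => _ [delta /= delta0 <-].
have [W [P [F [rho [/andP[rho0 rhod] AF Frho cardM]]]]] := h _ delta0.
pose G k : set T := [set x | exists i : 'I_#|P|, i = k :> nat /\ F (enum_val i) x].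
have Grho k x y : G k x -> G k y -> (d x y <= rho)%R.
  move=> [i [ik Fix]] [j [jk Fjy]].
  have ij : i = j by apply: val_inj; rewrite /= ik jk.
  by rewrite -ij in Fjy; exact: Frho (enum_valP i) Fix Fjy.
have cG : delta_cover d delta A G.
  split=> [x Ax|k].
    have [w Pw Fw] := AF _ Ax; exists (enum_rank_in Pw w) => //=.
    by exists (enum_rank_in Pw w); rewrite enum_rankK_in.
  by apply: (@le_trans _ _ rho%:E); rewrite ?lee_fin //; apply: diam_le => //; exact: Grho.
apply: le_trans (ereal_inf_lbound _) _.
  by exists G; [exact: cG|reflexivity].
have G0 k : (#|P| <= k)%N -> hausdorff_gauge d s (G k) = 0.
  move=> Pk; rewrite (_ : G k = set0) ?hausdorff_gauge0 // -subset0 => x [i [ik _]].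
  by move: (ltn_ord i); rewrite ik ltnNge Pk.
rewrite (nneseries_split 0 #|P|) => [|k _]; last exact: hausdorff_gauge_ge0.
rewrite [X in _ + X]eseries0 => [|k Pk _]; last exact: G0.
rewrite adde0 add0n; apply: (@le_trans _ _ (\sum_(0 <= k < #|P|) (rho ^+ s)%:E)).
  by apply: lee_sum => k _; apply: gauge_le => //; exact: Grho.
by rewrite sumEFin lee_fin sumr_const_nat subn0 -mulr_natl.
Qed.

Lemma hausdorff_null A :
  (forall e : R, (0 < e)%R -> hausdorff d s A <= e%:E) -> hausdorff d s A = 0.
Proof.
move=> h; apply/eqP; rewrite eq_le hausdorff_ge0 andbT.
by apply/lee_addgt0Pr => e e0; rewrite add0e h.
Qed.

Lemma hausdorff_null_bigcup (A : nat -> set T) :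
  (forall k, hausdorff d s (A k) = 0) -> hausdorff d s (\bigcup_k A k) = 0.
Proof.
move=> h; apply/eqP; rewrite eq_le hausdorff_ge0 andbT.
apply: le_trans (hausdorff_sigma_subadditive _ _ _) _.
by rewrite eseries0 // => k _ _; exact: h.
Qed.

Lemma hausdorffU A B : hausdorff d s (A `|` B) <= hausdorff d s A + hausdorff d s B.
Proof. exact: (outer_measureU2 (hausdorff d s)). Qed.

Lemma hausdorff_fin_cover (I : finType) (B : I -> set T) A :
  A `<=` [set x | exists i, B i x] ->
  hausdorff d s A <= \sum_i hausdorff d s (B i).
Proof.
move=> AB; apply: (@le_trans _ _ (hausdorff d s (\big[setU/set0]_i B i))).
  apply: le_hausdorff => x /AB[i Bix].
  by rewrite (bigD1 i) //=; left.
elim/big_ind2 : _ => [|X x Y y hx hy|//]; first by rewrite hausdorff0.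
by apply: le_trans (hausdorffU _ _) _; exact: leeD.
Qed.

(** Pulling back a cover of [A] increases no diameter. The gauge of the empty
    set is zero by convention, which is why empty preimages are treated apart.
    *)
Lemma hausdorff_isometry (f : T -> T) A :
  (forall x y, d (f x) (f y) = d x y) ->
  hausdorff d s (f @^-1` A) <= hausdorff d s A.
Proof.
move=> isof.
have dF (F : set T) : diam d (f @^-1` F) <= diam d F.
  apply: (le_max2 (lexx _)); apply: ereal_sup_le => _ [[x y] [/= Fx Fy] <-].
  by exists (f x, f y); rewrite ?isof.
have gF (F : set T) : hausdorff_gauge d s (f @^-1` F) <= hausdorff_gauge d s F.
  rewrite {1}/hausdorff_gauge; case: ifP => [_|/negbT f0]; first exact: hausdorff_gauge_ge0.
  have F0 : F != set0.
    by apply: contra f0 => /eqP ->; rewrite preimage_set0.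
  by rewrite /hausdorff_gauge (negbTE F0); apply: lee_pexpe; rewrite ?diam_ge0.
apply: ge_ereal_sup => _ [delta /= delta0 <-].
apply: (@le_trans _ _ (hausdorff_delta d s delta A)); last first.
  by apply: ereal_sup_ubound; exists delta.
apply: le_ereal_inf_tmp => _ [F [AF dd] <-].
apply: (@le_trans _ _ (\sum_(k <oo) hausdorff_gauge d s (f @^-1` (F k)))).
  apply: ereal_inf_lbound; exists (fun k => f @^-1` (F k)) => //; split.
    by move=> x /AF [k _ Fk]; exists k.
  by move=> k; exact: le_trans (dF _) (dd k).
by apply: lee_nneseries => [k _ _|k _]; [exact: hausdorff_gauge_ge0|exact: gF].
Qed.

End HausdorffBasics.

(** * The space of hexagons *)

Section PolBasics.
Context {R : realType}.
Implicit Types (e f : pol R).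

Definition edge e i : 'rV[R]_3 := row i (val e).

Lemma edge_unit e i : dot (edge e i) (edge e i) = 1.
Proof. by have /andP[/forallP/(_ i)/eqP] := valP e. Qed.

Lemma edge_sum e : \sum_i edge e i = 0.
Proof. by have /andP[_ /eqP] := valP e. Qed.

Lemma edge_norm e i : `|edge e i| <= 1.
Proof. exact/norm_le_unit/edge_unit. Qed.

Lemma pol_ext e f : (forall i, edge e i = edge f i) -> e = f.
Proof. by move=> h; apply/val_inj/row_matrixP. Qed.

Lemma mk_pol (E : 'I_6 -> 'rV[R]_3) :
  (forall i, dot (E i) (E i) = 1) -> \sum_i E i = 0 ->
  exists e : pol R, forall i, edge e i = E i.
Proof.
move=> E1 E0; have hE : is_hexagon (\matrix_i E i).
  apply/andP; split; first by apply/forallP => i; rewrite rowK E1.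
  by under eq_bigr do rewrite rowK; rewrite E0.
by exists (exist (fun E => is_true (is_hexagon E)) _ hE) => i; rewrite /edge /= rowK.
Qed.

(** The squared angle is at most 16 times the squared chord, which is at most
    [3 * eta ^+ 2]; six such terms add up to [288 * eta ^+ 2], and [288 <= 17
    ^ 2]. *)
Lemma pol_dist_le (eta : R) e f :
  (forall i, `|edge e i - edge f i| <= eta) -> pol_dist e f <= 17 * eta.
Proof.
move=> h; have eta0 : 0 <= eta by exact: le_trans (normr_ge0 _) (h 0).
have h2 i : acos (dot (edge e i) (edge f i)) ^+ 2 <= 48 * eta ^+ 2.
  apply: le_trans (acos_le_chord (edge_unit e i) (edge_unit f i)) _.
  have := dot_le_norm (edge e i - edge f i) (edge e i - edge f i).
  rewrite ger0_norm ?dot_ge0 // => h1.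
  have := h i; have := normr_ge0 (edge e i - edge f i); nra.
rewrite /pol_dist -[leRHS]ger0_norm; last by rewrite mulr_ge0.
rewrite -sqrtr_sqr ler_wsqrtr //.
apply: (@le_trans _ _ (\sum_(i < 6) 48 * eta ^+ 2)); first by apply: ler_sum => i _; exact: h2.
by rewrite sumr_const card_ord -mulr_natr; have := sqr_ge0 eta; nra.
Qed.

Lemma edge_le_pol_dist e f i : `|edge e i - edge f i| <= pol_dist e f.
Proof.
rewrite -[leLHS]ger0_norm // -sqrtr_sqr ler_wsqrtr //.
apply: le_trans (norm_sqr_le _) _.
apply: le_trans (chord_le_acos (edge_unit e i) (edge_unit f i)) _.
rewrite (bigD1 i) //= lerDl sumr_ge0 // => j _; exact: sqr_ge0.
Qed.

Lemma perm_pol_subproof (s : 'S_6) e : is_hexagon (row_perm s (val e)).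
Proof.
have rE i : row i (row_perm s (val e)) = edge e (s i).
  by apply/rowP => j; rewrite !mxE.
apply/andP; split; first by apply/forallP => i; rewrite rE edge_unit.
under eq_bigr do rewrite rE.
by rewrite -[eqbRHS](edge_sum e) [eqbRHS](reindex_inj (@perm_inj _ s)).
Qed.

Definition perm_pol (s : 'S_6) e : pol R :=
  exist (fun E => is_true (is_hexagon E)) _ (perm_pol_subproof s e).

Lemma edge_perm (s : 'S_6) e i : edge (perm_pol s e) i = edge e (s i).
Proof. by apply/rowP => j; rewrite !mxE. Qed.

Lemma perm_pol_isometry (s : 'S_6) e f :
  pol_dist (perm_pol s e) (perm_pol s f) = pol_dist e f.
Proof.
rewrite /pol_dist [in RHS](reindex_inj (@perm_inj _ s)); congr Num.sqrt.
by apply: eq_bigr => i _; rewrite -!/(edge _ _) !edge_perm.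
Qed.

Lemma pol_measure_perm (s : 'S_6) (A : set (pol R)) :
  (pol_measure (perm_pol s @^-1` A) <= pol_measure A)%E.
Proof. exact/hausdorff_isometry/perm_pol_isometry. Qed.

End PolBasics.

(** * A net on the sphere *)

Section Counting.
Context {R : realType}.

Lemma card_pair (X Y : finType) (P : pred (X * Y)) :
  #|P| = (\sum_x #|[pred y | P (x, y)]|)%N.
Proof.
rewrite -sum1_card (eq_bigl (fun p : X * Y => xpredT p.1 && P (p.1, p.2))); last by case.
rewrite -(pair_big_dep xpredT (fun x y => P (x, y)) (fun _ _ => 1%N)) /=.
by apply: eq_bigr => x _; rewrite -sum1_card.
Qed.

Lemma card_swap (X Y : finType) (P : pred (X * Y)) :
  #|P| = #|[pred p : Y * X | P (p.2, p.1)]|.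
Proof.
rewrite [RHS]card_pair card_pair; under eq_bigr do rewrite -sum1_card.
rewrite (exchange_big_dep xpredT) //=.
by apply: eq_bigr => y _; rewrite -sum1_card; apply: eq_bigl => x.
Qed.

(** The indices lie above the smallest one at distance at most [L]. *)
Lemma card_window (m : nat) (P : pred 'I_m) (L : R) : 0 <= L ->
  (forall i j, P i -> P j -> i%:R - j%:R <= L) -> (#|P|)%:R <= L + 1.
Proof.
move=> L0 h; have [i0 Pi0|/eq_card0 ->] := pickP P; last by rewrite addr_ge0.
case: (arg_minnP (fun i : 'I_m => nat_of_ord i) Pi0) => i1 Pi1 mini.
pose l := Num.truncn L; pose f (i : 'I_m) : 'I_l.+1 := inord (i - i1).
have lb i : P i -> (i - i1 <= l)%N.
  move=> Pi; rewrite /l truncn_ge_nat // natrB; last exact: mini.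
  exact: h.
have finj : {in P &, injective f}.
  move=> i j Pi Pj /(congr1 val); rewrite /= !inordK ?ltnS ?lb // => ij.
  by apply: val_inj => /=; rewrite -(subnK (mini _ Pi)) ij subnK // mini.
have /leq_card_in := finj; rewrite card_ord -(ler_nat R) => /le_trans; apply.
by rewrite -natr1 lerD2r truncn_le.
Qed.

Lemma card_lines (m m' : nat) (P : pred ('I_m * 'I_m')) (L : R) : 0 <= L ->
  (forall i i' j, P (i, j) -> P (i', j) -> i%:R - i'%:R <= L) ->
  (#|P|)%:R <= m'%:R * (L + 1).
Proof.
move=> L0 h; rewrite card_swap card_pair natr_sum.
apply: (@le_trans _ _ (\sum_(j < m') (L + 1))).
  by apply: ler_sum => j _; apply: card_window => // i i'; exact: h.
by rewrite sumr_const card_ord mulr_natl.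
Qed.

Lemma card_box (m m' : nat) (P : pred ('I_m * 'I_m')) (L : R) : 0 <= L ->
  (forall p q, P p -> P q -> p.1%:R - q.1%:R <= L /\ p.2%:R - q.2%:R <= L) ->
  (#|P|)%:R <= (L + 1) ^+ 2.
Proof.
move=> L0 h.
pose P1 := [pred i | [exists j, P (i, j)]]; pose P2 := [pred j | [exists i, P (i, j)]].
have sub : (#|P| <= #|predX P1 P2|)%N.
  apply/subset_leq_card/fintype.subsetP => -[i j] Pij.
  by rewrite !inE; apply/andP; split; apply/existsP; [exists j|exists i].
rewrite cardX in sub; apply: (@le_trans _ _ (#|P1| * #|P2|)%:R); first by rewrite ler_nat.
rewrite natrM expr2 ler_pM //; apply: card_window => // i i'.
  by move=> /existsP[j Pij] /existsP[j' Pij']; have [] := h _ _ Pij Pij'.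
by move=> /existsP[j Pij] /existsP[j' Pij']; have [] := h _ _ Pij Pij'.
Qed.

End Counting.

Section Net.
Context {R : realType}.
Implicit Types (e x y : 'rV[R]_3).

(** Each face of the cube [[-1, 1] ^ 3] carries a square grid of mesh [1/n],
    which is projected radially to the sphere. The components of an index are
    the axis of the face, its sign, and a point of the grid. *)
Definition net_index n : finType :=
  (('I_3 * bool) * ('I_n.*2.+1 * 'I_n.*2.+1))%type.

Definition grid n (i : 'I_n.*2.+1) : R := (i%:R - n%:R) / n%:R.

(** The coordinates other than [c] are taken in cyclic order, which makes the
    three axes alike; see [forall3_from] and [sum3_from]. *)
Definition cube_point (c : 'I_3) (a b : R) : 'rV[R]_3 :=
  \row_j (if j == c then 1 else if j == c + 1 then a else b).

Definition cube_norm (a b : R) : R := Num.sqrt (1 + a ^+ 2 + b ^+ 2).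

Definition net n (v : net_index n) : 'rV[R]_3 :=
  ((-1) ^+ v.1.2 / cube_norm (grid v.2.1) (grid v.2.2)) *:
    cube_point v.1.1 (grid v.2.1) (grid v.2.2).

Lemma I3_add :
  (0 + 1 = 1 :> 'I_3) * (1 + 1 = 2%:R :> 'I_3) * (2%:R + 1 = 0 :> 'I_3) *
  (0 + 2%:R = 2%:R :> 'I_3) * (1 + 2%:R = 0 :> 'I_3) * (2%:R + 2%:R = 1 :> 'I_3).
Proof. by do !split; apply: val_inj. Qed.

Lemma cube_pointE c a b : (cube_point c a b 0 c = 1) *
  (cube_point c a b 0 (c + 1) = a) * (cube_point c a b 0 (c + 2%:R) = b).
Proof. by elim/forall3: c; rewrite !I3_add !mxE. Qed.

Lemma forall3_from c (P : 'I_3 -> Prop) :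
  P c -> P (c + 1) -> P (c + 2%:R) -> forall i, P i.
Proof. by elim/forall3: c; rewrite !I3_add => *; apply: forall3. Qed.

Lemma sum3_from c (F : 'I_3 -> R) : \sum_i F i = F c + F (c + 1) + F (c + 2%:R).
Proof. by rewrite sum3; elim/forall3: c; rewrite !I3_add; ring. Qed.

Lemma dot_cube_point c a b x :
  dot (cube_point c a b) x = x 0 c + a * x 0 (c + 1) + b * x 0 (c + 2%:R).
Proof. by rewrite /dot (sum3_from c) !cube_pointE mul1r. Qed.

Lemma cube_norm_sqr a b : cube_norm a b ^+ 2 = 1 + a ^+ 2 + b ^+ 2.
Proof. by rewrite sqr_sqrtr // !addr_ge0 ?sqr_ge0. Qed.

Lemma cube_norm_ge1 a b : 1 <= cube_norm a b.
Proof.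
rewrite -[leLHS]sqrtr1 ler_wsqrtr //.
by move: (sqr_ge0 a) (sqr_ge0 b); lra.
Qed.

Lemma cube_norm_le2 a b : `|a| <= 1 -> `|b| <= 1 -> cube_norm a b <= 2.
Proof.
rewrite !ler_norml => /andP[a1 a2] /andP[b1 b2].
have := cube_norm_sqr a b; have := cube_norm_ge1 a b; nra.
Qed.

Lemma grid_itv n (i : 'I_n.*2.+1) : `|grid i| <= 1.
Proof.
case: n i => [|n] i; first by rewrite /grid invr0 mulr0 normr0.
rewrite /grid ler_norml ler_pdivlMr ?ltr0n // ler_pdivrMr ?ltr0n //.
have : (i <= n.+1 + n.+1)%N by rewrite addnn -ltnS.
rewrite -(ler_nat R) natrD.
by have := ler0n R i; move=> *; apply/andP; split; lra.
Qed.

Lemma net_unit n (v : net_index n) : dot (net v) (net v) = 1.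
Proof.
rewrite /net dotZr dotC dotZr dot_cube_point !cube_pointE.
have := cube_norm_sqr (grid v.2.1) (grid v.2.2).
have := cube_norm_ge1 (grid v.2.1) (grid v.2.2).
set N := cube_norm _ _ => N1 N2; rewrite -!expr2 -N2 mulrA -expr2.
rewrite exprMn sqrr_sign mul1r exprVn mulVf // sqrf_eq0; lra.
Qed.

(** Divide the difference of the squares by the sum of the two norms, which is
    at least 2. *)
Lemma cube_norm_lip (a a' b b' r : R) : `|a| <= 1 -> `|a'| <= 1 -> `|b| <= 1 ->
  `|b'| <= 1 -> `|a - a'| <= r -> `|b - b'| <= r ->
  `|cube_norm a b - cube_norm a' b'| <= 2 * r.
Proof.
rewrite !ler_norml => /andP[a1 a2] /andP[c1 c2] /andP[b1 b2] /andP[d1 d2].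
move=> /andP[r1 r2] /andP[r3 r4].
have := cube_norm_sqr a b; have := cube_norm_ge1 a b.
have := cube_norm_sqr a' b'; have := cube_norm_ge1 a' b'.
set N := cube_norm a b; set N' := cube_norm _ _ => N'1 N'2 N1 N2.
have e : (N - N') * (N + N') = (a - a') * (a + a') + (b - b') * (b + b').
  by rewrite -!subr_sqr N2 N'2; ring.
have h1 : -(2 * r) <= (a - a') * (a + a') <= 2 * r by apply/andP; split; nra.
have h2 : -(2 * r) <= (b - b') * (b + b') <= 2 * r by apply/andP; split; nra.
case/andP: h1 => ? ?; case/andP: h2 => ? ?.
have S0 : 2 <= N + N' by lra.
by apply/andP; split; rewrite -(ler_pM2r (x := N + N')) ?e; nra.
Qed.

Lemma card_net n : (0 < n)%N -> (#|net_index n|)%:R <= 54 * n%:R ^+ 2 :> R.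
Proof.
move=> n0; rewrite /net_index !card_prod !card_ord card_bool !natrM.
have : (n.*2.+1)%:R <= 3 * n%:R :> R by rewrite -natrM ler_nat; lia.
by have := ler0n R n.*2.+1; nra.
Qed.

End Net.

Section NetCounts.
Context {R : realType}.
Implicit Types (e x y : 'rV[R]_3).

Lemma grid_approx n (a : R) : (0 < n)%N -> `|a| <= 1 ->
  exists i : 'I_n.*2.+1, `|a - grid i| <= n%:R^-1.
Proof.
move=> n0; rewrite ler_norml => /andP[a1 a2]; have n0' : 0 < n%:R :> R by rewrite ltr0n.
set t := (a + 1) * n%:R; have t0 : 0 <= t by rewrite mulr_ge0 //; lra.
have /andP[t1 t2] := truncn_itv t0.
have tn : (Num.truncn t < n.*2.+1)%N.
  rewrite ltnS -(ler_nat R) (le_trans t1) // -mul2n natrM /t.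
  by rewrite ler_pM2r //; lra.
exists (Ordinal tn); rewrite /grid /=.
have -> : a - ((Num.truncn t)%:R - n%:R) / n%:R = (t - (Num.truncn t)%:R) / n%:R.
  by rewrite /t; field; rewrite gt_eqF.
rewrite ger0_norm ?divr_ge0 ?subr_ge0 // ler_pdivrMr // mulVf ?gt_eqF //.
by rewrite -natr1 in t2; lra.
Qed.

Lemma norm_max_coord e c : dot e e = 1 -> `|e| = `|e 0 c| -> 1 <= 3 * e 0 c ^+ 2.
Proof.
move=> e1 ec; have h j : e 0 j ^+ 2 <= e 0 c ^+ 2.
  rewrite -(real_normK (num_real (e 0 j))) -(real_normK (num_real (e 0 c))).
  by rewrite ler_pXn2r ?nnegrE // -ec coord_le_norm.
move: e1; rewrite /dot (sum3_from c) -!expr2.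
by have := h (c + 1); have := h (c + 2%:R); lra.
Qed.

(** The face is that of the largest coordinate of [e] in absolute value. The
    nearest grid point is within [1/n] of the radial projection of [e] to this
    face, and normalization costs a factor 3. *)
Lemma net_approx n e : (0 < n)%N -> dot e e = 1 ->
  exists v : net_index n, `|e - net v| <= 3 / n%:R.
Proof.
move=> n0 e1; have [c ec] := norm_attained e; have ec3 := norm_max_coord e1 ec.
have ec0 : e 0 c != 0 by apply/eqP => h; move: ec3; rewrite h; lra.
have ratio j : `|e 0 j / e 0 c| <= 1.
  by rewrite normf_div ler_pdivrMr ?normr_gt0 // mul1r -ec coord_le_norm.
set a := e 0 (c + 1) / e 0 c; set b := e 0 (c + 2%:R) / e 0 c.
have a1 : `|a| <= 1 by exact: ratio.
have b1 : `|b| <= 1 by exact: ratio.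
have [i ia] := grid_approx n0 a1; have [k kb] := grid_approx n0 b1.
exists ((c, e 0 c < 0), (i, k)); rewrite /net /=.
have a'1 := grid_itv (R := R) i; have b'1 := grid_itv (R := R) k.
set a' := grid i in ia a'1 *; set b' := grid k in kb b'1 *.
have nN : cube_norm a b = `|e 0 c|^-1.
  apply/eqP; rewrite -(@eqrXn2 _ 2) ?invr_ge0 //; last by rewrite (le_trans ler01) ?cube_norm_ge1.
  rewrite cube_norm_sqr exprVn real_normK ?num_real //.
  rewrite -[X in _ == X]mulr1 -[X in _ == _ * X]e1 /dot (sum3_from c) -!expr2 /a /b.
  by apply/eqP; field.
have Nlip := cube_norm_lip a1 a'1 b1 b'1 ia kb.
have N1 := cube_norm_ge1 a b; have N'1 := cube_norm_ge1 a' b'.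
have sg := numEsign (e 0 c); set s : R := (-1) ^+ _ in sg *.
have s1 : `|s| = 1 by rewrite normr_sign.
have -> : e = (s / cube_norm a b) *: cube_point c a b.
  rewrite nN invrK -sg; apply/rowP; elim/(forall3_from (c := c)); rewrite mxE !cube_pointE ?mulr1 //.
    by rewrite /a mulrCA mulfV // mulr1.
  by rewrite /b mulrCA mulfV // mulr1.
move: Nlip N1 N'1; set N := cube_norm a b; set N' := cube_norm a' b' => Nlip N1 N'1.
have key (t t' : R) : `|t'| <= 1 -> `|t - t'| <= n%:R^-1 -> `|t / N - t' / N'| <= 3 / n%:R.
  move=> t1 tt; clear - n0 N1 N'1 Nlip t1 tt.
  have -> : t / N - t' / N' = ((t - t') - t' / N' * (N - N')) / N.
    by field; apply/andP; split; lra.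
  rewrite normf_div [`|N|]gtr0_norm ?ler_pdivrMr; try lra.
  apply: le_trans (ler_normB _ _) _; rewrite normrM normf_div [`|N'|]gtr0_norm; last lra.
  have t'N : `|t'| / N' <= 1 by rewrite ler_pdivrMr; lra.
  have : 0 <= `|t'| / N' by rewrite divr_ge0 //; lra.
  have : 0 <= `|N - N'| by [].
  have : 0 < (n%:R : R)^-1 by rewrite invr_gt0 ltr0n.
  by move=> *; nra.
apply: norm_leP => [|j]; first by rewrite divr_ge0.
rewrite !mxE -!mulrA -mulrBr normrM s1 mul1r.
rewrite ![_^-1 * _]mulrC; apply: key.
  by case: ifP => _; [rewrite normr1|case: ifP].
case: ifP => _; first by rewrite subrr normr0 invr_ge0.
by case: ifP.
Qed.

Lemma card_charts n (P : pred (net_index n)) (L : R) :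
  (forall cs, (#|[pred ij | P (cs, ij)]|)%:R <= L) -> (#|P|)%:R <= 6 * L.
Proof.
move=> h; rewrite card_pair natr_sum.
apply: le_trans (ler_sum _ (fun cs _ => h cs)) _.
by rewrite sumr_const card_prod card_ord card_bool mulr_natl.
Qed.

Lemma net_coord n (v : net_index n) : 1 / 2 <= `|net v 0 v.1.1 : R|.
Proof.
rewrite mxE cube_pointE mulr1 normf_div normr_sign ger0_norm ?sqrtr_ge0 //.
have := cube_norm_ge1 (R := R) (grid v.2.1) (grid v.2.2).
have := cube_norm_le2 (R := R) (grid_itv v.2.1) (grid_itv v.2.2).
move=> N2 N1; rewrite ler_pdivlMr; lra.
Qed.

(** Grid coordinates are ratios of coordinates of net vectors; this is how the
    closeness of net vectors bounds the differences of their indices. *)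
Lemma net_ratio n (v : net_index n) (c := v.1.1) :
  net v 0 (c + 1) = grid v.2.1 * net v 0 c :> R /\
  net v 0 (c + 2%:R) = grid v.2.2 * net v 0 c :> R.
Proof.
rewrite /net; set k := (_ / _); have := cube_pointE c (grid v.2.1 : R) (grid v.2.2).
rewrite -/c; move: (cube_point _ _ _) => u [[u0 u1] u2].
by rewrite !mxE u0 u1 u2; split; ring.
Qed.

Lemma grid_sub n (i j : 'I_n.*2.+1) : (0 < n)%N ->
  i%:R - j%:R = (grid i - grid j) * n%:R :> R.
Proof. by move=> n0; rewrite /grid; field; rewrite pnatr_eq0 -lt0n. Qed.

(** On each face the grid coordinates are ratios with a denominator of
    absolute value at least [1/2], so they vary by [O(rho)] over the cap and
    the indices range over a square of side [O(rho n)]. *)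
Lemma card_cap n y (rho : R) : (0 < n)%N -> 1 <= rho * n%:R ->
  (#|[pred v : net_index n | `|net v - y| <= rho]|)%:R <= 1734 * (rho * n%:R) ^+ 2.
Proof.
move=> n0 rn; have n0' : 0 < n%:R :> R by rewrite ltr0n.
have rho0 : 0 < rho by rewrite -(pmulr_lgt0 _ n0'); lra.
rewrite (_ : 1734 * _ = 6 * (17 * (rho * n%:R)) ^+ 2); last by ring.
apply: card_charts => -[c s]; apply: le_trans (_ : (16 * (rho * n%:R) + 1) ^+ 2 <= _); last first.
  by apply: lerXn2r; rewrite ?nnegrE; lra.
apply: card_box => [|p q]; first lra.
rewrite /= => hp hq; set u := net _ in hp; set w := net _ in hq.
have uw j : `|u 0 j - w 0 j| <= 2 * rho.
  have -> : u 0 j - w 0 j = (u - y) 0 j - (w - y) 0 j by rewrite !mxE; ring.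
  apply: le_trans (ler_normB _ _) _.
  by move: (coord_le_norm (u - y) j) (coord_le_norm (w - y) j); lra.
have u2 : 1 / 2 <= `|u 0 c| := net_coord ((c, s), p).
have w2 : 1 / 2 <= `|w 0 c| := net_coord ((c, s), q).
have u0 : u 0 c != 0 by rewrite -normr_gt0; lra.
have w0 : w 0 c != 0 by rewrite -normr_gt0; lra.
have main j : u 0 j / u 0 c - w 0 j / w 0 c <= 16 * rho.
  apply: le_trans (ler_norm _) _.
  have -> : u 0 j / u 0 c - w 0 j / w 0 c =
      ((u 0 j - w 0 j) * w 0 c + w 0 j * (w 0 c - u 0 c)) / (u 0 c * w 0 c).
    by field; rewrite ?u0 ?w0.
  have uwc : 1 / 4 <= `|u 0 c| * `|w 0 c| by nra.
  rewrite normf_div [`|u 0 c * _|]normrM ler_pdivrMr; last lra.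
  have W j' : `|w 0 j'| <= 1 by apply: le_trans (coord_le_norm _ _) (norm_le_unit (net_unit _)).
  apply: le_trans (ler_normD _ _) _; rewrite !normrM [`|w 0 c - _|]distrC.
  move: (uw j) (uw c) (W j) (W c) (normr_ge0 (u 0 j - w 0 j)) (normr_ge0 (u 0 c - w 0 c)).
  by move: (normr_ge0 (w 0 j)) (normr_ge0 (w 0 c)) => *; nra.
have rat (r : 'I_n.*2.+1 * 'I_n.*2.+1) (z : 'rV[R]_3) : z 0 c != 0 ->
    z = net ((c, s), r) -> z 0 (c + 1) / z 0 c = grid r.1 /\ z 0 (c + 2%:R) / z 0 c = grid r.2.
  by move=> z0 zE; have [h1 h2] := net_ratio ((c, s), r); rewrite zE in z0 *; rewrite h1 h2 !mulfK.
have [p1 p2] := rat p u u0 erefl; have [q1 q2] := rat q w w0 erefl.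
rewrite !grid_sub // -p1 -q1 -p2 -q2 !mulrA.
by rewrite !ler_pM2r //; split; exact: main.
Qed.

(** The net points nearly orthogonal to [x] lie near a great circle, and there
    are [O(n / |x|)] of them; multiplying by [|x|] includes the case [x = 0].
    On each face the condition is that an affine function of the two grid
    coordinates be small. If one of its two linear coefficients is comparable
    to [|x|], then for each value of the other coordinate the index ranges
    over a window of length [O(1 / |x|)]. *)
Lemma card_slab n x (K : R) : (0 < n)%N -> 0 <= K -> `|x| <= 4 ->
  (#|[pred v : net_index n | `|dot (net v) x| <= K / n%:R]|)%:R * `|x|
    <= (288 * K + 72) * n%:R.
Proof.
move=> n0 K0 x4; have n0' : 0 < n%:R :> R by rewrite ltr0n.
set P := [pred v | _]; have [xs|xl] := leP (`|x| * n%:R) (4 * K).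
  have : (#|P|)%:R <= 54 * n%:R ^+ 2 :> R.
    by apply: le_trans (card_net n0); rewrite ler_nat max_card.
  have := ler0n R #|P|; have := normr_ge0 x => x0 c0 c1.
  apply: (@le_trans _ _ (54 * n%:R ^+ 2 * `|x|)); first exact: ler_wpM2r.
  have -> : 54 * n%:R ^+ 2 * `|x| = 54 * (`|x| * n%:R) * n%:R by ring.
  by rewrite ler_pM2r //; lra.
have xgt0 : 0 < `|x| by rewrite -(pmulr_lgt0 _ n0'); lra.
rewrite -ler_pdivlMr //.
have -> : (288 * K + 72) * n%:R / `|x| = 6 * (3 * n%:R * ((16 * K + 4) / `|x|)).
  by field; rewrite gt_eqF.
apply: card_charts => -[c s].
have key (i j : 'I_n.*2.+1) : P ((c, s), (i, j)) ->
    `|x 0 c + grid i * x 0 (c + 1) + grid j * x 0 (c + 2%:R)| * n%:R <= 2 * K.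
  rewrite /P /= /net /= dotC dotZr dotC dot_cube_point normrM normf_div normr_sign.
  have N1 := cube_norm_ge1 (R := R) (grid i) (grid j).
  have := cube_norm_le2 (R := R) (grid_itv i) (grid_itv j).
  rewrite [`|cube_norm _ _|]ger0_norm ?sqrtr_ge0 //; set N := cube_norm _ _ in N1 *.
  move=> N2; rewrite -mulrA mul1r mulrC ler_pdivrMr; last lra.
  move=> h; rewrite -ler_pdivlMr //; apply: le_trans h _.
  by rewrite mulrAC [2 * K]mulrC ler_pM2r ?invr_gt0 // ler_wpM2l.
have count (Q : pred ('I_n.*2.+1 * 'I_n.*2.+1)) (t : R) : `|x| <= 4 * `|t| ->
    (forall i i' j, Q (i, j) -> Q (i', j) -> `|(grid i - grid i') * t| * n%:R <= 4 * K) ->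
    (#|Q|)%:R <= 3 * n%:R * ((16 * K + 4) / `|x|).
  move=> xt Qt; apply: (@le_trans _ _ ((n.*2.+1)%:R * (16 * K / `|x| + 1))); last first.
    rewrite ler_pM ?ler0n //.
    - by rewrite addr_ge0 // divr_ge0 //; lra.
    - by rewrite -natrM ler_nat; lia.
    - by rewrite [leRHS]mulrDl lerD2l ler_pdivlMr // mul1r.
  apply: card_lines => [|i i' j hi hi']; first by rewrite divr_ge0 //; lra.
  rewrite grid_sub // ler_pdivlMr //.
  apply: le_trans (ler_norm _) _; rewrite !normrM normr_id [`|n%:R|]ger0_norm //.
  have := Qt _ _ _ hi hi'; rewrite normrM.
  by have := normr_ge0 (grid (R := R) i - grid i'); nra.
have [h1|h1] := leP `|x| (4 * `|x 0 (c + 1)|).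
  apply: count h1 _ => i i' j /key hi /key hi'.
  have -> : (grid i - grid i') * x 0 (c + 1) =
     (x 0 c + grid i * x 0 (c + 1) + grid j * x 0 (c + 2%:R)) -
     (x 0 c + grid i' * x 0 (c + 1) + grid j * x 0 (c + 2%:R)) by ring.
  apply: le_trans (ler_wpM2r (ltW n0') (ler_normB _ _)) _; lra.
have [h2|h2] := leP `|x| (4 * `|x 0 (c + 2%:R)|).
  rewrite card_swap; apply: count h2 _ => i i' j /key hi /key hi'.
  have -> : (grid i - grid i') * x 0 (c + 2%:R) =
     (x 0 c + grid j * x 0 (c + 1) + grid i * x 0 (c + 2%:R)) -
     (x 0 c + grid j * x 0 (c + 1) + grid i' * x 0 (c + 2%:R)) by ring.
  apply: le_trans (ler_wpM2r (ltW n0') (ler_normB _ _)) _; lra.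
(* The coordinate along the chart axis dominates: no net point of this chart. *)
have xc : `|x| = `|x 0 c|.
  have [j xj] := norm_attained x; move: (normr_ge0 (x 0 (c + 1))) (normr_ge0 (x 0 (c + 2%:R))) => ? ?.
  by elim/(forall3_from (c := c)): j xj => //; lra.
rewrite eq_card0; first by rewrite mulr_ge0 ?divr_ge0 ?mulr_ge0 //; lra.
case=> i j; apply/negbTE/negP => /= /key.
set z := x 0 c + _ + _ => hz.
have : `|x 0 c| <= `|z| + `|x 0 (c + 1)| + `|x 0 (c + 2%:R)|.
  have -> : x 0 c = z - grid i * x 0 (c + 1) - grid j * x 0 (c + 2%:R) by rewrite /z; ring.
  apply: le_trans (ler_normB _ _) _; rewrite lerD //.
    apply: le_trans (ler_normB _ _) _; rewrite lerD // normrM.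
    by rewrite ler_piMl // grid_itv.
  by rewrite normrM ler_piMl // grid_itv.
rewrite -xc => hx; have : `|x| * n%:R <= 2 * (`|z| * n%:R) by nra.
lra.
Qed.

End NetCounts.

(** * Coordinates on the space of hexagons *)

Section NullAndFinite.
Context {R : realType}.
Implicit Types (e f : pol R).

Lemma forall6 (P : 'I_6 -> Prop) :
  P 0 -> P 1 -> P 2%:R -> P 3%:R -> P 4%:R -> P 5%:R -> forall i, P i.
Proof.
move=> p0 p1 p2 p3 p4 p5 [[|[|[|[|[|[|//]]]]]] i6].
- by rewrite (_ : Ordinal _ = 0) //; exact: val_inj.
- by rewrite (_ : Ordinal _ = 1) //; exact: val_inj.
- by rewrite (_ : Ordinal _ = 2%:R) //; exact: val_inj.
- by rewrite (_ : Ordinal _ = 3%:R) //; exact: val_inj.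
- by rewrite (_ : Ordinal _ = 4%:R) //; exact: val_inj.
- by rewrite (_ : Ordinal _ = 5%:R) //; exact: val_inj.
Qed.

Lemma sum6 (V : nmodType) (F : 'I_6 -> V) :
  \sum_i F i = F 0 + F 1 + F 2%:R + F 3%:R + F 4%:R + F 5%:R.
Proof.
rewrite !big_ord_recl big_ord0 addr0 !addrA.
by congr (_ + F _ + F _ + F _ + F _ + F _); exact: val_inj.
Qed.

Lemma ler_norm4 (V : normedZmodType R) (a b c d : V) :
  `|a + b + c + d| <= `|a| + `|b| + `|c| + `|d|.
Proof.
apply: le_trans (ler_normD _ _) _; rewrite lerD2r.
by apply: le_trans (ler_normD _ _) _; rewrite lerD2r ler_normD.
Qed.

(** The measure in dimension [s] is bounded by counting cells of diameter
    [O(1/n)], and [O(n ^ s)] cells even make the measure in the next dimension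
    vanish, as [hausdorff_scale_null] says. *)
Lemma hausdorff_scale_le {T : Type} (d : T -> T -> R) (s : nat) (A : set T) (C M : R) (N0 : nat) :
  0 <= C ->
  (forall n, (0 < n)%N -> (N0 <= n)%N ->
     exists (W : finType) (P : pred W) (F : W -> set T),
     [/\ forall x, A x -> exists2 w, P w & F w x,
         forall w x y, F w x -> F w y -> d x y <= C / n%:R
       & (#|P|)%:R <= M * n%:R ^+ s]) ->
  (hausdorff d s A <= (M * C ^+ s)%:E)%E.
Proof.
move=> C0 h; apply: hausdorff_le_cover => delta delta0.
pose n := maxn N0 (Num.truncn (C / delta)).+1.
have n0 : (0 < n)%N by rewrite /n leq_max orbT.
have n0' : 0 < n%:R :> R by rewrite ltr0n.
have [W [P [F [AF dF cP]]]] := h n n0 (leq_maxl _ _).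
exists W, P, F, (C / n%:R); split=> //.
- rewrite divr_ge0 //= ler_pdivrMr // mulrC -ler_pdivrMr //.
  apply: (@le_trans _ _ (Num.truncn (C / delta)).+1%:R).
    by have := truncn_itv (divr_ge0 C0 (ltW delta0)); case/andP => _ /ltW.
  by rewrite ler_nat leq_maxr.
- by move=> w x y _; exact: dF.
- rewrite expr_div_n mulrA ler_pdivrMr ?exprn_gt0 //.
  by rewrite -mulrA [C ^+ s * _]mulrC mulrA ler_wpM2r // exprn_ge0.
Qed.

Lemma hausdorff_scale_null {T : Type} (d : T -> T -> R) (s : nat) (A : set T) (C M : R) (N0 : nat) :
  0 <= C -> 0 <= M ->
  (forall n, (0 < n)%N -> (N0 <= n)%N ->
     exists (W : finType) (P : pred W) (F : W -> set T),
     [/\ forall x, A x -> exists2 w, P w & F w x,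
         forall w x y, F w x -> F w y -> d x y <= C / n%:R
       & (#|P|)%:R <= M * n%:R ^+ s]) ->
  hausdorff d s.+1 A = 0%E.
Proof.
move=> C0 M0 h; apply: hausdorff_null => eps eps0.
pose N1 := maxn N0 (Num.truncn (M * C ^+ s.+1 / eps)).+1.
have MC0 : 0 <= M * C ^+ s.+1 by rewrite mulr_ge0 // exprn_ge0.
have N1gt : M * C ^+ s.+1 / eps <= N1%:R.
  apply: (@le_trans _ _ (Num.truncn (M * C ^+ s.+1 / eps)).+1%:R).
    by have := truncn_itv (divr_ge0 MC0 (ltW eps0)); case/andP => _ /ltW.
  by rewrite ler_nat leq_maxr.
have N1pos : 0 < N1%:R :> R by rewrite ltr0n leq_max orbT.
apply: (@le_trans _ _ ((M / N1%:R * C ^+ s.+1)%:E)); last first.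
  by rewrite lee_fin mulrAC ler_pdivrMr // [eps * _]mulrC -ler_pdivrMr.
apply: (@hausdorff_scale_le T d s.+1 A C _ N1) => // n n0 n1.
have [|W [P [F [AF dF cP]]]] := h n n0; first exact: leq_trans (leq_maxl _ _) n1.
exists W, P, F; split=> //; apply: le_trans cP _; rewrite exprS mulrA ler_wpM2r ?exprn_ge0 //.
by rewrite -mulrA ler_peMr // mulrC ler_pdivlMr // mul1r ler_nat.
Qed.

(** The sum of the last two edges is determined by the other four, and it
    determines the length [len45] of their difference. There remains the
    direction [dir45] of the difference, a unit vector orthogonal to the sum:
    one parameter besides the eight of the first four edges. *)
Definition sum45 e := edge e 4%:R + edge e 5%:R.
Definition diff45 e := edge e 4%:R - edge e 5%:R.
Definition len45 e : R := Num.sqrt (dot (diff45 e) (diff45 e)).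
Definition dir45 e := (len45 e)^-1 *: diff45 e.

Lemma sum45E e : sum45 e = - (edge e 0 + edge e 1 + edge e 2%:R + edge e 3%:R).
Proof.
have := edge_sum e; rewrite sum6 /sum45 -addrA => /eqP.
by rewrite addrC addr_eq0 => /eqP.
Qed.

Lemma len45_sqr e : len45 e ^+ 2 = dot (diff45 e) (diff45 e).
Proof. by rewrite sqr_sqrtr // dot_ge0. Qed.

Lemma len45_sum e : len45 e ^+ 2 = 4 - dot (sum45 e) (sum45 e).
Proof.
rewrite len45_sqr /sum45 /diff45; have := edge_unit e 4%:R; have := edge_unit e 5%:R.
by rewrite !vecE; lra.
Qed.

Lemma sum45_dir e : dot (dir45 e) (sum45 e) = 0.
Proof.
rewrite /dir45 dotC dotZr (_ : dot _ _ = 0) ?mulr0 // /sum45 /diff45.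
have := edge_unit e 4%:R; have := edge_unit e 5%:R.
by rewrite !vecE; lra.
Qed.

Lemma dir45_unit e : 0 < len45 e -> dot (dir45 e) (dir45 e) = 1.
Proof.
move=> l0; rewrite /dir45 dotZr dotC dotZr -len45_sqr.
by field; rewrite gt_eqF.
Qed.

Lemma norm_sum45 e : `|sum45 e| <= 2.
Proof.
apply: le_trans (ler_normD _ _) _.
by have := edge_norm e 4%:R; have := edge_norm e 5%:R; lra.
Qed.

(** The length [len45] is a square root, and square roots are Lipschitz only
    away from zero; this is the origin of the factor [1 / delta]. *)
Lemma edges_lipschitz (delta eta : R) e f :
  0 < delta <= 1 -> delta <= len45 e -> delta <= len45 f ->
  (forall i : 'I_6, (i < 4)%N -> `|edge e i - edge f i| <= eta) ->
  `|dir45 e - dir45 f| <= eta ->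
  forall i, `|edge e i - edge f i| <= 15 * eta / delta.
Proof.
move=> /andP[d0 d1] de df he hdir.
have eta0 : 0 <= eta by exact: le_trans (normr_ge0 _) hdir.
have ed : eta <= eta / delta by rewrite ler_peMr // invf_ge1.
have hx : `|sum45 e - sum45 f| <= 4 * eta.
  rewrite !sum45E (_ : _ - _ = - ((edge e 0 - edge f 0) + (edge e 1 - edge f 1)
    + (edge e 2%:R - edge f 2%:R) + (edge e 3%:R - edge f 3%:R))); last first.
    by apply/rowP => j; rewrite !mxE; ring.
  rewrite normrN; move: (he 0 isT) (he 1 isT) (he 2%:R isT) (he 3%:R isT) => h0 h1 h2 h3.
  by apply: le_trans (ler_norm4 _ _ _ _) _; lra.
have hl : `|len45 e - len45 f| <= 24 * (eta / delta).
  have : `|len45 e ^+ 2 - len45 f ^+ 2| <= 48 * eta.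
    rewrite !len45_sum (_ : _ - _ = - dot (sum45 e - sum45 f) (sum45 e + sum45 f)); last first.
      by rewrite !vecE; ring.
    rewrite normrN; apply: le_trans (dot_le_norm _ _) _.
    have := ler_normD (sum45 e) (sum45 f); have := norm_sum45 e; have := norm_sum45 f.
    have := normr_ge0 (sum45 e - sum45 f); have := normr_ge0 (sum45 e + sum45 f); nra.
  rewrite subr_sqr normrM [`|len45 e + len45 f|]ger0_norm; last lra.
  rewrite (_ : 24 * _ = 48 * eta / (2 * delta)); last by field; rewrite gt_eqF.
  rewrite ler_pdivlMr; last lra.
  by have := normr_ge0 (len45 e - len45 f); nra.
have le2 : len45 e <= 2.
  have := len45_sum e; have := dot_ge0 (sum45 e); have := sqrtr_ge0 (dot (diff45 e) (diff45 e)).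
  by rewrite -/(len45 e); nra.
have diffE g : delta <= len45 g -> diff45 g = len45 g *: dir45 g.
  by move=> dg; rewrite /dir45 scalerA divff ?scale1r //; lra.
have hy : `|diff45 e - diff45 f| <= 26 * (eta / delta).
  rewrite !diffE // (_ : _ - _ = len45 e *: (dir45 e - dir45 f) + (len45 e - len45 f) *: dir45 f); last first.
    by apply/rowP => j; rewrite !mxE; ring.
  apply: le_trans (ler_normD _ _) _; rewrite [`|len45 e *: _|]normrZ.
  rewrite [`|(len45 e - len45 f) *: _|]normrZ [`|len45 e|]ger0_norm; last lra.
  have : `|dir45 f| <= 1 by apply/norm_le_unit/dir45_unit; lra.
  have := normr_ge0 (dir45 f); have := normr_ge0 (dir45 e - dir45 f).
  have := normr_ge0 (len45 e - len45 f).
  by move=> *; nra.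
have goal4 (s : R) : `|s| = 1 ->
    `|2^-1 *: ((sum45 e - sum45 f) + s *: (diff45 e - diff45 f))| <= 15 * eta / delta.
  move=> s1; rewrite normrZ ger0_norm //.
  have := ler_normD (sum45 e - sum45 f) (s *: (diff45 e - diff45 f)).
  by rewrite normrZ s1 mul1r -mulrA => *; lra.
have i4 (i : 'I_6) : (i < 4)%N -> `|edge e i - edge f i| <= 15 * eta / delta.
  by move=> /he h; rewrite -mulrA; lra.
apply: forall6; try exact: i4.
  rewrite (_ : _ - _ = 2^-1 *: ((sum45 e - sum45 f) + 1 *: (diff45 e - diff45 f))).
    by rewrite goal4 ?normr1.
  by rewrite /sum45 /diff45; apply/rowP => j; rewrite !mxE; field.
rewrite (_ : _ - _ = 2^-1 *: ((sum45 e - sum45 f) + (-1) *: (diff45 e - diff45 f))).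
  by rewrite goal4 ?normrN1.
by rewrite /sum45 /diff45; apply/rowP => j; rewrite !mxE; field.
Qed.

End NullAndFinite.

(** * Finite total measure *)

Section CoverPol.
Context {R : realType}.
Implicit Types (e f : pol R).

Definition net3 n : finType := ((net_index n * net_index n) * net_index n)%type.
Definition net5 n : finType := ((net3 n * net_index n) * net_index n)%type.

Definition near5 n (w : net5 n) e : Prop :=
  [/\ `|edge e 0 - net w.1.1.1.1| <= 3 / n%:R,
      `|edge e 1 - net w.1.1.1.2| <= 3 / n%:R,
      `|edge e 2%:R - net w.1.1.2| <= 3 / n%:R,
      `|edge e 3%:R - net w.1.2| <= 3 / n%:R
    & `|dir45 e - net w.2| <= 3 / n%:R].

Lemma near_dist (V : normedZmodType R) (a b c : V) (r : R) :
  `|a - c| <= r -> `|b - c| <= r -> `|a - b| <= 2 * r.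
Proof.
move=> ac bc; rewrite (_ : a - b = (a - c) - (b - c)); last by rewrite opprB addrA subrK.
by apply: le_trans (ler_normB _ _) _; lra.
Qed.

Lemma near5_cover n e : (0 < n)%N -> 0 < len45 e -> exists w : net5 n, near5 w e.
Proof.
move=> n0 l0.
have [v0 h0] := net_approx n0 (edge_unit e 0).
have [v1 h1] := net_approx n0 (edge_unit e 1).
have [v2 h2] := net_approx n0 (edge_unit e 2%:R).
have [v3 h3] := net_approx n0 (edge_unit e 3%:R).
have [v4 h4] := net_approx n0 (dir45_unit l0).
exists ((((v0, v1), v2), v3), v4); exact: And5 h0 h1 h2 h3 h4.
Qed.

Lemma near5_dist n (w : net5 n) e f delta : (0 < n)%N -> 0 < delta <= 1 ->
  delta <= len45 e -> delta <= len45 f -> near5 w e -> near5 w f ->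
  pol_dist e f <= 1530 / delta / n%:R.
Proof.
move=> n0 d01 de df [e0 e1 e2 e3 e4] [f0 f1 f2 f3 f4].
have /andP[d0 _] := d01.
have : pol_dist e f <= 17 * (15 * (2 * (3 / n%:R)) / delta).
  apply/pol_dist_le/edges_lipschitz => //; last exact: near_dist e4 f4.
  by apply: forall6 => // _; [exact: near_dist e0 f0|exact: near_dist e1 f1|
    exact: near_dist e2 f2|exact: near_dist e3 f3].
move/le_trans; apply; rewrite le_eqVlt; apply/orP; left; apply/eqP.
by field; rewrite pnatr_eq0 -lt0n n0 gt_eqF.
Qed.

Lemma net_norm n (v : net_index n) : `|net v : 'rV[R]_3| <= 1.
Proof. exact/norm_le_unit/net_unit. Qed.

Definition net_sum n (w : net3 n * net_index n) : 'rV[R]_3 :=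
  net w.1.1.1 + net w.1.1.2 + net w.1.2 + net w.2.

Lemma net_sum_near n (w : net5 n) e : near5 w e -> `|- sum45 e - net_sum w.1| <= 12 / n%:R.
Proof.
move=> [e0 e1 e2 e3 _]; rewrite sum45E opprK /net_sum.
rewrite (_ : _ - _ = (edge e 0 - net w.1.1.1.1) + (edge e 1 - net w.1.1.1.2) +
  (edge e 2%:R - net w.1.1.2) + (edge e 3%:R - net w.1.2)); last first.
  by apply/rowP => j; rewrite !mxE; ring.
by apply: le_trans (ler_norm4 _ _ _ _) _; lra.
Qed.

Lemma net_sum_le n (w : net3 n * net_index n) : `|net_sum w| <= 4.
Proof.
apply: le_trans (ler_norm4 _ _ _ _) _.
by move: (net_norm w.1.1.1) (net_norm w.1.1.2) (net_norm w.1.2) (net_norm w.2); lra.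
Qed.

Lemma dot_telescope (b d s x : 'rV[R]_3) :
  dot b s = - dot (d - b) s - dot d (- x - s) - dot d x.
Proof. by rewrite !vecE; ring. Qed.

(** Since [dir45] is orthogonal to [sum45], the net points close to them are
    nearly orthogonal. This cuts the ten parameters of five net points down to
    nine. *)
Lemma near5_slab n (w : net5 n) e : near5 w e ->
  `|dot (net w.2) (net_sum w.1)| <= 72 / n%:R.
Proof.
move=> ew; have [_ _ _ _ e4] := ew; have hs := net_sum_near ew; have s4 := net_sum_le w.1.
have b1 := net_norm w.2; set b : 'rV[R]_3 := net w.2 in b1 e4 *.
rewrite (dot_telescope b (dir45 e) _ (sum45 e)) sum45_dir subr0; apply: le_trans (ler_normB _ _) _; rewrite normrN.
have h1 := dot_le_norm (dir45 e - b) (net_sum w.1).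
have h2 := dot_le_norm (dir45 e) (- sum45 e - net_sum w.1).
have : `|dir45 e| <= 1.
  have [l0|l0] := ltP 0 (len45 e); first by exact/norm_le_unit/dir45_unit.
  rewrite /dir45 (_ : len45 e = 0) ?invr0 ?scale0r ?normr0 //.
  by apply/eqP; rewrite eq_le l0 sqrtr_ge0.
move: (normr_ge0 (dir45 e - b)) (normr_ge0 (net_sum w.1)) (normr_ge0 (dir45 e)).
move: (normr_ge0 (- sum45 e - net_sum w.1)) => *; nra.
Qed.

Definition obtuse45 : set (pol R) := [set e | dot (edge e 4%:R) (edge e 5%:R) <= 0].

Lemma sum_inv_sqr n : \sum_(m < n) (m.+1%:R ^- 2) <= 2 :> R.
Proof.
case: n => [|n]; first by rewrite big_ord0.
suff : \sum_(m < n.+1) (m.+1%:R ^- 2) <= 2 - n.+1%:R^-1 :> R.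
  by move/le_trans; apply; rewrite lerBlDr lerDl invr_ge0.
elim: n => [|n ih]; first by rewrite big_ord1 expr1n invr1; lra.
rewrite big_ord_recr /=; apply: le_trans (lerD ih (lexx _)) _.
have n1 : 0 < n.+1%:R :> R by rewrite ltr0n.
rewrite -subr_ge0 -[n.+2%:R]natr1; set x := n.+1%:R in n1 *.
rewrite (_ : _ - _ = (x * (x + 1) ^+ 2)^-1).
  by rewrite invr_ge0 mulr_ge0 ?exprn_ge0; lra.
by field; apply/andP; split; lra.
Qed.

Definition slab_const : R := 288 * 72 + 72.

Lemma slab_const_ge : 54 <= slab_const.
Proof. by rewrite /slab_const; lra. Qed.

(** The bound [n / |x|] of [card_slab] is spread over layers: the number of [m
    >= 1] with [|x| <= 1/m] is about [1 / |x|]. Summing over [x] then amounts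
    to counting the net points in caps of radius [1/m]. Layers beyond [n] are
    cut off, since for [|x| <= 1/n] the trivial bound [O(n ^ 2)] is as good. *)
Lemma slab_layers n (x : 'rV[R]_3) : (0 < n)%N -> `|x| <= 4 ->
  (#|[pred v : net_index n | `|dot (net v) x| <= 72 / n%:R]|)%:R <=
  slab_const * n%:R * (1 + (#|[pred m : 'I_n | `|x| * m.+1%:R <= 1]|)%:R) :> R.
Proof.
move=> n0 x4; have C54 := slab_const_ge; set P := [pred v | _]; set Q := [pred m | _].
have n0' : 0 < n%:R :> R by rewrite ltr0n.
have slab : (#|P|)%:R * `|x| <= slab_const * n%:R.
  exact: (card_slab n0 (ler0n R 72) x4).
have [xn|xn] := leP (`|x| * n%:R) 1.
  have -> : #|Q| = n.
    rewrite -[RHS](card_ord n); apply: eq_card => m; rewrite !inE.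
    by apply: le_trans xn; rewrite ler_wpM2l // ler_nat.
  have : (#|P|)%:R <= 54 * n%:R ^+ 2 :> R.
    by apply: le_trans (card_net n0); rewrite ler_nat max_card.
  by nra.
have x0 : 0 < `|x| by rewrite -(pmulr_lgt0 _ n0'); lra.
pose t := Num.truncn `|x|^-1.
have xi0 : 0 <= `|x|^-1 by rewrite invr_ge0.
have /andP[t1 t2] := truncn_itv xi0.
rewrite -/t -natr1 in t1 t2.
have tn : (t <= n)%N.
  by rewrite -(ler_nat R); apply: le_trans t1 _; rewrite -div1r ler_pdivrMr // mulrC ltW.
have tQ : (t <= #|Q|)%N.
  rewrite -[leqLHS]card_ord.
  have winj : injective (widen_ord tn) by move=> a b /(congr1 val) /= ?; exact: val_inj.
  rewrite -(card_imset _ winj); apply: subset_leq_card.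
  apply/fintype.subsetP => _ /imsetP[m _ ->]; rewrite !inE /=.
  rewrite -ler_pdivlMl // mulr1; apply: le_trans t1; rewrite ler_nat; exact: ltn_ord.
have : (#|P|)%:R <= slab_const * n%:R * `|x|^-1 by rewrite -/(_ / _) ler_pdivlMr.
move/le_trans; apply; apply: ler_wpM2l; first by rewrite mulr_ge0 //; lra.
apply: le_trans (ltW t2) _; rewrite addrC lerD2l ler_nat //.
Qed.

Definition slab_sum_const : R := slab_const * (54 + 3468).

Lemma slab_sum_const_ge0 : 0 <= slab_sum_const.
Proof. by apply: mulr_ge0; [have := slab_const_ge; lra|lra]. Qed.

(** The singularity [1 / |x|] is integrable in two dimensions: the cap of
    radius [1/m] contains [O((n/m) ^ 2)] net points, and the sum of [1 / m ^
    2] converges. *)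
Lemma slab_sum n (y : 'rV[R]_3) : (0 < n)%N -> `|y| <= 3 ->
  \sum_(u : net_index n)
    (#|[pred v : net_index n | `|dot (net v) (y + net u)| <= 72 / n%:R]|)%:R
  <= slab_sum_const * n%:R ^+ 3 :> R.
Proof.
move=> n0 y3; have n0' : 0 < n%:R :> R by rewrite ltr0n.
apply: (@le_trans _ _ (\sum_(u : net_index n) slab_const * n%:R *
    (1 + (#|[pred m : 'I_n | `|y + net u| * m.+1%:R <= 1]|)%:R))).
  apply: ler_sum => u _; apply: slab_layers => //.
  by apply: le_trans (ler_normD _ _) _; have := net_norm u; lra.
rewrite -mulr_sumr big_split /= sumr_const.
have -> : \sum_(u : net_index n) (#|[pred m : 'I_n | `|y + net u| * m.+1%:R <= 1]|)%:R =
    \sum_(m < n) (#|[pred u : net_index n | `|net u - (- y)| <= m.+1%:R^-1]|)%:R :> R.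
  rewrite -!natr_sum; congr (_%:R); under eq_bigr do rewrite -sum1_card.
  rewrite (exchange_big_dep xpredT) //=; apply: eq_bigr => m _.
  rewrite -sum1_card; apply: eq_bigl => u.
  by rewrite !inE opprK addrC -ler_pdivlMr ?ltr0n // div1r.
have caps : \sum_(m < n) (#|[pred u : net_index n | `|net u - (- y)| <= m.+1%:R^-1]|)%:R
    <= 3468 * n%:R ^+ 2 :> R.
  apply: (@le_trans _ _ (\sum_(m < n) 1734 * n%:R ^+ 2 * m.+1%:R ^- 2)).
    apply: ler_sum => m _; rewrite -mulrA -exprVn -exprMn mulrC [n%:R * _]mulrC [_ * 1734]mulrC.
    by apply: card_cap => //; rewrite mulrC ler_pdivlMr ?ltr0n // mul1r ler_nat.
  rewrite -mulr_sumr; have := sum_inv_sqr n; have := sqr_ge0 (n%:R : R).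
  by nra.
have c := card_net (R := R) n0; have : 0 <= n%:R ^+ 2 :> R by rewrite sqr_ge0.
have C54 := slab_const_ge => n2.
rewrite (_ : _ * n%:R ^+ 3 = slab_const * n%:R * ((54 + 3468) * n%:R ^+ 2)); last first.
  by rewrite /slab_sum_const; move: slab_const => k; ring.
by apply: ler_wpM2l; [rewrite mulr_ge0 //; lra|rewrite mulrDl lerD].
Qed.

Lemma card_fibers (X Y : finType) (P : pred (X * Y)) (L : R) :
  (forall x, (#|[pred y | P (x, y)]|)%:R <= L) -> (#|P|)%:R <= (#|X|)%:R * L.
Proof.
move=> h; rewrite card_pair natr_sum; apply: le_trans (ler_sum _ (fun x _ => h x)) _.
by rewrite sumr_const mulr_natl.
Qed.

Lemma card_fibers2 (X Y Z : finType) (P : pred ((X * Y) * Z)) (L : R) :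
  (forall x, \sum_y (#|[pred z | P ((x, y), z)]|)%:R <= L) -> (#|P|)%:R <= (#|X|)%:R * L.
Proof.
move=> h; rewrite card_pair natr_sum.
rewrite (eq_bigr (fun p : X * Y => (fun x y => (#|[pred z | P ((x, y), z)]|)%:R : R) p.1 p.2)); last by case.
rewrite -(pair_bigA _ (fun x y => (#|[pred z | P ((x, y), z)]|)%:R : R)) /=.
by apply: le_trans (ler_sum _ (fun x _ => h x)) _; rewrite sumr_const mulr_natl.
Qed.

Lemma card_net3 n : (0 < n)%N ->
  (#|net3 n|)%:R <= 54 ^+ 3 * n%:R ^+ 6 :> R.
Proof.
move=> n0; rewrite /net3 (card_prod (_ * _)%type (net_index n)) (card_prod (net_index n) (net_index n)) !natrM; have := card_net (R := R) n0.
rewrite (_ : _ ^+ 3 * _ = (54 * n%:R ^+ 2) * (54 * n%:R ^+ 2) * (54 * n%:R ^+ 2)); last by ring.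
by move=> c; rewrite !ler_pM ?mulr_ge0.
Qed.

(** On this set [len45 >= 1], so that cells have diameter [O(1/n)]. The first
    three edges have [O(n ^ 6)] choices, and the fourth edge together with the
    direction has [O(n ^ 3)]. *)
Lemma obtuse45_finite : (pol_measure obtuse45 < +oo :> \bar R)%E.
Proof.
pose Q n : pred (net5 n) := fun w => `|dot (net w.2) (net_sum w.1)| <= 72 / n%:R :> R.
have obt e : obtuse45 e -> 1 <= len45 e.
  move=> obt; have := edge_unit e 4%:R; have := edge_unit e 5%:R.
  have := len45_sqr e; have := sqrtr_ge0 (dot (diff45 e) (diff45 e)).
  rewrite -/(len45 e) /diff45; move: obt; rewrite /obtuse45 /=.
  by rewrite !vecE; nra.
apply: le_lt_trans (_ : (_ <= ((54 ^+ 3 * slab_sum_const) * (1530 / 1) ^+ 9)%:E)%E) (ltry _).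
apply: (@hausdorff_scale_le _ _ _ _ _ _ _ 0) => [|n n0 _]; first lra.
exists (net5 n), (Q n), (fun w => [set e | obtuse45 e /\ near5 w e]); split.
- move=> e oe; have [|w we] := @near5_cover n e n0; first by have := obt e oe; lra.
  by exists w => //; exact: near5_slab we.
- move=> w e f [/obt oe we] [/obt of_ wf].
  by apply: near5_dist we wf => //; rewrite ltr01 lexx.
apply: le_trans (card_fibers2 (L := slab_sum_const * n%:R ^+ 3) _) _.
  move=> -[[v0 v1] v2].
  apply: (slab_sum (y := net v0 + net v1 + net v2) n0).
  apply: le_trans (ler_normD _ _) _.
  have := ler_normD (net v0 : 'rV[R]_3) (net v1).
  by move: (net_norm v0) (net_norm v1) (net_norm v2); lra.
have k0 := slab_sum_const_ge0.
apply: le_trans (ler_wpM2r _ (card_net3 n0)) _; first by rewrite mulr_ge0 ?exprn_ge0.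
rewrite le_eqVlt; apply/orP; left; apply/eqP.
by move: slab_sum_const => k; ring.
Qed.

End CoverPol.

Lemma exists_perm_map (T : finType) (p l : seq T) :
  uniq p -> uniq l -> size p = size l -> exists s : {perm T}, map s p = l.
Proof.
elim: p l => [|x p ih] [|y l] //=; first by exists 1%g.
move=> /andP[xp up] /andP[yl ul] [/(ih _ up ul)[s sp]].
exists (s * tperm (s x) y)%g; rewrite permM tpermL; congr (_ :: _).
move: yl; rewrite -sp => yl; apply/eq_in_map => z zp; rewrite permM tpermD //.
  by apply: contraNneq xp => /perm_inj ->.
by apply: contraNneq yl => ->; exact: map_f.
Qed.

Section NullSets.
Context {R : realType}.
Implicit Types (e f : pol R).

(** Unit vectors with sum zero cannot all have positive inner products with
    one of them, so up to a permutation the last two edges form an obtuse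
    angle. *)
Lemma total_finite : (pol_measure [set: pol R] < +oo)%E.
Proof.
apply: (@le_lt_trans _ _ (\sum_(s : 'S_6) pol_measure (perm_pol s @^-1` (@obtuse45 R)))%E).
  apply: hausdorff_fin_cover => e _ /=; apply: contrapT => /forallNP h.
  have pos i j : i != j -> 0 < dot (edge e i) (edge e j).
    move=> ij; have [||//|s [s4 s5]] := @exists_perm_map _ [:: 4%:R; 5%:R] [:: i; j].
    - by [].
    - by rewrite /= inE ij.
    rewrite ltNge; apply/negP => ij0; apply: (h s).
    by rewrite /obtuse45 /= !edge_perm s4 s5.
  have := congr1 (dot (edge e 0)) (edge_sum e); rewrite dot0r sum6 !dotDr edge_unit.
  move: (pos 0 1 isT) (pos 0 2%:R isT) (pos 0 3%:R isT) (pos 0 4%:R isT) (pos 0 5%:R isT).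
  lra.
apply: lte_sum_pinfty => s _; exact: le_lt_trans (pol_measure_perm _ _) obtuse45_finite.
Qed.

(** * Null sets of degenerate hexagons *)

Definition parallel45 (b : bool) : set (pol R) :=
  [set e | edge e 4%:R = (-1) ^+ b *: edge e 5%:R].

(** Edges 1, 2, 3 and 5 determine the hexagon, and they have eight parameters.
    *)
Lemma parallel45_null b : pol_measure (parallel45 b) = 0%E.
Proof.
apply: (@hausdorff_scale_null _ _ _ 8 _ 510 (54 ^+ 4) 0) => [||n n0 _]; [lra|by rewrite exprn_ge0|].
pose near (w : (net3 n * net_index n)%type) e :=
  [/\ `|edge e 1 - net w.1.1.1| <= 3 / n%:R, `|edge e 2%:R - net w.1.1.2| <= 3 / n%:R,
      `|edge e 3%:R - net w.1.2| <= 3 / n%:R & `|edge e 5%:R - net w.2| <= 3 / n%:R].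
exists (net3 n * net_index n)%type, xpredT, (fun w => [set e | parallel45 b e /\ near w e]); split.
- move=> e pe.
  have [v1 h1] := net_approx n0 (edge_unit e 1).
  have [v2 h2] := net_approx n0 (edge_unit e 2%:R).
  have [v3 h3] := net_approx n0 (edge_unit e 3%:R).
  have [v5 h5] := net_approx n0 (edge_unit e 5%:R).
  exists (((v1, v2), v3), v5); first by [].
  by split; [exact: pe|exact: And4 h1 h2 h3 h5].
- move=> w e f [pe [e1 e2 e3 e5]] [pf [f1 f2 f3 f5]].
  have h1 := near_dist e1 f1; have h2 := near_dist e2 f2; have h3 := near_dist e3 f3.
  have h5 := near_dist e5 f5.
  have h4 : `|edge e 4%:R - edge f 4%:R| <= 2 * (3 / n%:R).
    by rewrite pe pf -scalerBr normrZ normr_sign mul1r.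
  set r : R := 2 * (3 / n%:R) in h1 h2 h3 h4 h5.
  have rl : r <= 30 / n%:R by rewrite /r mulrA -natrM; apply: ler_wpM2r; [rewrite invr_ge0 ler0n|rewrite ler_nat].
  have h0 : `|edge e 0 - edge f 0| <= 30 / n%:R.
    have E g : edge g 0 = - (edge g 1 + edge g 2%:R + edge g 3%:R + edge g 4%:R + edge g 5%:R) :> 'rV[R]_3.
      have := edge_sum g; rewrite sum6 -!addrA => /eqP; rewrite addr_eq0 => /eqP ->.
      by rewrite !addrA.
    rewrite !E (_ : _ - _ = - ((edge e 1 - edge f 1) + (edge e 2%:R - edge f 2%:R) +
      (edge e 3%:R - edge f 3%:R) + (edge e 4%:R - edge f 4%:R) + (edge e 5%:R - edge f 5%:R))); last first.
      by apply/rowP => j; rewrite !mxE; ring.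
    rewrite normrN; apply: le_trans (ler_normD _ _) _.
    apply: le_trans (lerD (ler_norm4 _ _ _ _) (lexx _)) _.
    rewrite (_ : 30 / _ = r + r + r + r + r); last by rewrite /r; ring.
    by rewrite !lerD.
  rewrite (_ : 510 / _ = 17 * (30 / n%:R)); last by ring.
  apply: pol_dist_le; apply: forall6; first exact: h0.
  - exact: le_trans h1 rl.
  - exact: le_trans h2 rl.
  - exact: le_trans h3 rl.
  - exact: le_trans h4 rl.
  - exact: le_trans h5 rl.
- apply: le_trans (card_fibers (L := 54 * n%:R ^+ 2) _) _.
    by move=> x; apply: le_trans (card_net n0); rewrite ler_nat max_card.
  apply: le_trans (ler_wpM2r _ (card_net3 n0)) _; first by rewrite mulr_ge0 ?exprn_ge0.
  by rewrite le_eqVlt; apply/orP; left; apply/eqP; ring.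
Qed.

Lemma norm_cross_le (u v : 'rV[R]_3) : `|cross u v| <= 2 * (`|u| * `|v|).
Proof.
have h i j : `|u 0 i * v 0 j| <= `|u| * `|v| by rewrite normrM ler_pM // coord_le_norm.
apply: norm_leP => [|j]; first by rewrite !mulr_ge0.
by elim/forall3: j; rewrite /cross vec3E; apply: le_trans (ler_normB _ _) _;
  rewrite mulr2n mulrDl mul1r lerD.
Qed.

(** With [c] the vanishing of the two kinds of triple products, of three edges
    and of two edges and a sum, is treated at once. *)
Definition cross3 (c : bool) (u v w : 'rV[R]_3) : 'rV[R]_3 := cross u (v + c%:R *: w).

Lemma norm_cross3_le c (u v w : 'rV[R]_3) :
  `|u| <= 1 -> `|v| <= 1 -> `|w| <= 1 -> `|cross3 c u v w| <= 4.
Proof.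
move=> u1 v1 w1; apply: le_trans (norm_cross_le _ _) _.
have : `|v + c%:R *: w| <= 2.
  apply: le_trans (ler_normD _ _) _; rewrite normrZ normr_nat.
  by case: c; rewrite ?mul1r ?mul0r; lra.
move: (normr_ge0 u) (normr_ge0 (v + c%:R *: w)) => *; nra.
Qed.

Lemma cross3_lip c (u v w u' v' w' : 'rV[R]_3) (r : R) :
  `|u| <= 1 -> `|v'| <= 1 -> `|w'| <= 1 ->
  `|u - u'| <= r -> `|v - v'| <= r -> `|w - w'| <= r ->
  `|cross3 c u v w - cross3 c u' v' w'| <= 8 * r.
Proof.
move=> u1 v1 w1 hu hv hw.
have -> : cross3 c u v w - cross3 c u' v' w' =
    cross u ((v - v') + c%:R *: (w - w')) + cross3 c (u - u') v' w'.
  by apply: rV3P; rewrite /cross3 /cross !vecE; ring.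
apply: le_trans (ler_normD _ _) _.
have h1 := norm_cross_le u ((v - v') + c%:R *: (w - w')).
have h2 := norm_cross_le (u - u') (v' + c%:R *: w').
have h3 : `|(v - v') + c%:R *: (w - w')| <= 2 * r.
  apply: le_trans (ler_normD _ _) _; rewrite normrZ normr_nat.
  by have := normr_ge0 (w - w'); case: c {h1 h2}; rewrite ?mul1r ?mul0r; lra.
have h4 : `|v' + c%:R *: w'| <= 2.
  apply: le_trans (ler_normD _ _) _; rewrite normrZ normr_nat.
  by case: c {h1 h2 h3}; rewrite ?mul1r ?mul0r; lra.
rewrite -/(cross3 c (u - u') v' w') in h2.
move: (normr_ge0 u) (normr_ge0 (u - u')) (normr_ge0 (v' + c%:R *: w')) h1 h2 h3 h4.
move: (normr_ge0 (v - v' + c%:R *: (w - w'))).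
move: `|_ + _| `|v' + _| `|u| `|u - u'| u1 hu => p q s t *; nra.
Qed.

(** Coplanarity of [e_3] confines it to a great circle. The three thresholds
    keep this circle, the circle of [dir45] and the reconstruction of the last
    two edges away from their singularities. *)
Definition coplanar (c : bool) (delta : R) : set (pol R) :=
  [set e | let m := cross3 c (edge e 0) (edge e 1) (edge e 2%:R) in
    [/\ dot m (edge e 3%:R) = 0, delta <= `|m|, delta <= `|sum45 e| & delta <= len45 e]].

Lemma dot_split (a b m m' : 'rV[R]_3) : dot m a = 0 ->
  dot b m' = - dot (a - b) m' - dot a (m - m').
Proof. by rewrite !vecE => h; lra. Qed.

(** The fourth edge lies in a slab given by the first three, and [dir45] in a
    slab given by the first four: [O(n ^ 6)] times [O(n)] times [O(n)] cells
    in dimension nine. *)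
Lemma coplanar_null_at c (delta : R) : 0 < delta <= 1 ->
  pol_measure (coplanar c delta) = 0%E.
Proof.
move=> d01; have /andP[d0 d1] := d01.
pose m n (w : net3 n) : 'rV[R]_3 := cross3 c (net w.1.1) (net w.1.2) (net w.2).
pose Q n : pred (net5 n) := fun w => [&& `|dot (net w.1.2) (m n w.1.1) : R| <= 108 / n%:R,
  delta / 2 <= `|m n w.1.1|, `|dot (net w.2) (net_sum w.1) : R| <= 72 / n%:R
  & delta / 2 <= `|net_sum w.1| :> R].
pose C4 : R := (288 * 108 + 72) / (delta / 2); pose C5 : R := (288 * 72 + 72) / (delta / 2).
have C40 : 0 <= C4 by apply: divr_ge0; lra.
have C50 : 0 <= C5 by apply: divr_ge0; lra.
apply: (@hausdorff_scale_null _ _ _ 8 _ (1530 / delta) (54 ^+ 3 * (C4 * C5)) (Num.truncn (48 / delta)).+1).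
- by apply: divr_ge0; lra.
- by apply: mulr_ge0; [exact: exprn_ge0|exact: mulr_ge0].
move=> n n0 nN; have n0' : 0 < n%:R :> R by rewrite ltr0n.
have nd : 24 / n%:R <= delta / 2.
  rewrite ler_pdivrMr // mulrAC ler_pdivlMr // [delta * _]mulrC -ler_pdivrMr //.
  apply: (@le_trans _ _ (Num.truncn (48 / delta)).+1%:R); last by rewrite ler_nat.
  have /truncn_itv/andP[_ /ltW] : 0 <= 48 / delta by apply: divr_ge0; lra.
  by apply: le_trans; apply: ler_wpM2r; [rewrite invr_ge0 ltW|lra].
exists (net5 n), (Q n), (fun w => [set e | coplanar c delta e /\ near5 w e]); split.
- move=> e ce; have [_ _ _ dl] := ce.
  have [|w we] := @near5_cover R n e n0; first by apply: lt_le_trans dl.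
  exists w; last by [].
  have [h0 h1 h2 h3 _] := we; have [det0 dm ds _] := ce.
  have hm := cross3_lip c (edge_norm e 0) (net_norm w.1.1.1.2) (net_norm w.1.1.2) h0 h1 h2.
  set me := cross3 c (edge e 0) _ _ in det0 dm hm; rewrite -/(m n w.1.1) in hm.
  have m4 : `|m n w.1.1| <= 4 by apply: norm_cross3_le; exact: net_norm.
  have hs := net_sum_near we.
  have r24 : 8 * (3 / n%:R) = 24 / n%:R :> R by ring.
  have n12 : 12 / n%:R <= 24 / n%:R :> R by apply: ler_wpM2r; [rewrite invr_ge0|rewrite ler_nat].
  apply/and4P; split.
  + have -> : dot (net w.1.2) (m n w.1.1) =
        - dot (edge e 3%:R - net w.1.2) (m n w.1.1) - dot (edge e 3%:R) (me - m n w.1.1).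
      exact: dot_split.
    apply: le_trans (ler_normB _ _) _; rewrite normrN.
    have k1 := dot_le_norm (edge e 3%:R - net w.1.2) (m n w.1.1).
    have k2 := dot_le_norm (edge e 3%:R) (me - m n w.1.1).
    have e31 := edge_norm e 3%:R.
    rewrite (_ : 108 / _ = 3 * ((3 / n%:R) * 4) + 3 * (1 * (8 * (3 / n%:R)))); last by ring.
    by rewrite lerD //; [apply: le_trans k1 _|apply: le_trans k2 _];
      rewrite ler_wpM2l // ler_pM.
  + rewrite r24 in hm; have := ler_normB me (me - m n w.1.1).
    rewrite (_ : me - (me - m n w.1.1) = m n w.1.1); last by rewrite opprB addrC subrK.
    have : `|me| <= `|me - m n w.1.1| + `|m n w.1.1|.
      by rewrite -{1}(subrK (m n w.1.1) me) ler_normD.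
    by move: hm nd dm; clear; lra.
  + exact: near5_slab we.
  + have : `|- sum45 e| <= `|- sum45 e - net_sum w.1| + `|net_sum w.1|.
      by rewrite -{1}(subrK (net_sum w.1) (- sum45 e)) ler_normD.
    by rewrite normrN; move: hs n12 nd ds; clear; lra.
- move=> w e f [[_ _ _ de] we] [[_ _ _ df] wf].
  exact: near5_dist n0 d01 de df we wf.
have C4n : 0 <= C4 * n%:R := mulr_ge0 C40 (ler0n _ _).
have C5n : 0 <= C5 * n%:R := mulr_ge0 C50 (ler0n _ _).
have C45 := mulr_ge0 C4n C5n.
apply: le_trans (card_fibers2 (L := (C4 * n%:R) * (C5 * n%:R)) _) _.
  move=> t; have [mt|mt] := leP (delta / 2) `|m n t|; last first.
    rewrite big1 => [|y _]; first exact: C45.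
    rewrite eq_card0 // => z.
    by rewrite !inE /Q /= (leNgt (delta / 2)) mt andbF.
  have slab (K : R) (x : 'rV[R]_3) : 0 <= K -> `|x| <= 4 -> delta / 2 <= `|x| ->
      (#|[pred v : net_index n | `|dot (net v) x| <= K / n%:R]|)%:R
        <= (288 * K + 72) / (delta / 2) * n%:R.
    move=> K0 x4 xd; rewrite mulrAC ler_pdivlMr; last lra.
    apply: le_trans (card_slab n0 K0 x4); exact: ler_wpM2l.
  have m4 : `|m n t| <= 4 by apply: norm_cross3_le; exact: net_norm.
  rewrite (bigID (fun y : net_index n => `|dot (net y) (m n t)| <= 108 / n%:R)) /=.
  rewrite [X in _ + X]big1 ?addr0; last first.
    move=> y hy; rewrite eq_card0 // => z.
    by rewrite !inE /Q /= (negbTE hy).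
  apply: (@le_trans _ _ (\sum_(y : net_index n | `|dot (net y) (m n t)| <= 108 / n%:R) C5 * n%:R)).
    apply: ler_sum => y _.
    have [sy|sy] := leP (delta / 2) `|net_sum (t, y)|; last first.
      rewrite eq_card0 => [|z]; first exact: C5n.
      by move: sy; rewrite ltNge => /negbTE sy; rewrite !inE /Q /= sy !andbF.
    apply: le_trans (slab 72 _ (ler0n _ _) (net_sum_le _) sy).
    rewrite ler_nat; apply: subset_leq_card; apply/fintype.subsetP => z.
    by rewrite !inE /Q /= => /and4P[].
  rewrite sumr_const -[leLHS]mulr_natl; apply: ler_wpM2r; first exact: C5n.
  apply: le_trans (slab 108 _ (ler0n _ _) m4 mt).
  by rewrite ler_nat; apply: subset_leq_card; apply/fintype.subsetP.
apply: le_trans (ler_wpM2r _ (card_net3 n0)) _; first exact: C45.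
rewrite le_eqVlt; apply/orP; left; apply/eqP.
by clearbody C4 C5; ring.
Qed.

End NullSets.

Section Generic.
Context {R : realType}.
Implicit Types (e f : pol R) (s t : 'S_6).

Definition coplanar0 (c : bool) : set (pol R) :=
  [set e | let m := cross3 c (edge e 0) (edge e 1) (edge e 2%:R) in
    [/\ dot m (edge e 3%:R) = 0, m != 0, sum45 e != 0 & diff45 e != 0]].

(** The sets [coplanar c delta] with [delta = 1 / (k + 1)] exhaust [coplanar0
    c]. *)
Lemma coplanar0_null c : pol_measure (coplanar0 c) = 0%E.
Proof.
apply/eqP; rewrite eq_le hausdorff_ge0 andbT.
rewrite -(@hausdorff_null_bigcup R _ pol_dist 9 (fun k => coplanar c k.+1%:R^-1)); last first.
  move=> k; apply: coplanar_null_at.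
  by rewrite invr_gt0 ltr0n /= invf_le1 ?ltr0n // ler1n.
apply: le_hausdorff => e [m0 m1 s1 d1].
set m := cross3 _ _ _ _ in m0 m1.
have l1 : 0 < len45 e by rewrite sqrtr_gt0 dot_gt0.
pose r := Num.min `|m| (Num.min `|sum45 e| (len45 e)).
have r0 : 0 < r by rewrite !lt_min !normr_gt0 m1 s1.
have ri0 : 0 <= r^-1 by rewrite invr_ge0 ltW.
have /andP[_ /ltW hk] := truncn_itv ri0.
exists (Num.truncn r^-1) => //.
have : (Num.truncn r^-1).+1%:R^-1 <= r.
  by rewrite -[leRHS]invrK lef_pV2 ?posrE ?invr_gt0 ?ltr0n.
by rewrite !le_min => /and3P[h1 h2 h3]; split.
Qed.

(** Outside this set no two edges are parallel, and no triple product of edges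
    vanishes, even if the second one is replaced by a sum of two. The side
    conditions in [coplanar0] lose nothing, because each of them fails only
    when two edges are parallel or when a triple product without a sum
    vanishes. *)
Definition degenerate : set (pol R) :=
  [set e | exists s, (exists b, parallel45 b (perm_pol s e)) \/
                     (exists c, coplanar0 c (perm_pol s e))].

Lemma degenerate_null : pol_measure degenerate = 0%E.
Proof.
apply/eqP; rewrite eq_le hausdorff_ge0 andbT.
pose B (i : 'S_6 * (bool + bool)) : set (pol R) := perm_pol i.1 @^-1`
  match i.2 with inl b => parallel45 b | inr c => coplanar0 c end.
apply: le_trans (@hausdorff_fin_cover _ _ pol_dist 9 _ B degenerate _) _.
  move=> e [s [[b h]|[c h]]]; first by exists (s, inl b).
  by exists (s, inr c).
rewrite big1 // => -[s [b|c]] _; apply/eqP; rewrite eq_le hausdorff_ge0 andbT.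
  by apply: le_trans (pol_measure_perm _ _) _; rewrite parallel45_null.
by apply: le_trans (pol_measure_perm _ _) _; rewrite coplanar0_null.
Qed.

Lemma perm_pol_comp s t e : perm_pol s (perm_pol t e) = perm_pol (s * t)%g e.
Proof. by apply: pol_ext => i; rewrite !edge_perm permM. Qed.

Lemma degenerate_perm t e : degenerate (perm_pol t e) -> degenerate e.
Proof. by move=> [s h]; exists (s * t)%g; rewrite -perm_pol_comp. Qed.

Lemma cross_unit_eq0 (u v : 'rV[R]_3) : dot u u = 1 -> dot v v = 1 ->
  cross u v = 0 -> exists b : bool, u = (-1) ^+ b *: v.
Proof.
move=> u1 v1 c0; have := lagrange_id u v; rewrite c0 dot0r u1 v1 mul1r.
move=> /esym/eqP; rewrite subr_eq0 eq_sym sqrf_eq1 => /orP[] /eqP d.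
  exists false; rewrite scale1r; apply/subr0_eq/dot_eq0.
  by rewrite dot_subE // d subrr mulr0.
exists true; rewrite scaleN1r; apply/eqP; rewrite -subr_eq0 opprK; apply/eqP/dot_eq0.
by move: u1 v1 d; rewrite !vecE => *; lra.
Qed.

Section NonDegenerate.
Variables (e : pol R).
Hypothesis ge : ~ degenerate e.

Lemma generic_cross i j : i != j -> cross (edge e i) (edge e j) != 0.
Proof.
move=> ij; apply/eqP => /(cross_unit_eq0 (edge_unit e i) (edge_unit e j))[b eb].
have [||//|s [s4 s5]] := @exists_perm_map _ [:: 4%:R; 5%:R] [:: i; j].
- by [].
- by rewrite /= inE ij.
by apply: ge; exists s; left; exists b; rewrite /parallel45 /= !edge_perm s4 s5.
Qed.

Lemma generic_last s : sum45 (perm_pol s e) != 0 /\ diff45 (perm_pol s e) != 0.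
Proof.
split; apply/eqP => h; apply: ge; exists s; left; [exists true|exists false].
  by rewrite /parallel45 /= scaleN1r; apply/eqP; rewrite -addr_eq0; apply/eqP.
by rewrite /parallel45 /= scale1r; exact/subr0_eq.
Qed.

Lemma generic_triple i j k : uniq [:: i; j; k] ->
  triple (edge e i) (edge e j) (edge e k) != 0.
Proof.
move=> ijk; apply/eqP => t0.
have [||//|s [s0 s1 s3]] := @exists_perm_map _ [:: 0; 1; 3%:R] [:: i; j; k]; [by []|by []|].
apply: ge; exists s; right; exists false; have [hs hd] := generic_last s.
rewrite /coplanar0 /= !edge_perm s0 s1 s3 /cross3 scale0r addr0; split=> //.
by apply: generic_cross; move: ijk; rewrite /= !inE negb_or => /andP[/andP[]].
Qed.

(** The vector [m] of [coplanar0] is nonzero here, since it has a nonzero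
    inner product with [e_k] by [generic_triple]. *)
Lemma generic_triple2 i j k l : uniq [:: i; j; k; l] ->
  triple (edge e i) (edge e j + edge e k) (edge e l) != 0.
Proof.
move=> ijkl; apply/eqP => t0.
have [||//|s [s0 s1 s2 s3]] := @exists_perm_map _ [:: 0; 1; 2%:R; 3%:R] [:: i; j; k; l]; [by []|by []|].
apply: ge; exists s; right; exists true; have [hs hd] := generic_last s.
rewrite /coplanar0 /= !edge_perm s0 s1 s2 s3 /cross3 scale1r; split=> //.
have : triple (edge e i) (edge e j) (edge e k) != 0.
  by apply: generic_triple; move: ijkl; rewrite /= !inE !negb_or => /and4P[/and3P[-> ->] _ /andP[-> _]].
apply: contraNneq => c0; have -> : triple (edge e i) (edge e j) (edge e k) =
    dot (cross (edge e i) (edge e j + edge e k)) (edge e k).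
  by rewrite /triple /cross !vecE; ring.
by rewrite c0 dotC dot0r.
Qed.

End NonDegenerate.
End Generic.

(** * Positive total measure *)

Section BoxCover.
Context {R : realType}.
Local Open Scope ereal_scope.

Lemma nneseries_ge_term (u : nat -> \bar R) (k : nat) :
  (forall n, 0 <= u n) -> u k <= \sum_(n <oo) u n.
Proof.
move=> u0; apply: le_trans (nneseries_lim_ge k.+1 _); last by move=> *; exact: u0.
by rewrite big_nat_recr //= leeDr // sume_ge0.
Qed.

(** Induction on the dimension. The slice of the box at the last coordinate
    [t] is covered by the cubes whose last interval contains [t], and
    integrating the inequality for slices over [t] supplies the missing side
    lengths. The predicate [P] lets a slice select its cubes. *)
Lemma box_cover_volume (n : nat) (P : pred nat) (c : nat -> nat -> R) (l : nat -> R)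
    (a : nat -> R) (eta : R) :
  (0 <= eta)%R -> (forall k, 0 <= l k)%R ->
  (forall x : nat -> R, (forall i, (i < n)%N -> a i <= x i <= a i + eta)%R ->
     exists2 k, P k & forall i, (i < n)%N -> (`|x i - c k i| <= l k)%R) ->
  (eta ^+ n)%:E <= \sum_(k <oo) (if P k then ((2 * l k) ^+ n)%:E else 0).
Proof.
move=> eta0 l0; elim: n P => [|n ih] P cov.
  have [//|k Pk _] := cov (fun=> 0%R).
  apply: le_trans (nneseries_ge_term k _); first by rewrite Pk !expr0.
  by move=> m; case: ifP => //; rewrite expr0 lee_fin.
pose D : set R := `[a n, (a n + eta)%R]%classic.
pose I k : set R := `[(c k n - l k)%R, (c k n + l k)%R]%classic.
have mD : measurable D by exact: measurable_itv.
have mI k : measurable (I k) by exact: measurable_itv.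
pose f k (t : R) : \bar R := (if P k then ((2 * l k) ^+ n)%:E else 0) * (\1_(I k) t)%:E.
have c0 k : 0 <= (if P k then ((2 * l k) ^+ n)%:E else 0).
  by case: ifP => // _; rewrite lee_fin exprn_ge0 // mulr_ge0.
have f0 k t : 0 <= f k t by rewrite /f mule_ge0 // lee_fin.
have mf k : measurable_fun D (f k).
  apply: emeasurable_funM; first exact: measurable_cst.
  exact/measurable_EFinP/measurable_indic.
have slice t : D t -> (eta ^+ n)%:E <= \sum_(k <oo) f k t.
  rewrite /D /= in_itv /= => Dt.
  apply: le_trans (ih (fun k => P k && (t \in I k)) _) _.
    move=> x xa; have [i|k Pk hk] := cov (fun i => if i == n then t else x i).
      rewrite ltnS leq_eqVlt; case: eqP => [-> _|_] //=; exact: xa.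
    exists k; last first.
      by move=> i i_n; have := hk i (ltnW i_n); rewrite ltn_eqF.
    rewrite Pk /=; have := hk n (ltnSn n); rewrite eqxx ler_norml => /andP[h1 h2].
    by apply/mem_set; rewrite /I /= in_itv /=; apply/andP; split; lra.
  apply: lee_nneseries => [k _ _|k _].
    by case: ifP => // _; rewrite lee_fin exprn_ge0 // mulr_ge0.
  rewrite /f indicE; case: (P k) => /=; last by rewrite mul0e.
  by case: (t \in I k); rewrite ?mule1 ?mule0.
have muD : lebesgue_measure D = eta%:E.
  rewrite lebesgue_measure_itv /= lte_fin; case: ltP => [_|h].
    by rewrite -EFinB addrC addKr.
  by congr (_%:E); apply/le_anti; rewrite eta0 /= ; lra.
have muI k : lebesgue_measure (I k) = (2 * l k)%:E.
  rewrite lebesgue_measure_itv /= lte_fin; case: ltP => [_|h].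
    by rewrite -EFinB; congr (_%:E); ring.
  by congr (_%:E); have := l0 k; lra.
apply: (@le_trans _ _ (\int[lebesgue_measure]_(t in D) \sum_(k <oo) f k t)).
  rewrite exprSr EFinM -muD -integral_cst //.
  have mS : measurable_fun D (fun t => \sum_(k <oo) f k t).
    by apply: ge0_emeasurable_sum => // k t _ _; exact: f0.
  apply: ge0_le_integral => //.
  by move=> t _; rewrite lee_fin exprn_ge0.
rewrite integral_nneseries //.
apply: lee_nneseries => [k _ _|k _]; first by apply: integral_ge0 => t _; exact: f0.
have m1 : measurable_fun D (fun t => (\1_(I k) t)%:E : \bar R).
  exact/measurable_EFinP/measurable_indic.
rewrite /f ge0_integralZl //.
case: (P k); last by rewrite mul0e.
rewrite exprSr EFinM; apply: lee_pmul.
- by rewrite lee_fin exprn_ge0 // mulr_ge0.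
- by apply: integral_ge0 => t _; rewrite lee_fin.
- by [].
rewrite [leLHS](_ : _ = lebesgue_measure (I k `&` D)); last by apply: integral_indic; [exact: mD|exact: mI].
rewrite -muI; apply: le_measure; last exact: subIsetl.
  by apply: mem_set; apply: measurableI; [exact: (mI k)|exact: mD].
by apply: mem_set; exact: (mI k).
Qed.

End BoxCover.

Section Positive.
Context {R : realType}.

(** The coordinates map a set of diameter [l] into a cube of half-side [l]
    around the image of any of its points. So a cover of [A] gives a cover of
    the box by cubes, and their total volume is at least that of the box. *)
Lemma hausdorff_gt0_box {T : Type} (d : T -> T -> R) (s : nat) (A : set T)
    (g : T -> nat -> R) (a : nat -> R) (eta : R) :
  0 < eta ->
  (forall x y i, (i < s)%N -> `|g x i - g y i| <= d x y) ->
  (forall z : nat -> R, (forall i, (i < s)%N -> a i <= z i <= a i + eta) ->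
     exists2 x, A x & forall i, (i < s)%N -> g x i = z i) ->
  (0 < hausdorff d s A)%E.
Proof.
move=> eta0 glip gbox.
have pos : (0 < ((2 ^+ s)^-1 * eta ^+ s)%:E)%E by rewrite lte_fin mulr_gt0 ?invr_gt0 ?exprn_gt0.
apply: lt_le_trans pos _.
apply: (@le_trans _ _ (hausdorff_delta d s 1 A)); last first.
  by apply: ereal_sup_ubound; exists 1 => /=.
apply: le_ereal_inf_tmp => _ [F [AF dF] <-].
have [x0 _ _] : exists2 x, A x & forall i, (i < s)%N -> g x i = a i.
  by apply: gbox => i _; rewrite lexx lerDl ltW.
have [p pF] : {p : nat -> T & forall k, F k !=set0 -> F k (p k)}.
  apply: (@choice _ _ (fun k y => F k !=set0 -> F k y)) => k.
  have [Fk|nF] := pselect (F k !=set0); last by exists x0.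
  by have [y Fy] := cid Fk; exists y.
pose l k : R := fine (diam d (F k)).
have dfin k : diam d (F k) \is a fin_num.
  by rewrite ge0_fin_numE ?diam_ge0 // (le_lt_trans (dF k)) ?ltry.
have l0 k : 0 <= l k by rewrite fine_ge0 ?diam_ge0.
have dl k x : F k x -> d x (p k) <= l k.
  move=> Fx; rewrite -lee_fin fineK // /diam le_max; apply/orP; right.
  apply: ereal_sup_ubound; exists (x, p k) => //=; split=> //.
  by apply: pF; exists x.
rewrite EFinM lee_pdivrMl ?exprn_gt0 //.
apply: le_trans (@box_cover_volume R s (fun k => F k != set0) (fun k => g (p k)) l a eta (ltW eta0) l0 _) _.
  move=> z /gbox[x /AF[k _ Fx] gx]; exists k; first by apply/set0P; exists x.
  by move=> i i_s; rewrite -gx //; apply: le_trans (dl _ _ Fx); exact: glip.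
rewrite -nneseriesZl; last by move=> *; exact: hausdorff_gauge_ge0.
apply: lee_nneseries => [k _ _|k _].
  by case: ifP => // _; rewrite lee_fin exprn_ge0 // mulr_ge0.
rewrite /hausdorff_gauge; case: eqP => _ /=; first by rewrite mule0.
by rewrite -[diam _ _]fineK // -EFin_expe -EFinM lee_fin exprMn.
Qed.

Lemma sqrt_near1 (x y : R) : 0 <= x <= 1 / 100 -> 0 <= y <= 1 / 100 ->
  [/\ Num.sqrt (1 - x ^+ 2 - y ^+ 2) ^+ 2 = 1 - x ^+ 2 - y ^+ 2,
      99 / 100 <= Num.sqrt (1 - x ^+ 2 - y ^+ 2)
    & Num.sqrt (1 - x ^+ 2 - y ^+ 2) <= 1].
Proof.
move=> /andP[x0 x1] /andP[y0 y1].
have x2 : x ^+ 2 <= 1 / 100 * (1 / 100) by rewrite expr2 ler_pM.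
have y2 : y ^+ 2 <= 1 / 100 * (1 / 100) by rewrite expr2 ler_pM.
have s : Num.sqrt (1 - x ^+ 2 - y ^+ 2) ^+ 2 = 1 - x ^+ 2 - y ^+ 2.
  by rewrite sqr_sqrtr //; lra.
split=> //; have := sqrtr_ge0 (1 - x ^+ 2 - y ^+ 2); move: s (sqr_ge0 x) (sqr_ge0 y); set r := Num.sqrt _; nra.
Qed.

Lemma sqr_near1 (x : R) : -103/100 <= x <= -99/100 -> 98/100 <= x ^+ 2 <= 107/100.
Proof. by move=> /andP[h h']; rewrite expr2; apply/andP; split; nra. Qed.

Lemma sqr_quot_itv (b y : R) : 45/100 <= b <= 63/100 -> -103/100 <= y <= -99/100 ->
  (43/100) ^+ 2 <= (b / y) ^+ 2 <= (64/100) ^+ 2.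
Proof.
move=> /andP[b0 b1] /andP[y0 y1]; rewrite -[(b / y) ^+ 2]sqrrN -mulrN -invrN.
have : 43/100 <= b / - y <= 64/100.
  by rewrite ler_pdivlMr ?ler_pdivrMr; [apply/andP; split; lra|lra|lra].
move: (b / - y) => q {b0 b1 y0 y1} /andP[q0 q1].
by apply/andP; split; apply: lerXn2r; rewrite ?nnegrE; lra.
Qed.

(** Here [X] is what the last two edges must add up to. A unit vector [u]
    leaves a unit vector [X - u] exactly when [2 u.X = X.X]. With the first
    coordinate of [u] prescribed, this linear equation gives the second
    coordinate in terms of the third, and the third is a root of a quadratic
    polynomial which changes sign on [[1/2, 9/10]]. *)
Lemma fifth_edge (X : 'rV[R]_3) (a : R) :
  -103/100 <= X 0 0 <= -99/100 -> -103/100 <= X 0 1 <= -99/100 ->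
  -3/100 <= X 0 2%:R <= 1/100 -> -1/2 <= a <= -49/100 ->
  exists u : 'rV[R]_3, [/\ u 0 0 = a, dot u u = 1 & 2 * dot u X = dot X X].
Proof.
have r1 : 0 <= (1/2 : R) <= 1 by apply/andP; split; lra.
have r2 : 0 <= (9/10 : R) <= 1 by apply/andP; split; lra.
move=> /andP[x0 x0'] /andP[x1 x1'] /andP[x2 x2'] /andP[a0 a1].
pose B := dot X X / 2 - a * X 0 0.
pose p : {poly R} := (a ^+ 2 - 1)%:P + (((B%:P - X 0 2%:R *: 'X) * (X 0 1)^-1%:P) ^+ 2 + 'X ^+ 2).
have X10 : X 0 1 != 0 by apply/eqP; lra.
have pE c : p.[c] = a ^+ 2 - 1 + (((B - X 0 2%:R * c) / X 0 1) ^+ 2 + c ^+ 2).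
  by rewrite /p !hornerE.
have /andP[B0 B2] : 46/100 <= B <= 60/100.
  have /andP[h0 h0'] : 98/100 <= X 0 0 ^+ 2 <= 107/100 by apply: sqr_near1; rewrite x0.
  have /andP[h1 h1'] : 98/100 <= X 0 1 ^+ 2 <= 107/100 by apply: sqr_near1; rewrite x1.
  have h2 : 0 <= X 0 2%:R ^+ 2 := sqr_ge0 _.
  have h2' : X 0 2%:R ^+ 2 <= 1/100 by rewrite expr2; clear - x2 x2'; nra.
  have /andP[h3 h3'] : 48/100 <= a * X 0 0 <= 52/100.
    by clear - a0 a1 x0 x0'; apply/andP; split; nra.
  by rewrite /B dotE -!expr2; clear - h0 h0' h1 h1' h2 h2' h3 h3'; apply/andP; split; lra.
have q c : 0 <= c <= 1 -> (43/100) ^+ 2 <= ((B - X 0 2%:R * c) / X 0 1) ^+ 2 <= (64/100) ^+ 2.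
  move=> /andP[c0 c1]; apply: sqr_quot_itv; last by rewrite x1.
  by clear - B0 B2 c0 c1 x2 x2'; clearbody B; apply/andP; split; nra.
have /andP[a2 a2'] : 24/100 <= a ^+ 2 <= 25/100.
  by rewrite expr2; clear - a0 a1; apply/andP; split; nra.
have [| |c /andP[c0 c1] /rootP pc] := @poly_ivt R p (1/2) (9/10); first by clear; lra.
  rewrite !pE; have /andP[q1 q1'] := q _ r1; have /andP[q2 q2'] := q _ r2.
  by clear - a2 a2' q1 q1' q2 q2'; apply/andP; split; lra.
exists (vec3 a ((B - X 0 2%:R * c) / X 0 1) c); split; rewrite ?vec3E //.
  by move: pc; rewrite pE dotE !vec3E -!expr2; clear; lra.
rewrite [dot _ X]dotE !vec3E mulfVK //.
by rewrite /B; field.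
Qed.

End Positive.

Section PolPositive.
Context {R : realType}.

(** Nine coordinates which parametrize the hexagons near the one with [e_0 =
    (0, 0, 1)], [e_1 = (0, 0, -1)], [e_2 = (0, 1, 0)], [e_3 = (1, 0, 0)] and
    [e_4 = (-1/2, -1/2, sqrt (1/2))]. *)
Definition box_coords (e : pol R) (i : nat) : R :=
  [:: edge e 0 0 0; edge e 0 0 1; edge e 1 0 0; edge e 1 0 1; edge e 2%:R 0 0;
      edge e 2%:R 0 2%:R; edge e 3%:R 0 1; edge e 3%:R 0 2%:R; edge e 4%:R 0 0]`_i.

Lemma sum_near1 (b c d s : R) : 0 <= b <= 1/100 -> 0 <= c <= 1/100 ->
  0 <= d <= 1/100 -> 99/100 <= s <= 1 -> -103/100 <= - (b + c + d + s) <= -99/100.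
Proof.
move=> /andP[? ?] /andP[? ?] /andP[? ?] /andP[? ?].
by apply/andP; split; lra.
Qed.

Lemma sum_near0 (b c s t : R) : 0 <= b <= 1/100 -> 0 <= c <= 1/100 ->
  99/100 <= s <= 1 -> 99/100 <= t <= 1 -> -3/100 <= - (s - t + b + c) <= 1/100.
Proof.
move=> /andP[? ?] /andP[? ?] /andP[? ?] /andP[? ?].
by apply/andP; split; lra.
Qed.

Lemma pol_measure_gt0 : (0 < pol_measure [set: pol R])%E.
Proof.
pose a (i : nat) : R := if i == 8%N then -1/2 else 0.
apply: (@hausdorff_gt0_box _ _ pol_dist 9 _ box_coords a (1/100)); first lra.
  move=> e f i i9.
  have h k j : `|edge e k 0 j - edge f k 0 j| <= pol_dist e f.
    apply: le_trans (edge_le_pol_dist e f k).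
    by apply: le_trans (coord_le_norm _ j); rewrite !mxE.
  by do 9 (case: i i9 => [_|i i9]; first exact: h).
move=> z hz.
have z0 i : (i < 8)%N -> 0 <= z i <= 1/100.
  by move=> i8; have := hz i (ltnW i8); rewrite /a ltn_eqF // add0r.
have [q0 l0 u0] := sqrt_near1 (z0 0 isT) (z0 1 isT).
have [q1 l1 u1] := sqrt_near1 (z0 2 isT) (z0 3 isT).
have [q2 l2 u2] := sqrt_near1 (z0 4 isT) (z0 5 isT).
have [q3 l3 u3] := sqrt_near1 (z0 6 isT) (z0 7 isT).
move: q0 l0 u0 q1 l1 u1 q2 l2 u2 q3 l3 u3.
set s0 := Num.sqrt (1 - z 0 ^+ 2 - _); set s1 := Num.sqrt (1 - z 2 ^+ 2 - _).
set s2 := Num.sqrt (1 - z 4 ^+ 2 - _); set s3 := Num.sqrt (1 - z 6 ^+ 2 - _).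
move=> q0 l0 u0 q1 l1 u1 q2 l2 u2 q3 l3 u3.
pose E0 := vec3 (z 0) (z 1) s0; pose E1 := vec3 (z 2) (z 3) (- s1).
pose E2 := vec3 (z 4) s2 (z 5); pose E3 := vec3 s3 (z 6) (z 7).
pose X : 'rV[R]_3 := - (E0 + E1 + E2 + E3).
have [X0 X1 X2] : [/\ X 0 0 = - (z 0 + z 2 + z 4 + s3), X 0 1 = - (z 1 + z 3 + s2 + z 6)
    & X 0 2%:R = - (s0 - s1 + z 5 + z 7)].
  by split; rewrite /X /E0 /E1 /E2 /E3 !mxE.
have [||||E4 [e40 e41 e4X]] := @fifth_edge R X (z 8).
- by rewrite X0; apply: sum_near1; rewrite ?z0 ?l3.
- by rewrite X1 addrAC; apply: sum_near1; rewrite ?z0 ?l2.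
- by rewrite X2; apply: sum_near0; rewrite ?z0 ?l0 ?l1.
- by have := hz 8 isT; rewrite /a eqxx (_ : -1/2 + 1/100 = -49/100 :> R) //; lra.
have E5u : dot (X - E4) (X - E4) = 1.
  by rewrite dotBr ![dot (X - E4) _]dotC !dotBr e41 (dotC X E4); lra.
pose E (i : 'I_6) : 'rV[R]_3 := [:: E0; E1; E2; E3; E4; X - E4]`_i.
have [i||e eE] := @mk_pol R E.
- elim/forall6: i; rewrite /E //=.
  + by rewrite /E0 dotE !vec3E -!expr2 q0; ring.
  + by rewrite /E1 dotE !vec3E mulrNN -!expr2 q1; ring.
  + by rewrite /E2 dotE !vec3E -!expr2 q2; ring.
  + by rewrite /E3 dotE !vec3E -!expr2 q3; ring.
- by rewrite sum6 /E /= -addrA [E4 + _]addrC subrK /X subrr.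
exists e => // i i9; rewrite /box_coords !eE /E /=.
by do 9 (case: i i9 => [_|i i9]; first by rewrite /= ?vec3E).
Qed.

End PolPositive.

(** * Continuity and ambient isotopies *)

Section Continuity.
Context {R : realType}.

Lemma cont_pair {T U V : topologicalType} (f : T -> U) (g : T -> V) (x : T) :
  {for x, continuous f} -> {for x, continuous g} ->
  {for x, continuous (fun z => (f z, g z))}.
Proof. by move=> cf cg; exact: (cvg_pair cf cg). Qed.

Lemma cont_all {T U : topologicalType} (f : T -> U) :
  (forall x, {for x, continuous f}) -> continuous f.
Proof. by []. Qed.

Lemma cont_snd {U V : topologicalType} (x : U * V) : {for x, continuous (@snd U V)}.
Proof. exact: cvg_snd. Qed.

Section RealValued.
Context {T : topologicalType}.
Implicit Types (f g h : T -> R) (x : T).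

Lemma contc (c : R) x : {for x, continuous (fun _ : T => c)}.
Proof. exact: cst_continuous. Qed.

Lemma contD f g x : {for x, continuous f} -> {for x, continuous g} ->
  {for x, continuous (fun z => f z + g z)}.
Proof. exact: (@continuousD _ R). Qed.

Lemma contN f x : {for x, continuous f} -> {for x, continuous (fun z => - f z)}.
Proof. exact: (@continuousN _ R). Qed.

Lemma contB f g x : {for x, continuous f} -> {for x, continuous g} ->
  {for x, continuous (fun z => f z - g z)}.
Proof. by move=> cf cg; apply: contD => //; exact: contN. Qed.

Lemma contM f g x : {for x, continuous f} -> {for x, continuous g} ->
  {for x, continuous (fun z => f z * g z)}.
Proof. exact: continuousM. Qed.

Lemma contV f x : f x != 0 -> {for x, continuous f} ->
  {for x, continuous (fun z => (f z)^-1)}.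
Proof. exact: continuousV. Qed.

Lemma cont_norm f x : {for x, continuous f} -> {for x, continuous (fun z => `|f z|)}.
Proof. by move=> cf; apply: (continuous_comp cf); exact: norm_continuous. Qed.

Lemma cont_sqrt f x : {for x, continuous f} -> {for x, continuous (fun z => Num.sqrt (f z))}.
Proof. by move=> cf; apply: (continuous_comp cf); exact: sqrt_continuous. Qed.

Lemma cont_sum (I : Type) (r : seq I) (P : pred I) (F : I -> T -> R) x :
  (forall i, {for x, continuous (F i)}) ->
  {for x, continuous (fun z => \sum_(i <- r | P i) F i z)}.
Proof.
move=> cF; elim: r => [|i r ih].
  rewrite (_ : (fun z => _) = (fun=> 0)); first exact: contc.
  by apply/funext => z; rewrite big_nil.
rewrite (_ : (fun z => _) = (fun z => (if P i then F i z else 0) + \sum_(j <- r | P j) F j z)).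
  by apply: contD => //; case: (P i) => //; exact: contc.
by apply/funext => z; rewrite big_cons; case: (P i); rewrite ?add0r.
Qed.

Lemma cont_vec3 f g h x :
  {for x, continuous f} -> {for x, continuous g} -> {for x, continuous h} ->
  {for x, continuous (fun z => vec3 (f z) (g z) (h z))}.
Proof.
move=> cf cg ch.
have -> : (fun z => vec3 (f z) (g z) (h z)) = (fun z => f z *: vec3 1 0 0 +
    g z *: vec3 0 1 0 + h z *: vec3 0 0 1).
  apply/funext => z; apply: rV3P; rewrite !vecE; ring.
by apply: continuousD; [apply: continuousD|]; exact: continuousZr_tmp.
Qed.

End RealValued.

Lemma cont_coord (j : 'I_3) (x : 'rV[R]_3) : {for x, continuous (fun z : 'rV[R]_3 => z 0 j)}.
Proof. exact: coord_continuous. Qed.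

Lemma cont_coord2 (j : 'I_3) (p : R * 'rV[R]_3) :
  {for p, continuous (fun z : R * 'rV[R]_3 => z.2 0 j)}.
Proof. exact: (continuous_comp (@cont_snd _ _ p) (@cont_coord j p.2)). Qed.

Lemma cont_time (p : R * 'rV[R]_3) : {for p, continuous (fun z : R * 'rV[R]_3 => z.1)}.
Proof. exact: cvg_fst. Qed.

Lemma cont_comp2 {T : topologicalType} (F : R * R -> R) (f g : T -> R) x :
  continuous F -> {for x, continuous f} -> {for x, continuous g} ->
  {for x, continuous (fun z => F (f z, g z))}.
Proof.
move=> cF cf cg; apply: (@continuous_comp _ _ _ (fun z => (f z, g z)) F); last exact: cF.
exact: cont_pair.
Qed.

End Continuity.

Section Isotopy.
Context {R : realType}.
Notation V := 'rV[R]_3.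
Implicit Types (K L : set V).

(** Continuity holds for all times and not just on [[0, 1]], so that isotopies
    compose without reference to subspaces. *)
Definition isotopy (H : R -> V -> V) : Prop :=
  [/\ continuous (fun p : R * V => H p.1 p.2), forall x, H 0 x = x
    & forall t, 0 <= t <= 1 ->
        exists G : V -> V, [/\ continuous G, cancel (H t) G & cancel G (H t)]].

Definition isotopic K L : Prop := exists H, isotopy H /\ H 1 @` K = L.

Lemma isotopy_ambient H : isotopy H -> ambient_isotopy H.
Proof. by move=> [cH H0 HG]; split=> //; exact: continuous_subspaceT. Qed.

(** Composing the two maps at each time avoids gluing two time intervals. *)
Lemma isotopic_trans K L M : isotopic K L -> isotopic L M -> isotopic K M.
Proof.
move=> [H [iH HK]] [H' [iH' HL]]; exists (fun t x => H' t (H t x)); split; last first.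
  by rewrite -HL -HK -image_comp.
have [cH H0 HG] := iH; have [cH' H'0 HG'] := iH'; split.
- move=> p; apply: (@continuous_comp _ _ _ (fun p : R * V => (p.1, H p.1 p.2)) (fun p => H' p.1 p.2)); last exact: cH'.
  by apply: cont_pair; [exact: cvg_fst|exact: cH].
- by move=> x; rewrite H0 H'0.
- move=> t t01; have [G [cG HK1 HK2]] := HG t t01; have [G' [cG' HK1' HK2']] := HG' t t01.
  exists (G \o G'); split.
  + by move=> x; apply: continuous_comp; [exact: cG'|exact: cG].
  + by move=> x /=; rewrite HK1' HK1.
  + by move=> x /=; rewrite HK2 HK2'.
Qed.

Lemma isotopic_trivial_knot K : isotopic K unit_circle -> trivial_knot K.
Proof. by move=> [H [/isotopy_ambient iH HK]]; exists H. Qed.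

Lemma isotopic_shift K (v : V) : isotopic K [set x + v | x in K].
Proof.
exists (fun t x => x + t *: v); split; last by congr (_ @` _); apply/funext => x; rewrite scale1r.
split.
- have -> : (fun p : R * V => p.2 + p.1 *: v) =
      (fun p : R * V => vec3 (p.2 0 0 + p.1 * v 0 0) (p.2 0 1 + p.1 * v 0 1)
        (p.2 0 2%:R + p.1 * v 0 2%:R)).
    by apply/funext => p; apply: rV3P; rewrite !vecE.
  apply: cont_all => p; apply: cont_vec3; apply: contD; try exact: cont_coord2;
    by apply: contM; [exact: cont_time|exact: contc].
- by move=> x; rewrite scale0r addr0.
- move=> t _; exists (fun x => x - t *: v); split.
  + have -> : (fun x : V => x - t *: v) =
        (fun x : V => vec3 (x 0 0 - t * v 0 0) (x 0 1 - t * v 0 1) (x 0 2%:R - t * v 0 2%:R)).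
      by apply/funext => p; apply: rV3P; rewrite !vecE.
    by apply: cont_all => p; apply: cont_vec3; apply: contB; try exact: cont_coord; exact: contc.
  + by move=> x; rewrite addrK.
  + by move=> x; rewrite subrK.
Qed.

(** The segment from the coordinate [x_1] to [k w.x + c] consists of affine
    functions with a positive coefficient of [x_1], so replacing [x_1] by any
    of them is invertible. *)
Lemma isotopic_height K (w : V) (k c : R) : 0 < k -> 0 < w 0 1 ->
  isotopic K [set vec3 (x 0 0) (k * dot w x + c) (x 0 2%:R) | x in K].
Proof.
move=> k0 w1.
pose a t : R := (1 - t) + t * (k * w 0 1).
pose b t (x : V) : R := t * (k * (w 0 0 * x 0 0 + w 0 2%:R * x 0 2%:R) + c).
have a0 t : 0 <= t <= 1 -> a t != 0.
  move=> /andP[t0 t1]; have kw : 0 < k * w 0 1 by rewrite mulr_gt0.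
  rewrite gt_eqF // /a; move: (k * _) kw => z z0; nra.
exists (fun t (x : V) => vec3 (x 0 0) (a t * x 0 1 + b t x) (x 0 2%:R)); split; last first.
  congr (_ @` _); apply/funext => x; congr (vec3 _ _ _); rewrite /a /b dotE; ring.
have cb (T : topologicalType) (f : T -> R) (g h : T -> R) x :
   {for x, continuous f} -> {for x, continuous g} -> {for x, continuous h} ->
   {for x, continuous (fun z => f z * (k * (w 0 0 * g z + w 0 2%:R * h z) + c))}.
  move=> cf cg ch; apply: contM => //; apply: contD; last exact: contc.
  by apply: contM; [exact: contc|]; apply: contD; apply: contM => //; exact: contc.
split.
- apply: cont_all => p; apply: cont_vec3; [exact: cont_coord2| |exact: cont_coord2].
  apply: contD; last by apply: cb; [exact: cont_time|exact: cont_coord2|exact: cont_coord2].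
  apply: contM; last exact: cont_coord2.
  by apply: contD; [apply: contB|apply: contM]; try exact: cont_time; exact: contc.
- by move=> x; apply: rV3P; rewrite !vec3E // /a /b; ring.
- move=> t /a0 at0.
  exists (fun x : V => vec3 (x 0 0) ((x 0 1 - b t x) / a t) (x 0 2%:R)); split.
  + apply: cont_all => p; apply: cont_vec3; [exact: cont_coord| |exact: cont_coord].
    apply: contM; last exact: contc.
    apply: contB; first exact: cont_coord.
    by apply: cb; [exact: contc|exact: cont_coord|exact: cont_coord].
  + by move=> x; apply: rV3P; rewrite !vec3E // /b !vec3E; field.
  + by move=> x; apply: rV3P; rewrite !vec3E // /b !vec3E; field.
Qed.

End Isotopy.

(** * From a lens to the circle *)

Section LevelAndRadial.
Context {R : realType}.
Notation V := 'rV[R]_3.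
Implicit Types (K L : set V).

(** With the plane [x_1 = y] identified with the complex numbers by [x_0 + i
    x_2], this is the affine map [z |-> (p + i q) (z - s)]. *)
Definition level_map (p q s0 s2 : R -> R -> R) (t : R) (x : V) : V :=
  let y := x 0 1 in
  vec3 (p t y * (x 0 0 - s0 t y) - q t y * (x 0 2%:R - s2 t y)) y
       (q t y * (x 0 0 - s0 t y) + p t y * (x 0 2%:R - s2 t y)).

Lemma level_isotopy (p q s0 s2 : R -> R -> R) :
  continuous (fun z => p z.1 z.2) -> continuous (fun z => q z.1 z.2) ->
  continuous (fun z => s0 z.1 z.2) -> continuous (fun z => s2 z.1 z.2) ->
  (forall y, p 0 y = 1) -> (forall y, q 0 y = 0) ->
  (forall y, s0 0 y = 0) -> (forall y, s2 0 y = 0) ->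
  (forall t y, 0 <= t <= 1 -> p t y ^+ 2 + q t y ^+ 2 != 0) ->
  isotopy (level_map p q s0 s2).
Proof.
move=> cp cq cs0 cs2 p0 q0 s00 s20 pq.
have cF (F : R -> R -> R) (z : R * V) : continuous (fun z => F z.1 z.2) ->
    {for z, continuous (fun z : R * V => F z.1 (z.2 0 1))}.
  by move=> cF; apply: (cont_comp2 cF); [exact: cont_time|exact: cont_coord2].
have cFt (F : R -> R -> R) t (x : V) : continuous (fun z => F z.1 z.2) ->
    {for x, continuous (fun x : V => F t (x 0 1))}.
  by move=> cF'; apply: (cont_comp2 cF'); [exact: contc|exact: cont_coord].
split.
- apply: cont_all => z; apply: cont_vec3; [|exact: cont_coord2|].
    by apply: contB; apply: contM; [exact: cF|apply: contB; [exact: cont_coord2|exact: cF]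
      |exact: cF|apply: contB; [exact: cont_coord2|exact: cF]].
  by apply: contD; apply: contM; [exact: cF|apply: contB; [exact: cont_coord2|exact: cF]
    |exact: cF|apply: contB; [exact: cont_coord2|exact: cF]].
- by move=> x; apply: rV3P; rewrite /level_map !vec3E // p0 q0 s00 s20; ring.
move=> t t01; pose N y := p t y * p t y + q t y * q t y.
have N0 y : N y != 0 by rewrite /N -!expr2; exact: pq.
exists (fun x : V => let y := x 0 1 in
  vec3 ((p t y * x 0 0 + q t y * x 0 2%:R) / N y + s0 t y) y
       ((p t y * x 0 2%:R - q t y * x 0 0) / N y + s2 t y)); split.
- apply: cont_all => x.
  have cN : {for x, continuous (fun x : V => (N (x 0 1))^-1)}.
    apply: contV; first exact: N0.
    by apply: contD; apply: contM; exact: cFt.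
  apply: cont_vec3; [|exact: cont_coord|]; apply: contD; try exact: cFt;
    apply: contM => //.
    by apply: contD; apply: contM; try exact: cFt; exact: cont_coord.
  by apply: contB; apply: contM; try exact: cFt; exact: cont_coord.
- move=> x; apply: rV3P; rewrite /level_map /= !vec3E //; have := N0 (x 0 1);
    rewrite /N; by move=> n0; field.
- move=> x; apply: rV3P; rewrite /level_map /= !vec3E //; have := N0 (x 0 1);
    rewrite /N; by move=> n0; field.
Qed.

Definition diamond : set V := [set x | `|x 0 0| + `|x 0 1| = 1 /\ x 0 2%:R = 0].

Definition taxi (x : V) : R := `|x 0 0| + `|x 0 1| + `|x 0 2%:R|.
Definition euclid (x : V) : R := Num.sqrt (dot x x).

Lemma euclid_gt0 x : x != 0 -> 0 < euclid x.
Proof. by move=> x0; rewrite sqrtr_gt0 dot_gt0. Qed.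

Lemma euclid_sqr x : euclid x ^+ 2 = dot x x.
Proof. by rewrite sqr_sqrtr // dot_ge0. Qed.

Lemma euclid_le_taxi x : euclid x <= taxi x.
Proof.
rewrite -(@ler_pXn2r _ 2) ?nnegrE ?sqrtr_ge0 //; last by rewrite !addr_ge0.
rewrite euclid_sqr dotE -!expr2 -!(real_normK (num_real (x 0 _))) /taxi.
move: (normr_ge0 (x 0 0)) (normr_ge0 (x 0 1)) (normr_ge0 (x 0 2%:R)).
by move: `|x 0 0| `|x 0 1| `|x 0 2%:R| => a b c; nra.
Qed.

Lemma norm_le_euclid x : `|x| <= euclid x.
Proof.
by rewrite -(@ler_pXn2r _ 2) ?nnegrE ?sqrtr_ge0 // euclid_sqr norm_sqr_le.
Qed.

Lemma taxi_le_norm x : taxi x <= 3 * `|x|.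
Proof. by rewrite /taxi; move: (coord_le_norm x 0) (coord_le_norm x 1) (coord_le_norm x 2%:R); lra. Qed.

Definition taxi_ratio x : R := taxi x / euclid x.

Lemma taxi_ratio_itv x : x != 0 -> 1 <= taxi_ratio x <= 3.
Proof.
move=> /euclid_gt0 e0; rewrite /taxi_ratio ler_pdivlMr // ler_pdivrMr // mul1r euclid_le_taxi.
by apply: le_trans (taxi_le_norm x) _; rewrite ler_wpM2l // norm_le_euclid.
Qed.

Lemma taxi_ratioZ (a : R) x : 0 < a -> taxi_ratio (a *: x) = taxi_ratio x.
Proof.
move=> a0; rewrite /taxi_ratio /taxi /euclid !mxE !normrM !(gtr0_norm a0).
rewrite dotZr dotC dotZr mulrA -expr2 sqrtrM ?sqr_ge0 // sqrtr_sqr (gtr0_norm a0).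
rewrite -!mulrDr; have [->|e0] := eqVneq (Num.sqrt (dot x x)) 0; first by rewrite mulr0 !invr0 !mulr0.
by field; rewrite e0 gt_eqF.
Qed.

Lemma cont_taxi_ratio x : x != 0 -> {for x, continuous taxi_ratio}.
Proof.
move=> /euclid_gt0 e0; apply: contM.
  by apply: contD; [apply: contD|]; apply: cont_norm; exact: cont_coord.
apply: contV; first by rewrite gt_eqF.
apply: cont_sqrt; rewrite (_ : (fun z => dot z z) = (fun z : V => z 0 0 * z 0 0 + z 0 1 * z 0 1 + z 0 2%:R * z 0 2%:R)).
  by apply: contD; [apply: contD|]; apply: contM; exact: cont_coord.
by apply/funext => z; rewrite dotE.
Qed.

Lemma cont_linear_bound (W : normedModType R) (F : W -> W) (C : R) :
  (forall y, `|F y| <= C * `|y|) -> {for 0, continuous F}.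
Proof.
move=> FC; have F0 : F 0 = 0.
  by apply/eqP; rewrite -normr_eq0 eq_le normr_ge0 andbT (le_trans (FC 0)) // normr0 mulr0.
rewrite /prop_for /continuous_at F0; apply/cvgrPdist_lt => eps eps0.
have C0 : 0 < `|C| + 1 by rewrite ltr_wpDl.
near=> y; rewrite sub0r normrN; apply: (@le_lt_trans _ _ ((`|C| + 1) * `|y|)).
  apply: le_trans (FC y) _; rewrite ler_wpM2r //.
  by apply: le_trans (ler_norm C) _; rewrite lerDl.
rewrite mulrC -ltr_pdivlMr //; near: y.
apply: nbhs0_lt; by rewrite divr_gt0.
Unshelve. all: by end_near. Qed.

(** At 0 the boundedness of [phi] takes over the part of continuity there,
    since [x] tends to 0. *)
Lemma cont_scale_bounded (phi : V -> R) (C : R) :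
  (forall x, x != 0 -> {for x, continuous phi}) ->
  (forall x, x != 0 -> `|phi x| <= C) ->
  continuous (fun x : V => phi x *: x).
Proof.
move=> cphi phiC; apply: cont_all => x; have [->|x0] := eqVneq x 0; last first.
  rewrite (_ : (fun x => _) = (fun x => vec3 (phi x * x 0 0) (phi x * x 0 1) (phi x * x 0 2%:R))).
    by apply: cont_vec3; apply: contM; try exact: cont_coord; exact: cphi.
  by apply/funext => z; apply: rV3P; rewrite !vecE.
apply: (cont_linear_bound (C := `|C|)) => y; have [->|y0] := eqVneq y 0.
  by rewrite scaler0 normr0 mulr0.
rewrite normrZ ler_wpM2r //; apply: le_trans (phiC _ y0) _; exact: ler_norm.
Qed.

(** Each time map multiplies a vector by a factor at least 1 which is constant
    on rays; dividing by the factor inverts it. The last factor is the ratio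
    of the l1 norm and the Euclidean norm. *)
Lemma diamond_isotopic_circle : isotopic diamond unit_circle.
Proof.
pose f t x : R := (1 - t) + t * taxi_ratio x.
have f1 t x : 0 <= t <= 1 -> x != 0 -> 1 <= f t x.
  by move=> /andP[t0 t1] /taxi_ratio_itv /andP[h1 h2]; rewrite /f; nra.
exists (fun t x => f t x *: x); split; first split.
- rewrite (_ : (fun p : R * V => _) = (fun p : R * V => vec3
    ((1 - p.1) * p.2 0 0 + p.1 * (taxi_ratio p.2 *: p.2) 0 0)
    ((1 - p.1) * p.2 0 1 + p.1 * (taxi_ratio p.2 *: p.2) 0 1)
    ((1 - p.1) * p.2 0 2%:R + p.1 * (taxi_ratio p.2 *: p.2) 0 2%:R))); last first.
    by apply/funext => p; apply: rV3P; rewrite /f !vecE; ring.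
  have cF : continuous (fun x => taxi_ratio x *: x).
    apply: (@cont_scale_bounded _ 3); first exact: cont_taxi_ratio.
    move=> x /taxi_ratio_itv /andP[h1 h2]; rewrite ger0_norm //; lra.
  apply: cont_all => p.
  have c1 : {for p, continuous (fun p : R * V => 1 - p.1)}.
    by apply: contB; [exact: contc|exact: cont_time].
  have c2 j : {for p, continuous (fun p : R * V => (taxi_ratio p.2 *: p.2) 0 j)}.
    apply: (@continuous_comp _ _ _ (fun p : R * V => taxi_ratio p.2 *: p.2) (fun x : V => x 0 j)); last exact: cont_coord.
    by apply: (@continuous_comp _ _ _ snd (fun x => taxi_ratio x *: x)); [exact: cont_snd|exact: cF].
  have c3 j : {for p, continuous (fun p : R * V =>
      (1 - p.1) * p.2 0 j + p.1 * (taxi_ratio p.2 *: p.2) 0 j)}.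
    by apply: contD; apply: contM; [exact: c1|exact: cont_coord2|exact: cont_time|exact: c2].
  by apply: cont_vec3; exact: c3.
- by move=> x; rewrite /f mul0r addr0 subr0 scale1r.
- move=> t t01; exists (fun y => (f t y)^-1 *: y).
  have fZ (a : R) x : 0 < a -> f t (a *: x) = f t x by move=> a0; rewrite /f taxi_ratioZ.
  split.
  + apply: (@cont_scale_bounded _ 1) => x x0.
      apply: contV; first by have := f1 t x t01 x0; rewrite -normr_gt0 => ?; rewrite ger0_norm; lra.
      apply: contD; first exact: contc.
      by apply: contM; [exact: contc|exact: cont_taxi_ratio].
    have := f1 t x t01 x0 => h; rewrite ger0_norm ?invr_ge0; last lra.
    by rewrite invf_le1; lra.
  + move=> x; have [->|x0] := eqVneq x 0; first by rewrite !scaler0.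
    have h := f1 t x t01 x0; rewrite fZ; last lra.
    by rewrite scalerA mulVf ?scale1r // gt_eqF //; lra.
  + move=> x; have [->|x0] := eqVneq x 0; first by rewrite !scaler0.
    have h := f1 t x t01 x0; rewrite fZ ?invr_gt0; last lra.
    by rewrite scalerA mulfV ?scale1r // gt_eqF //; lra.
have ft x : f 1 x = taxi_ratio x by rewrite /f subrr add0r mul1r.
apply/seteqP; split.
  move=> _ [x [x1 x2] <-]; rewrite /unit_circle /= !mxE ft x2 mulr0; split=> //.
  have t1 : taxi x = 1 by rewrite /taxi x1 x2 normr0 addr0.
  have x0 : x != 0.
    by apply/eqP => x0; move: t1; rewrite x0 /taxi !mxE normr0 !addr0 => /eqP; rewrite eq_sym oner_eq0.
  have := euclid_gt0 x0; have := euclid_sqr x; rewrite dotE x2 mulr0 addr0 /taxi_ratio t1 div1r.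
  move: (euclid x) => r r2 r0; rewrite !exprMn -mulrDr -!expr2 in r2 *.
  by rewrite -r2 exprVn mulVf // sqrf_eq0 gt_eqF.
move=> y [y1 y2].
have y0 : y != 0.
  by apply/eqP => y0; move: y1; rewrite y0 !mxE expr0n addr0 => /eqP; rewrite eq_sym oner_eq0.
have ey : euclid y = 1 by rewrite /euclid dotE y2 mulr0 addr0 -!expr2 y1 sqrtr1.
have /andP[r1 _] := taxi_ratio_itv y0.
have r0 : 0 < (taxi_ratio y)^-1 by rewrite invr_gt0; lra.
exists ((taxi_ratio y)^-1 *: y).
  rewrite /diamond /= !mxE y2 mulr0; split=> //.
  rewrite !normrM (gtr0_norm r0) -mulrDr -[`|y 0 0| + _]addr0.
  have -> : `|y 0 0| + `|y 0 1| + 0 = taxi_ratio y.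
    by rewrite /taxi_ratio ey divr1 /taxi y2 normr0.
  by rewrite mulVf // gt_eqF //; lra.
by rewrite ft taxi_ratioZ // scalerA mulfV ?scale1r // gt_eqF //; lra.
Qed.

End LevelAndRadial.

Section Straighten.
Context {R : realType}.
Notation V := 'rV[R]_3.

(** In the plane [x_1 = y] there are two points symmetric about the centre
    [(c0 y, c2 y)]; they merge as [|y|] reaches 1. *)
Definition lens (c0 c2 g0 g2 : R -> R) : set V :=
  [set x | exists (y : R) (b : bool), `|y| <= 1 /\
     x = vec3 (c0 y + (-1) ^+ b * ((1 - `|y|) * g0 y)) y
              (c2 y + (-1) ^+ b * ((1 - `|y|) * g2 y))].

(** The modulus of [(a + i b) (c + i d) / (g + i h)]. *)
Lemma mul_norm_sqr (a b c d g h n : R) : n = g * g + h * h -> n != 0 ->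
  (((a * c - b * d) * g + (a * d + b * c) * h) / n) ^+ 2 +
  (((a * d + b * c) * g - (a * c - b * d) * h) / n) ^+ 2 =
  (a * a + b * b) * (c * c + d * d) / n.
Proof.
move=> nE n0; transitivity ((a * a + b * b) * (c * c + d * d) * (g * g + h * h) / (n * n)).
  by field.
by rewrite -nE; field.
Qed.

(** Multiplying level [y] by [g ((1 - t) y) / g y] turns the gap function [g]
    into the constant [g 0]. As an interval is contractible to 0, no
    continuous choice of an argument of [g] is needed. *)
Lemma lens_isotopic_diamond (c0 c2 g0 g2 : R -> R) :
  continuous c0 -> continuous c2 -> continuous g0 -> continuous g2 ->
  (forall y, g0 y ^+ 2 + g2 y ^+ 2 != 0) ->
  isotopic (lens c0 c2 g0 g2) diamond.
Proof.
move=> cc0 cc2 cg0 cg2 gN.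
pose N y := g0 y * g0 y + g2 y * g2 y.
have N0 y : N y != 0 by rewrite /N -!expr2.
have Ngt0 y : 0 < N y by rewrite lt0r N0 /N -!expr2 addr_ge0 ?sqr_ge0.
(* Let [z = z0 + i z2] be [sg / g(0)]. The factors [A + i B] run along the segment
   from 1 to [z], so in the end [g(0)] becomes real; the sign [sg] makes the real
   part of [z] nonnegative, which keeps the segment away from 0. *)
pose b0 := g0 0 < 0; pose sg : R := (-1) ^+ b0.
have sg0 : 0 <= sg * g0 0 by rewrite /sg /b0 -normrEsign.
have sg2 : sg * sg = 1 by rewrite /sg -signr_addb addbb.
pose z0 := sg * g0 0 / N 0; pose z2 := - (sg * g2 0) / N 0.
have z00 : 0 <= z0 by rewrite divr_ge0 // ltW.
have zN : z0 * z0 + z2 * z2 = (N 0)^-1.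
  rewrite /z0 /z2; transitivity (sg * sg * (g0 0 * g0 0 + g2 0 * g2 0) / (N 0 * N 0)).
    by field; exact: N0.
  by rewrite sg2 -/(N 0); field; exact: N0.
pose A t := (1 - t) + t * z0; pose B t := t * z2.
pose P t y := A t * g0 ((1 - t) * y) - B t * g2 ((1 - t) * y).
pose Q t y := A t * g2 ((1 - t) * y) + B t * g0 ((1 - t) * y).
pose p t y := (P t y * g0 y + Q t y * g2 y) / N y.
pose q t y := (Q t y * g0 y - P t y * g2 y) / N y.
have A_0 : A 0 = 1 by rewrite /A subr0 mul0r addr0.
have B_0 : B 0 = 0 by rewrite /B mul0r.
have P_0 y : P 0 y = g0 y by rewrite /P A_0 B_0 subr0 !mul1r mul0r subr0.
have Q_0 y : Q 0 y = g2 y by rewrite /Q A_0 B_0 subr0 !mul1r mul0r addr0.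
exists (level_map p q (fun t y => t * c0 y) (fun t y => t * c2 y)); split.
  have ct (z : R * R) : {for z, continuous (fun z : R * R => z.1)} by exact: cvg_fst.
  have cy (z : R * R) : {for z, continuous (fun z : R * R => z.2)} by exact: cvg_snd.
  have ch (f : R -> R) (z : R * R) : continuous f -> {for z, continuous (fun z : R * R => f z.2)}.
    by move=> cf; apply: (continuous_comp (cy z)); exact: cf.
  have cty (f : R -> R) (z : R * R) : continuous f ->
      {for z, continuous (fun z : R * R => f ((1 - z.1) * z.2))}.
    move=> cf; apply: (@continuous_comp _ _ _ (fun z : R * R => (1 - z.1) * z.2)); last exact: cf.
    by apply: contM; [apply: contB; [exact: contc|exact: ct]|exact: cy].
  have cA (z : R * R) : {for z, continuous (fun z : R * R => A z.1)}.
    by apply: contD; [apply: contB; [exact: contc|exact: ct]|apply: contM; [exact: ct|exact: contc]].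
  have cB (z : R * R) : {for z, continuous (fun z : R * R => B z.1)}.
    by apply: contM; [exact: ct|exact: contc].
  have cP (z : R * R) : {for z, continuous (fun z : R * R => P z.1 z.2)}.
    by apply: contB; apply: contM; [exact: cA|exact: cty|exact: cB|exact: cty].
  have cQ (z : R * R) : {for z, continuous (fun z : R * R => Q z.1 z.2)}.
    by apply: contD; apply: contM; [exact: cA|exact: cty|exact: cB|exact: cty].
  have cN (z : R * R) : {for z, continuous (fun z : R * R => (N z.2)^-1)}.
    apply: contV; first exact: N0.
    by apply: contD; apply: contM; exact: ch.
  apply: level_isotopy.
  - apply: cont_all => z; apply: contM; last exact: cN.
    by apply: contD; apply: contM; [exact: cP|exact: ch|exact: cQ|exact: ch].
  - apply: cont_all => z; apply: contM; last exact: cN.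
    by apply: contB; apply: contM; [exact: cQ|exact: ch|exact: cP|exact: ch].
  - by apply: cont_all => z; apply: contM; [exact: ct|exact: ch].
  - by apply: cont_all => z; apply: contM; [exact: ct|exact: ch].
  - by move=> y; rewrite /p P_0 Q_0 -/(N y) mulfV ?N0.
  - by move=> y; rewrite /q P_0 Q_0 [g2 y * _]mulrC subrr mul0r.
  - by move=> y; rewrite mul0r.
  - by move=> y; rewrite mul0r.
  - move=> t y /andP[t0 t1].
    have -> : p t y ^+ 2 + q t y ^+ 2 = (A t * A t + B t * B t) * N ((1 - t) * y) / N y.
      exact: (mul_norm_sqr _ _ _ _ erefl (N0 y)).
    rewrite !mulf_neq0 ?invr_eq0 //.
    have B0 : 0 <= B t * B t by rewrite -expr2 sqr_ge0.
    have [t1'|t1'] := eqVneq t 1.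
      by rewrite /A /B t1' subrr add0r !mul1r zN invr_eq0.
    have A0 : 0 < A t.
      by apply: ltr_wpDr; [exact: mulr_ge0|rewrite subr_gt0 lt_neqAle t1'].
    by rewrite gt_eqF //; apply: ltr_wpDr => //; exact: mulr_gt0.
have p1 y : p 1 y = sg * g0 y / N y.
  rewrite /p /P /Q /A /B !subrr !mul0r !add0r !mul1r.
  rewrite (_ : z0 * g0 0 - z2 * g2 0 = sg); last first.
    rewrite /z0 /z2; transitivity (sg * (g0 0 * g0 0 + g2 0 * g2 0) / N 0); first by field.
    by rewrite -/(N 0) mulfK.
  rewrite (_ : z0 * g2 0 + z2 * g0 0 = 0); last by rewrite /z0 /z2; field.
  by rewrite mul0r addr0.
have q1 y : q 1 y = - (sg * g2 y) / N y.
  rewrite /q /P /Q /A /B !subrr !mul0r !add0r !mul1r.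
  rewrite (_ : z0 * g0 0 - z2 * g2 0 = sg); last first.
    rewrite /z0 /z2; transitivity (sg * (g0 0 * g0 0 + g2 0 * g2 0) / N 0); first by field.
    by rewrite -/(N 0) mulfK.
  rewrite (_ : z0 * g2 0 + z2 * g0 0 = 0); last by rewrite /z0 /z2; field.
  by rewrite mul0r add0r.
have imE y (b : bool) : level_map p q (fun t y => t * c0 y) (fun t y => t * c2 y) 1
    (vec3 (c0 y + (-1) ^+ b * ((1 - `|y|) * g0 y)) y
          (c2 y + (-1) ^+ b * ((1 - `|y|) * g2 y))) =
    vec3 ((-1) ^+ b * sg * (1 - `|y|)) y 0.
  apply: rV3P; rewrite /level_map /= !vec3E // !mul1r p1 q1.
    transitivity ((-1) ^+ b * sg * (1 - `|y|) * (g0 y * g0 y + g2 y * g2 y) / N y); first by field.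
    by rewrite -/(N y) mulfK.
  by field.
apply/seteqP; split.
  move=> _ [_ [y [b [y1 ->]]] <-]; rewrite imE /diamond /= !vec3E; split=> //.
  rewrite !normrM normr_sign mul1r /sg normr_sign mul1r ger0_norm; last by rewrite subr_ge0.
  by rewrite subrK.
move=> x [x1 x2]; pose b := (x 0 0 < 0) (+) b0; pose y := x 0 1.
have y1 : `|y| <= 1 by rewrite -x1 lerDr.
eexists; first by exists y, b.
rewrite imE; apply: rV3P; rewrite !vec3E //.
have -> : 1 - `|y| = `|x 0 0| by rewrite -x1 addrK.
rewrite /sg -signr_addb /b -addbA addbb addbF.
by rewrite -numEsign.
Qed.

End Straighten.

(** * Two rising paths with common ends *)

Section MonotonePath.
Context {R : realType}.
Notation V := 'rV[R]_3.

(** Written with absolute values, this truncation to [[0, 1]] is evidently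
    continuous. *)
Definition clamp01 (t : R) : R := (`|t| - `|t - 1| + 1) / 2.

Lemma clamp01_le0 t : t <= 0 -> clamp01 t = 0.
Proof. by move=> t0; rewrite /clamp01 ler0_norm // ler0_norm; lra. Qed.

Lemma clamp01_ge1 t : 1 <= t -> clamp01 t = 1.
Proof. by move=> t1; rewrite /clamp01 ger0_norm ?ger0_norm; lra. Qed.

Lemma clamp01_id t : 0 <= t <= 1 -> clamp01 t = t.
Proof. by move=> /andP[t0 t1]; rewrite /clamp01 ger0_norm // ler0_norm; lra. Qed.

Lemma clamp01_itv t : 0 <= clamp01 t <= 1.
Proof.
have [t0|t0] := leP t 0; first by rewrite clamp01_le0 // lexx ler01.
have [t1|t1] := leP t 1; first by rewrite clamp01_id ?t1 ?ltW.
by rewrite clamp01_ge1 ?lexx ?ler01 // ltW.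
Qed.

Lemma cont_clamp01 {T : topologicalType} (f : T -> R) x :
  {for x, continuous f} -> {for x, continuous (fun z => clamp01 (f z))}.
Proof.
move=> cf; apply: contM; last exact: contc.
apply: contD; last exact: contc.
apply: contB; apply: cont_norm => //.
by apply: contB => //; exact: contc.
Qed.

Lemma cont_comp {T : topologicalType} (g : R -> R) (h : T -> R) x :
  continuous g -> {for x, continuous h} -> {for x, continuous (fun z => g (h z))}.
Proof. by move=> cg ch; apply: (@continuous_comp _ _ _ h g); [exact: ch|exact: cg]. Qed.

Section Path.
Variables (w : V) (f : nat -> V) (m : nat).
Hypothesis up : forall j, (j < m)%N -> 0 < dot w (f j).

Definition hgt j : R := \sum_(i < j) dot w (f i).
Definition node j : V := \sum_(i < j) f i.
(** The point of height [y] on the polygonal path with edges [f]: each edge is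
    traversed while [y] runs through its range of heights. Without case
    analysis on [y], continuity is immediate. *)
Definition lift_path (y : R) : V :=
  \sum_(i < m) clamp01 ((y - hgt i) / dot w (f i)) *: f i.

Lemma hgtS j : hgt j.+1 = hgt j + dot w (f j).
Proof. by rewrite /hgt big_ord_recr. Qed.

Lemma nodeS j : node j.+1 = node j + f j.
Proof. by rewrite /node big_ord_recr. Qed.

Lemma dot_node j : dot w (node j) = hgt j.
Proof. by rewrite /node dot_sumr. Qed.

Lemma hgt0 : hgt 0 = 0. Proof. by rewrite /hgt big_ord0. Qed.

Lemma hgt_le i j : (i <= j)%N -> (j <= m)%N -> hgt i <= hgt j.
Proof.
elim: j => [|j ih]; first by rewrite leqn0 => /eqP ->.
rewrite leq_eqVlt => /predU1P[-> //|ij] jm.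
by apply: le_trans (ih ij (ltnW jm)) _; rewrite hgtS lerDl ltW // up.
Qed.

Lemma lift_path_seg j (s : R) : (j < m)%N -> 0 <= s <= 1 ->
  lift_path (hgt j + s * dot w (f j)) = node j + s *: f j.
Proof.
move=> jm s01; have /andP[s0 s1] := s01.
have fj := up jm; set y := hgt j + _.
pose u i := clamp01 ((y - hgt i) / dot w (f i)) *: f i.
have lo i : (i < j)%N -> u i = f i.
  move=> ij; have im := ltn_trans ij jm; rewrite /u clamp01_ge1 ?scale1r //.
  rewrite ler_pdivlMr ?up // mul1r lerBrDl -hgtS /y.
  apply: le_trans (hgt_le ij (ltnW jm)) _; rewrite lerDl mulr_ge0 // ltW //.
have hi i : (j < i)%N -> (i < m)%N -> u i = 0.
  move=> ji im; rewrite /u clamp01_le0 ?scale0r //.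
  rewrite pmulr_lle0 ?invr_gt0 ?up // subr_le0 /y.
  apply: le_trans (hgt_le ji (ltnW im)); rewrite hgtS lerD2l ler_piMl // ltW //.
have mid : u j = s *: f j.
  rewrite /u (_ : (y - hgt j) / _ = s) ?clamp01_id //.
  by rewrite /y addrAC subrr add0r mulfK // gt_eqF.
rewrite /lift_path -/(u _) (eq_bigr (fun i : 'I_m => u i)) //.
rewrite -(big_mkord xpredT u) (@big_cat_nat _ _ _ j) //=; last exact: ltnW.
rewrite (@big_cat_nat _ _ _ j.+1 j m) //= big_nat1 mid.
rewrite [X in _ + (_ + X)]big1_seq ?addr0; last first.
  by move=> i /andP[_]; rewrite mem_index_iota => /andP[ji im]; exact: hi.
congr (_ + _); rewrite big_mkord /node; apply: eq_bigr => i _; exact: lo.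
Qed.

Lemma find_level y : 0 <= y -> y < hgt m ->
  exists j s, [/\ (j < m)%N, 0 <= s, s < 1 & y = hgt j + s * dot w (f j)].
Proof.
move=> y0 ym; have : exists j, y < hgt j by exists m.
move=> /ex_minnP[[|j] yj minj]; first by move: yj; rewrite hgt0 ltNge y0.
have jm : (j < m)%N by exact: minj.
have yj' : hgt j <= y by rewrite leNgt; apply/negP => /minj; rewrite ltnn.
have fj := up jm; rewrite hgtS in yj.
exists j, ((y - hgt j) / dot w (f j)); split=> //.
- by rewrite divr_ge0 ?subr_ge0 // ltW.
- by rewrite ltr_pdivrMr // mul1r ltrBlDl.
- by rewrite divfK ?gt_eqF // addrC subrK.
Qed.

Hypothesis m0 : (0 < m)%N.

Lemma hgt_last : hgt m = hgt m.-1 + dot w (f m.-1).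
Proof. by rewrite -hgtS prednK. Qed.

Lemma last_lt : (m.-1 < m)%N. Proof. by rewrite prednK. Qed.

Lemma hgt_gt0 : 0 < hgt m.
Proof. by rewrite hgt_last ltr_wpDl ?up ?last_lt // -hgt0 hgt_le // leq_pred. Qed.

Lemma lift_path_near_end (s : R) : 0 <= s <= 1 ->
  lift_path (hgt m - s * dot w (f m.-1)) = node m - s *: f m.-1.
Proof.
move=> /andP[s0 s1].
have -> : hgt m - s * dot w (f m.-1) = hgt m.-1 + (1 - s) * dot w (f m.-1).
  by rewrite hgt_last; ring.
rewrite lift_path_seg ?last_lt //; last by apply/andP; split; lra.
have -> : node m = node m.-1 + f m.-1 by rewrite -nodeS prednK.
by rewrite scalerBl scale1r addrA.
Qed.

Lemma lift_path_end : lift_path (hgt m) = node m.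
Proof.
have := @lift_path_near_end 0; rewrite mul0r scale0r !subr0; apply.
by rewrite lexx ler01.
Qed.

Lemma dot_lift_path y : 0 <= y -> y <= hgt m -> dot w (lift_path y) = y.
Proof.
move=> y0; rewrite le_eqVlt => /predU1P[->|ym]; first by rewrite lift_path_end dot_node.
have [j [s [jm s0 s1 ->]]] := find_level y0 ym.
by rewrite lift_path_seg ?s0 ?ltW // dotDr dotZr dot_node.
Qed.

(** A path is straight near its ends, so that the gap between two paths with
    the same ends decreases linearly there; see [two_paths_isotopic]. *)
Lemma lift_path_start (eps l : R) : 0 <= eps <= dot w (f 0) -> 0 <= l <= 1 ->
  lift_path (l * eps) = l *: lift_path eps.
Proof.
move=> /andP[e0 ed] /andP[l0 l1]; have d0 := up m0.
have key s : 0 <= s -> s <= dot w (f 0) -> lift_path s = (s / dot w (f 0)) *: f 0.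
  move=> s0 sd; have := @lift_path_seg 0 (s / dot w (f 0)) m0.
  rewrite hgt0 add0r divfK ?gt_eqF // => ->; last first.
    by rewrite divr_ge0 ?(ltW d0) //= ler_pdivrMr // mul1r.
  by rewrite /node big_ord0 add0r.
rewrite !key ?scalerA ?mulrA ?mulr_ge0 //.
by apply: le_trans ed; rewrite ler_piMl.
Qed.

Lemma lift_path_finish (eps l : R) : 0 <= eps <= dot w (f m.-1) -> 0 <= l <= 1 ->
  node m - lift_path (hgt m - l * eps) = l *: (node m - lift_path (hgt m - eps)).
Proof.
move=> /andP[e0 ed] /andP[l0 l1]; have d0 := up last_lt.
have key s : 0 <= s -> s <= dot w (f m.-1) ->
    node m - lift_path (hgt m - s) = (s / dot w (f m.-1)) *: f m.-1.
  move=> s0 sd; have := @lift_path_near_end (s / dot w (f m.-1)).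
  rewrite divfK ?gt_eqF // => ->; last first.
    by rewrite divr_ge0 ?(ltW d0) //= ler_pdivrMr // mul1r.
  by rewrite opprB addrC subrK.
rewrite !key ?scalerA ?mulrA ?mulr_ge0 //.
by apply: le_trans ed; rewrite ler_piMl.
Qed.

Lemma cont_lift_path j : continuous (fun y => lift_path y 0 j).
Proof.
apply: cont_all => y; rewrite (_ : (fun y => _) =
    (fun y => \sum_(i < m) clamp01 ((y - hgt i) / dot w (f i)) * f i 0 j)).
  apply: cont_sum => i; apply: contM; last exact: contc.
  apply: cont_clamp01; apply: contM; last exact: contc.
  by apply: contB; [exact: cvg_id|exact: contc].
by apply/funext => z; rewrite /lift_path summxE; apply: eq_bigr => i _; rewrite mxE.
Qed.

End Path.

Section TwoPaths.
Variables (w : V) (f f' : nat -> V) (m m' : nat).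
Hypothesis w1 : 0 < w 0 1.
Hypotheses (up : forall j, (j < m)%N -> 0 < dot w (f j))
  (up' : forall j, (j < m')%N -> 0 < dot w (f' j)).
Hypotheses (m0 : (0 < m)%N) (m0' : (0 < m')%N).
Hypothesis same_end : node f m = node f' m'.
Let H : R := hgt w f m.
Let path := lift_path w f m.
Let path' := lift_path w f' m'.
Hypothesis disj : forall y, 0 < y < H -> path y != path' y.

Definition two_paths : set V :=
  [set x | exists2 y, 0 <= y <= H & x = path y \/ x = path' y].

Let sameH : hgt w f' m' = H.
Proof. by rewrite /H -!dot_node same_end. Qed.

Let H0 : 0 < H. Proof. exact: hgt_gt0. Qed.

(** Normalizing heights to [[-1, 1]] presents the two paths as a lens, whose
    function [g] is half their difference divided by [1 - |y|]. Because the
    paths are straight near their ends, this quotient is constant there, and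
    so it extends continuously without a zero: [cl] clamps [y] before
    dividing. In between [g] vanishes only if the two points of a level agree
    in two coordinates and in height, hence coincide. *)
Lemma two_paths_isotopic : isotopic two_paths unit_circle.
Proof.
pose h y := H / 2 * (y + 1).
have hk y : -1 <= y <= 1 -> 0 <= h y <= H by move=> /andP[? ?]; have := H0; rewrite /h; move: (H) => z z0; apply/andP; split; nra.
pose gap j y := (path (h y) 0 j - path' (h y) 0 j) / 2.
pose mean j y := (path (h y) 0 j + path' (h y) 0 j) / 2.
have ch (y : R) : {for y, continuous h}.
  by apply: contM; [exact: contc|apply: contD; [exact: cvg_id|exact: contc]].
have cpath j (y : R) : {for y, continuous (fun y => path (h y) 0 j)}.
  exact: (@cont_comp _ (fun y => path y 0 j) h y (@cont_lift_path _ _ _ _) (@ch y)).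
have cpath' j (y : R) : {for y, continuous (fun y => path' (h y) 0 j)}.
  exact: (@cont_comp _ (fun y => path' y 0 j) h y (@cont_lift_path _ _ _ _) (@ch y)).
have cgap j (y : R) : {for y, continuous (gap j)}.
  by apply: contM; [apply: contB; [exact: cpath|exact: cpath']|exact: contc].
have cmean j (y : R) : {for y, continuous (mean j)}.
  by apply: contM; [apply: contD; [exact: cpath|exact: cpath']|exact: contc].
have gap0 y : -1 < y < 1 -> gap 0 y ^+ 2 + gap 2%:R y ^+ 2 != 0.
  move=> /andP[y0 y1]; have hy : 0 < h y < H by have := H0; rewrite /h; move: (H) => z z0; apply/andP; split; nra.
  have /andP[hy0 hyH] := hy.
  rewrite paddr_eq0 ?sqr_ge0 // !sqrf_eq0; apply/negP => /andP[].
  rewrite !mulf_eq0 !invr_eq0 !pnatr_eq0 /= !orbF !subr_eq0 => /eqP g0 /eqP g2.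
  have /eqP := disj hy; apply; apply: rV3P => //.
  have := dot_lift_path up m0 (ltW hy0) (ltW hyH).
  have := dot_lift_path up' m0' (ltW hy0); rewrite sameH => /(_ (ltW hyH)).
  rewrite -/path -/path' !dotE g0 g2 => e1 e2.
  have w10 : w 0 1 != 0 by rewrite gt_eqF.
  by apply: (mulfI w10); lra.
(* Within [eps] of the lowest or the highest level both paths are on their first
   or last edge. *)
pose eps := Num.min (Num.min (dot w (f 0)) (dot w (f m.-1)))
  (Num.min (Num.min (dot w (f' 0)) (dot w (f' m'.-1))) (H / 4)).
have eps0 : 0 < eps.
  by rewrite !lt_min !up ?up' ?last_lt //= divr_gt0 // H0.
have : eps <= eps by []; rewrite {2}/eps !le_min => /andP[/andP[ef el] /andP[/andP[ef' el'] eH]].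
have itv_of x : eps <= x -> 0 <= eps <= x by rewrite (ltW eps0).
(* [del] is [eps] measured in the normalized height. *)
pose del := 2 * eps / H.
have del0 : 0 < del by rewrite divr_gt0 ?mulr_gt0 // H0.
have del1 : del <= 1 / 2.
  by rewrite /del ler_pdivrMr ?H0 //; move: eH; move: (H) => z; lra.
have Hdel : H / 2 * del = eps by rewrite /del; field; rewrite gt_eqF ?H0.
have top y : 1 - del <= y <= 1 -> forall j, gap j y = (1 - y) / del * gap j (1 - del).
  move=> /andP[y0 y1] j; pose l := (1 - y) / del.
  have l01 : 0 <= l <= 1.
    by rewrite /l divr_ge0 ?(ltW del0) ?subr_ge0 //= ler_pdivrMr // mul1r; lra.
  have hy : h y = H - l * eps.
    by rewrite -Hdel /l /h; field; rewrite gt_eqF.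
  have hd : h (1 - del) = H - eps by rewrite -Hdel /h; field.
  have e := lift_path_finish up m0 (itv_of _ el) l01.
  have := lift_path_finish up' m0' (itv_of _ el') l01.
  rewrite sameH -same_end => e'.
  rewrite /gap hy hd -/H -/path -/path' in e e' *.
  move: (congr1 (fun x : V => x 0 j) e) (congr1 (fun x : V => x 0 j) e').
  rewrite !mxE -/l; move: l {l01 hy e e'} => l; move: (path _) (path _) (path' _) (path' _) (node _ _) => a b c d n.
  move=> h1 h2; have -> : b 0 j - d 0 j = (n 0 j - d 0 j) - (n 0 j - b 0 j) by ring.
  by rewrite h1 h2; ring.
have bot y : -1 <= y <= -1 + del -> forall j, gap j y = (1 + y) / del * gap j (-1 + del).
  move=> /andP[y0 y1] j; pose l := (1 + y) / del.
  have l01 : 0 <= l <= 1.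
    rewrite /l; apply/andP; split; first by apply: divr_ge0; lra.
    by rewrite ler_pdivrMr // mul1r; lra.
  have hy : h y = l * eps.
    by rewrite -Hdel /l /h; field; rewrite gt_eqF.
  have hd : h (-1 + del) = eps by rewrite -Hdel /h; field.
  have e := lift_path_start up m0 (itv_of _ ef) l01.
  have e' := lift_path_start up' m0' (itv_of _ ef') l01.
  rewrite /gap hy hd -/path -/path' in e e' *.
  by rewrite e e' !mxE -/l; field.
pose cl y := - (1 - del) + 2 * (1 - del) * clamp01 ((y + (1 - del)) / (2 * (1 - del))).
have d1 : 0 < 2 * (1 - del) by lra.
have cl_itv y : - (1 - del) <= cl y <= 1 - del.
  by have /andP[c0 c1] := clamp01_itv ((y + (1 - del)) / (2 * (1 - del)));
    rewrite /cl; apply/andP; split; nra.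
have cl_id y : - (1 - del) <= y <= 1 - del -> cl y = y.
  move=> /andP[y0 y1]; rewrite /cl clamp01_id; last first.
    by rewrite divr_ge0 ?(ltW d1) /= ?ler_pdivrMr //; lra.
  by field; rewrite gt_eqF //; lra.
have cl_hi y : 1 - del <= y -> cl y = 1 - del.
  by move=> y1; rewrite /cl clamp01_ge1; [ring|rewrite ler_pdivlMr //; lra].
have cl_lo y : y <= - (1 - del) -> cl y = - (1 - del).
  move=> y1; rewrite /cl clamp01_le0; first by ring.
  by rewrite pmulr_lle0 ?invr_gt0 //; lra.
have cl_norm y : 0 < 1 - `|cl y|.
  by rewrite subr_gt0; apply: le_lt_trans (_ : 1 - del < 1); [rewrite ler_norml cl_itv|lra].
pose g j y := gap j (cl y) / (1 - `|cl y|).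
have ccl (y : R) : {for y, continuous cl}.
  apply: contD; first exact: contc.
  apply: contM; first exact: contc.
  by apply: cont_clamp01; apply: contM; [apply: contD; [exact: cvg_id|exact: contc]|exact: contc].
have cg j : continuous (g j).
  apply: cont_all => y; apply: contM.
    by apply: (@cont_comp _ (gap j) cl y); [apply: cont_all => z; exact: cgap|exact: ccl].
  apply: contV; first by rewrite gt_eqF.
  by apply: contB; [exact: contc|apply: cont_norm; exact: ccl].
have gE j y : -1 <= y <= 1 -> (1 - `|y|) * g j y = gap j y.
  move=> /andP[y0 y1]; rewrite /g.
  have [yh|yh] := leP (1 - del) y.
    rewrite cl_hi // !ger0_norm; [|lra|lra].
    by rewrite [RHS]top ?yh // (_ : 1 - (1 - del) = del); [field; rewrite gt_eqF|ring].
  have [yl|yl] := leP y (- (1 - del)).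
    rewrite cl_lo // normrN ler0_norm ?ger0_norm; [|lra|lra].
    rewrite [RHS]bot; last by apply/andP; split; lra.
    rewrite (_ : 1 - (1 - del) = del); last by ring.
    by rewrite opprB [del - 1]addrC; field; rewrite gt_eqF.
  rewrite cl_id; last by rewrite !ltW.
  by rewrite mulrC divfK // gt_eqF // subr_gt0 ltr_norml; apply/andP; split; lra.
have g_neq0 y : g 0 y ^+ 2 + g 2%:R y ^+ 2 != 0.
  have -> : g 0 y ^+ 2 + g 2%:R y ^+ 2 =
      (gap 0 (cl y) ^+ 2 + gap 2%:R (cl y) ^+ 2) * (1 - `|cl y|) ^- 2.
    have aux (a b c : R) : (a / c) ^+ 2 + (b / c) ^+ 2 = (a ^+ 2 + b ^+ 2) * c ^- 2.
      by rewrite !expr_div_n -mulrDl.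
    exact: aux.
  rewrite mulf_neq0 //; last by rewrite invr_eq0 expf_neq0 // gt_eqF.
  by apply: gap0; have /andP[c0 c1] := cl_itv y; apply/andP; split; lra.
apply: isotopic_trans (isotopic_height _ (-1) (_ : 0 < 2 / H) w1) _; first by rewrite divr_gt0 // H0.
apply: isotopic_trans diamond_isotopic_circle.
rewrite (_ : [set _ | _ in _] = lens (mean 0) (mean 2%:R) (g 0) (g 2%:R)).
  by apply: lens_isotopic_diamond => //; apply: cont_all => y; exact: cmean.
have Hn0 : H != 0 by rewrite gt_eqF // H0.
have pE y (b : bool) : -1 <= y <= 1 ->
    vec3 (mean 0 y + (-1) ^+ b * ((1 - `|y|) * g 0 y)) y
         (mean 2%:R y + (-1) ^+ b * ((1 - `|y|) * g 2%:R y)) =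
    (let x := if b then path' (h y) else path (h y) in
      vec3 (x 0 0) (2 / H * dot w x + -1) (x 0 2%:R)).
  move=> y1; have /andP[h0 h1] := hk y y1.
  have d : dot w (if b then path' (h y) else path (h y)) = h y.
    by case: b; rewrite dot_lift_path // sameH.
  rewrite !gE // /mean /gap /= d; apply: rV3P; rewrite !vec3E.
  - by case: b {d} => /=; field.
  - by rewrite /h; field.
  - by case: b {d} => /=; field.
apply/seteqP; split.
  move=> _ [x [z /andP[z0 zH] xz] <-].
  pose y := 2 / H * z - 1; have hy : h y = z by rewrite /h /y; field.
  have y1 : -1 <= y <= 1.
    rewrite /y; apply/andP; split.
      by rewrite lerBrDr addNr mulr_ge0 // divr_ge0 // ltW ?H0.
    by rewrite lerBlDr mulrAC ler_pdivrMr ?H0 //; lra.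
  case: xz => xz; [exists y, false|exists y, true]; split; rewrite ?ler_norml // pE // hy -xz //.
move=> x [y [b [y1 ->]]]; rewrite ler_norml in y1.
exists (if b then path' (h y) else path (h y)); last by rewrite pE.
exists (h y); first exact: hk.
by case: b; [right|left].
Qed.

End TwoPaths.

End MonotonePath.

(** * Hexagons with one maximum *)

Section Embedding.
Context {R : realType}.
Notation V := 'rV[R]_3.
Implicit Types (e : pol R).

(** The edges indexed by natural numbers, which is what [node] and [lift_path]
    expect. *)
Definition edgen e (l : nat) : V :=
  [:: edge e 0; edge e 1; edge e 2%:R; edge e 3%:R; edge e 4%:R; edge e 5%:R]`_l.

Definition point e (j : nat) (s : R) : V := node (edgen e) j + s *: edgen e j.

Lemma edgenE e (i : 'I_6) : edgen e i = edge e i.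
Proof. by elim/forall6: i. Qed.

Lemma edgen_ord e l : (l < 6)%N -> exists2 i : 'I_6, l = i & edgen e l = edge e i.
Proof. by move=> l6; exists (Ordinal l6) => //; rewrite -edgenE. Qed.

Lemma node_edgen6 e : node (edgen e) 6 = 0.
Proof.
by rewrite /node -[RHS](edge_sum e); apply: eq_bigr => i _; rewrite edgenE.
Qed.

Lemma node_edgen_sum e : edgen e 0 + edgen e 1 + edgen e 2 + edgen e 3 + edgen e 4 + edgen e 5 = 0.
Proof. by rewrite -[RHS](edge_sum e) sum6. Qed.

Lemma vertexE e (k : 'I_6) : vertex e k = node (edgen e) k.
Proof.
rewrite /vertex /node (big_ord_widen_cond 6 xpredT (edgen e)); last exact: ltnW.
by apply: eq_bigr => i _; rewrite edgenE.
Qed.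

Lemma polygon_pointE e (k : 'I_6) s : polygon_point e (k, s) = point e k s.
Proof. by rewrite /polygon_point vertexE /point edgenE. Qed.

Lemma polygon_image e : polygon_point e @` polygon_param =
  [set x | exists j s, [/\ (j < 6)%N, 0 <= s < 1 & x = point e j s]].
Proof.
apply/seteqP; split.
  by move=> _ [[k s] /= s01 <-]; exists k, s; rewrite polygon_pointE.
by move=> _ [j [s [j6 s01 ->]]]; exists (Ordinal j6, s); rewrite ?polygon_pointE.
Qed.

Section Generic.
Variable e : pol R.
Hypothesis ge : ~ degenerate e.
Let F := edgen e.

Lemma edgen_triple i j k : [&& (i < 6)%N, (j < 6)%N, (k < 6)%N, i != j, i != k & j != k] ->
  dot (cross (F i) (F j)) (F k) != 0.
Proof.
case/and5P => /(edgen_ord e)[a ia Ea] /(edgen_ord e)[b jb Eb] /(edgen_ord e)[c kc Ec] ij /andP[ik jk].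
rewrite /F Ea Eb Ec; apply: (generic_triple ge).
by move: ij ik jk; rewrite ia jb kc /= !inE negb_or !andbT !val_eqE => -> -> ->.
Qed.

Lemma edgen_triple2 i j k l : all (fun n => n < 6)%N [:: i; j; k; l] -> uniq [:: i; j; k; l] ->
  dot (cross (F i) (F l)) (F j + F k) != 0.
Proof.
case/and5P => /(edgen_ord e)[a ia Ea] /(edgen_ord e)[b jb Eb] /(edgen_ord e)[c kc Ec] /(edgen_ord e)[d ld Ed] _ u.
rewrite /F Ea Eb Ec Ed.
have : triple (edge e a) (edge e b + edge e c) (edge e d) != 0.
  apply: (generic_triple2 ge); rewrite -(map_inj_uniq (val_inj : injective (val : 'I_6 -> nat))) /=.
  by rewrite -ia -jb -kc -ld.
apply: contraNneq => h; apply/eqP; rewrite -[RHS]oppr0 -h.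
by rewrite /triple /cross !vecE; ring.
Qed.

Lemma dot_cross_l (u v : V) : dot (cross u v) u = 0.
Proof. by rewrite /cross !vecE; ring. Qed.

Lemma dot_cross_r (u v : V) : dot (cross u v) v = 0.
Proof. by rewrite /cross !vecE; ring. Qed.

(** An intersection gives a linear relation between consecutive edges with
    coefficients [1 - s] and [s'] at the ends and 1 in the middle. Its product
    with the normal of the two end edges leaves a triple product with the sum
    of the middle edges. There are at most two of these, or three which the
    vanishing of the total sum trades for the remaining edge. If there are
    none, or four which are traded likewise, the relation makes two adjacent
    edges linearly dependent. *)
Lemma point_neq i j s s' : (i < j)%N -> (j < 6)%N -> 0 <= s < 1 -> 0 <= s' < 1 ->
  point e i s != point e j s'.
Proof.
move=> ij j6 /andP[s0 s1] /andP[t0 t1]; apply/eqP => E.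
have tot n : dot n (F 0) + dot n (F 1) + dot n (F 2) + dot n (F 3) + dot n (F 4) + dot n (F 5) = 0.
  by rewrite -!dotDr node_edgen_sum dot0r.
have E' n : dot n (node F i) + s * dot n (F i) = dot n (node F j) + s' * dot n (F j).
  by have := congr1 (dot n) E; rewrite /point !dotDr !dotZr.
have nS n k : dot n (node F k.+1) = dot n (node F k) + dot n (F k) by rewrite nodeS dotDr.
have np (a b : R) : a != 0 -> b != 0 -> b * a = 0 -> False.
  by move=> a0 b0 /eqP; rewrite mulf_eq0 (negbTE a0) (negbTE b0).
have s1' : 1 - s != 0 by rewrite gt_eqF // subr_gt0.
have t1' : s' - 1 != 0 by rewrite lt_eqF // subr_lt0.
have [d dE] : exists d, j = (i + d.+1)%N by exists (j - i).-1; lia.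
case: d => [|[|[|[|[|d]]]]] in dE *; rewrite ?addnS ?addn0 in dE; subst j; last by move: j6; lia.
- pose l : nat := if (i == 0)%N then 2 else 0.
  have tr : dot (cross (F i.+1) (F l)) (F i) != 0 by apply: edgen_triple; rewrite /l; case: ifP; lia.
  apply: (np _ _ tr s1'); have := E' (cross (F i.+1) (F l)).
  by rewrite nS dot_cross_l mulr0 addr0 => h; lra.
- have tr : dot (cross (F i) (F i.+2)) (F i.+1) != 0 by apply: edgen_triple; lia.
  move/eqP: tr; apply; have := E' (cross (F i) (F i.+2)).
  by rewrite !nS dot_cross_l dot_cross_r !mulr0 !addr0 => h; lra.
- have tr : dot (cross (F i) (F i.+3)) (F i.+1 + F i.+2) != 0.
    by apply: edgen_triple2; rewrite /= ?inE; lia.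
  move/eqP: tr; apply; have := E' (cross (F i) (F i.+3)).
  by rewrite !nS dot_cross_l dot_cross_r dotDr !mulr0 !addr0 => h; lra.
- case: i => [|[|i]] in j6 ij E E' *; last by move: j6; lia.
    have tr : dot (cross (F 0) (F 4)) (F 5) != 0 by apply: edgen_triple.
    move/eqP: tr; apply; have := E' (cross (F 0) (F 4)); have := tot (cross (F 0) (F 4)).
    by rewrite !nS dot_cross_l dot_cross_r !mulr0 !addr0 => h h'; lra.
  have tr : dot (cross (F 1) (F 5)) (F 0) != 0 by apply: edgen_triple.
  move/eqP: tr; apply; have := E' (cross (F 1) (F 5)); have := tot (cross (F 1) (F 5)).
  by rewrite !nS dot_cross_l dot_cross_r !mulr0 !addr0 => h h'; lra.
- case: i => [|i] in j6 ij E E' *; last by move: j6; lia.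
  have tr : dot (cross (F 0) (F 1)) (F 5) != 0 by apply: edgen_triple.
  apply: (np _ _ tr t1'); have := E' (cross (F 0) (F 1)); have := tot (cross (F 0) (F 1)).
  by rewrite !nS dot_cross_l dot_cross_r mulr0 => h h'; lra.
Qed.

Lemma edgen_neq0 j : (j < 6)%N -> F j != 0.
Proof.
move=> j6; apply/eqP => Fj.
pose l : nat := if (j == 0)%N then 2 else 0; pose k : nat := if (j == 5)%N then 3 else 5.
suff /edgen_triple : [&& (l < 6)%N, (k < 6)%N, (j < 6)%N, l != k, l != j & k != j].
  by rewrite Fj dot0r eqxx.
by rewrite /l /k; do 2?case: ifP; lia.
Qed.

Lemma polygon_point_inj : set_inj polygon_param (polygon_point e).
Proof.
move=> [i s] [j s']; rewrite !inE /= => s01 t01; rewrite !polygon_pointE.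
have [ij|ij|/val_inj ->] := ltngtP i j.
- by move/eqP; rewrite (negbTE (point_neq ij (ltn_ord j) s01 t01)).
- by move/esym/eqP; rewrite (negbTE (point_neq ij (ltn_ord i) t01 s01)).
- move/addrI/eqP; rewrite -subr_eq0 -scalerBl scaler_eq0 (negbTE (edgen_neq0 (ltn_ord j))) orbF.
  by rewrite subr_eq0 => /eqP ->.
Qed.

(** The falling edges, traversed backwards from the starting point, form a
    second rising path with the same end. *)
Lemma unimodal_unknot (w : V) k : 0 < w 0 1 -> (0 < k < 6)%N ->
  (forall j, (j < k)%N -> 0 < dot w (F j)) ->
  (forall j, (k <= j < 6)%N -> dot w (F j) < 0) ->
  isotopic (polygon_point e @` polygon_param) unit_circle.
Proof.
move=> w1 /andP[k0 k6] up down; rewrite polygon_image.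
pose F' j := - F (5 - j).
have node' j : (j <= 6)%N -> node F' j = node F (6 - j).
  elim: j => [|j ih] j6; first by rewrite [RHS]node_edgen6 /node big_ord0.
  rewrite nodeS ih ?(ltnW j6) // /F' (_ : 6 - j = (5 - j).+1)%N; last by lia.
  by rewrite nodeS addrK subSS.
have up' j : (j < 6 - k)%N -> 0 < dot w (F' j).
  by move=> jk; rewrite dotNr oppr_gt0 down //; lia.
have k6' : (0 < 6 - k)%N by rewrite subn_gt0.
have same : node F k = node F' (6 - k) by rewrite node' ?leq_subr // subKn // ltnW.
have seg j s : (j < k)%N -> 0 <= s < 1 -> lift_path w F k (hgt w F j + s * dot w (F j)) = point e j s.
  by move=> jk /andP[s0 s1]; rewrite lift_path_seg // s0 ltW.
have seg' j s : (j < 6 - k)%N -> 0 < s -> s < 1 ->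
    lift_path w F' (6 - k) (hgt w F' j + s * dot w (F' j)) = point e (5 - j) (1 - s).
  move=> jk s0 s1; rewrite lift_path_seg ?(ltW s0) ?ltW // node'; last by lia.
  rewrite (_ : 6 - j = (5 - j).+1)%N; last by lia.
  by rewrite /point nodeS /F' scalerN scalerBl scale1r addrA.
have seg0 j : (j < 6 - k)%N ->
    lift_path w F' (6 - k) (hgt w F' j) = node F (6 - j).
  move=> jk; have := @lift_path_seg _ w F' (6 - k) up' j 0 jk.
  by rewrite mul0r scale0r !addr0 lexx ler01 node' => [-> //|]; lia.
have hgtE : hgt w F' (6 - k) = hgt w F k by rewrite -!dot_node -same.
rewrite (_ : [set _ | _] = two_paths w F F' k (6 - k)).
  apply: (two_paths_isotopic w1 up up' k0 k6' same) => y /andP[y0 yk].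
  have [i [s [ik s0 s1 ys]]] := find_level up (ltW y0) yk.
  have [j [t [jk t0 t1 yt]]] : exists j s, [/\ (j < 6 - k)%N, 0 <= s, s < 1 & y = hgt w F' j + s * dot w (F' j)].
    by apply: find_level => //; rewrite ?ltW // hgtE.
  rewrite {1}ys seg ?s0 // yt; move: t0; rewrite le_eqVlt => /predU1P[t0|t0]; last first.
    by rewrite seg' //; apply: point_neq; rewrite ?s0 //; [lia|lia|lra].
  rewrite -t0 mul0r addr0 seg0 //; case: j jk yt => [|j] jk yt.
    by move: y0; rewrite yt -t0 mul0r addr0 hgt0 ltxx.
  have -> : node F (6 - j.+1) = point e (6 - j.+1) 0 by rewrite /point scale0r addr0.
  by apply: point_neq; rewrite ?s0 ?lexx ?ltr01 //; lia.
apply/seteqP; split.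
  move=> x [j [s [j6 s01 ->]]]; have /andP[s0 s1] := s01.
  have bnd m f i t : (forall j, (j < m)%N -> 0 < dot w (f j)) -> (i < m)%N -> 0 <= t <= 1 ->
      0 <= hgt w f i + t * dot w (f i) <= hgt w f m.
    move=> upf im /andP[t0 t1]; have fi := upf _ im; apply/andP; split.
      apply: addr_ge0; last by apply: mulr_ge0 => //; exact: ltW.
      by rewrite -(hgt0 w f); apply: (hgt_le upf) => //; exact: ltnW.
    apply: le_trans (hgt_le upf im (leqnn m)); rewrite hgtS lerD2l ler_piMl // ltW //.
  have [jk|kj] := ltnP j k.
    exists (hgt w F j + s * dot w (F j)); last by left; rewrite seg.
    by apply: bnd => //; rewrite s0 ltW.
  have jk : (5 - j < 6 - k)%N by lia.
  exists (hgt w F' (5 - j)%N + (1 - s) * dot w (F' (5 - j)%N)).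
    by rewrite -hgtE; apply: bnd => //; apply/andP; split; lra.
  right; rewrite lift_path_seg //; last by apply/andP; split; lra.
  rewrite node'; last by lia.
  rewrite (_ : 6 - (5 - j) = j.+1)%N; last by lia.
  by rewrite /F' (_ : 5 - (5 - j) = j)%N ?nodeS /point; [rewrite scalerN scalerBl scale1r opprB addrACA subrr addr0|lia].
move=> x [y /andP[y0]]; rewrite le_eqVlt => /predU1P[->|yk].
  rewrite (lift_path_end up k0) -hgtE (lift_path_end up' k6') -same.
  case=> ->; exists k, 0; rewrite lexx ltr01 /point scale0r addr0; split=> //.
case=> ->.
  have [j [s [jk s0 s1 ->]]] := find_level up y0 yk.
  by exists j, s; rewrite seg ?s0 //; split=> //; lia.
have [j [t [jk t0 t1 ->]]] : exists j s, [/\ (j < 6 - k)%N, 0 <= s, s < 1 & y = hgt w F' j + s * dot w (F' j)].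
  by apply: find_level => //; rewrite hgtE.
move: t0; rewrite le_eqVlt => /predU1P[t0|t0]; last first.
  by exists (5 - j)%N, (1 - t); rewrite seg' //; split=> //; [lia|apply/andP; split; lra].
rewrite -t0 mul0r addr0 seg0 //; case: j jk {yk} => [|j] jk.
  exists 0%N, 0; rewrite lexx ltr01; split=> //.
  by rewrite [LHS]node_edgen6 /point scale0r addr0 /node big_ord0.
exists (6 - j.+1)%N, 0; rewrite lexx ltr01 /point scale0r addr0; split=> //; lia.
Qed.

End Generic.
End Embedding.

(** * Signs of heights *)

Section Signs.
Context {R : realType}.
Notation V := 'rV[R]_3.
Implicit Types (e : pol R).

Lemma rot_inj : injective (fun i : 'I_6 => i + 1).
Proof. exact: addIr. Qed.

Definition shift e : pol R := perm_pol (perm rot_inj) e.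

Lemma edgen_shift e j : (j < 6)%N -> edgen (shift e) j = edgen e (j.+1 %% 6).
Proof.
move=> /(edgen_ord (shift e))[i -> ->]; rewrite edge_perm permE.
by elim/forall6: i; rewrite /edgen /=; congr edge; apply/val_inj.
Qed.

Lemma edgen_iter_shift p e j : (j < 6)%N ->
  edgen (iter p shift e) j = edgen e ((j + p) %% 6).
Proof.
elim: p e => [|p ih] e j6; first by rewrite addn0 modn_small.
rewrite iterSr ih // edgen_shift ?ltn_mod //; congr edgen.
by rewrite -addn1 modnDml addn1 addnS.
Qed.

Lemma point_shift e j s : (j < 6)%N ->
  point (shift e) j s = point e (j.+1 %% 6) s - edgen e 0.
Proof.
have nodeE k : (k <= 6)%N -> node (edgen (shift e)) k = \sum_(i < k) edgen e (i.+1 %% 6).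
  move=> k6; rewrite /node; apply: eq_bigr => i _; rewrite edgen_shift //.
  exact: leq_trans k6.
move=> j6; rewrite /point edgen_shift //.
suff -> : node (edgen (shift e)) j = node (edgen e) (j.+1 %% 6) - edgen e 0.
  by rewrite addrAC.
apply: etrans (nodeE j (ltnW j6)) _; have [j5|j5] := leqP 5 j.
  have -> : j = 5%N by apply/eqP; rewrite eqn_leq j5 -ltnS j6.
  apply/eqP; rewrite eq_sym subr_eq eq_sym addrC; apply/eqP.
  have := node_edgen6 e; rewrite /node !big_ord_recl !big_ord0 /=.
  by rewrite !modn_small.
rewrite modn_small // /node [in RHS]big_ord_recl addrAC subrr add0r.
apply: eq_bigr => i _; rewrite lift0 modn_small // ltnS.
exact: ltn_trans (ltn_ord i) j5.
Qed.

Definition curve e : set V := polygon_point e @` polygon_param.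

(** The first vertex is always placed at the origin; hence the translation. *)
Lemma curve_shift e : curve (shift e) = [set x + - edgen e 0 | x in curve e].
Proof.
rewrite /curve !polygon_image; apply/seteqP; split.
  move=> _ [j [s [j6 s01 ->]]]; rewrite point_shift //.
  by exists (point e (j.+1 %% 6) s) => //; exists (j.+1 %% 6)%N, s; rewrite ltn_mod.
move=> _ [_ [j [s [j6 s01 ->]]] <-].
have jE : (((j + 5) %% 6).+1 %% 6 = j)%N by rewrite -addn1 modnDml -addnA modnDr modn_small.
exists ((j + 5) %% 6)%N, s; rewrite ltn_mod; split=> //.
by rewrite point_shift ?ltn_mod // jE.
Qed.

Lemma curve_iter_shift e p : isotopic (curve (iter p shift e)) unit_circle ->
  isotopic (curve e) unit_circle.
Proof.
elim: p => //= p ih; rewrite curve_shift => h; apply: ih.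
exact: isotopic_trans (isotopic_shift _ _) h.
Qed.

Lemma shift_generic e p : ~ degenerate e -> ~ degenerate (iter p shift e).
Proof. by move=> ge; elim: p => //= p ih /degenerate_perm. Qed.

Lemma cyclic_unimodal_unknot e (w : V) p k : ~ degenerate e -> 0 < w 0 1 -> (0 < k < 6)%N ->
  (forall j, (j < k)%N -> 0 < dot w (edgen e ((j + p) %% 6))) ->
  (forall j, (k <= j < 6)%N -> dot w (edgen e ((j + p) %% 6)) < 0) ->
  is_unknot e.
Proof.
move=> ge w1 /andP[k0 k6] up down; split; first exact: polygon_point_inj.
apply: isotopic_trivial_knot; apply: (@curve_iter_shift e p).
apply: (@unimodal_unknot _ _ (@shift_generic e p ge) w k w1); first by rewrite k0.
  by move=> j jk; rewrite edgen_iter_shift ?up // (ltn_trans jk).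
by move=> j /andP[kj j6]; rewrite edgen_iter_shift // down // kj.
Qed.

Lemma sign_stable n (a b : nat -> R) : (forall i, (i < n)%N -> a i != 0) ->
  exists2 eps, 0 < eps & forall i t, (i < n)%N -> 0 <= t <= eps -> 0 < a i * (a i + t * b i).
Proof.
elim: n => [|n ih] a0; first by exists 1.
have [|eps e0 he] := ih; first by move=> i ni; apply: a0; exact: ltnW.
have an : 0 < `|a n| by rewrite normr_gt0 a0.
have bn : 0 < `|b n| + 1 by rewrite ltr_wpDl.
exists (Num.min eps (`|a n| / (`|b n| + 1))); first by rewrite lt_min e0 divr_gt0.
move=> i t; rewrite le_min ltnS leq_eqVlt => /predU1P[->|ni] /and3P[t0 te tn]; last first.
  by apply: he => //; rewrite t0.
move: tn; rewrite ler_pdivlMr // => tn.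
have tb : `|t * b n| < `|a n|.
  rewrite normrM ger0_norm //; have [->|tn0] := eqVneq t 0; first by rewrite mul0r.
  have : 0 < t by rewrite lt_neqAle eq_sym tn0.
  by move: tn; rewrite mulrDr mulr1; lra.
have : `|a n * (t * b n)| < a n * a n.
  by rewrite -expr2 -normr_id -[_ ^+ 2]real_normK ?num_real // expr2 normr_id normrM ltr_pM2l.
by rewrite ltr_norml => /andP[h _]; rewrite mulrDr; lra.
Qed.

Lemma same_sign (a b : R) : 0 < a * b -> (0 < a) = (0 < b).
Proof.
move=> h; apply/idP/idP => h'; first by rewrite -(pmulr_rgt0 _ h').
by rewrite -(pmulr_lgt0 _ h').
Qed.

(** The first two entries of the word are the signs chosen for [e_0] and
    [e_1]. Around the cycle the number of sign changes is even, and it is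
    positive because the signs are not all equal; it is at most three, since
    linearly there are at most two. So it is two. The flag [c] exchanges
    rising and falling. *)
Lemma two_block_pattern (s2 s3 s4 s5 c : bool) :
  ~~ [&& s2 != s3, s3 != s4 & s4 != s5] -> ~~ [&& s2 == s3, s3 == s4 & s4 == s5] ->
  exists p k, (0 < k < 6)%N /\ forall j, (j < 6)%N ->
    (nth false [:: s2; s2; s2; s3; s4; s5] ((j + p) %% 6) (+) c) = (j < k)%N.
Proof.
move=> nalt ncst.
pose ok p k := all (fun j => (nth false [:: s2; s2; s2; s3; s4; s5] ((j + p) %% 6) (+) c) == (j < k)%N) (iota 0 6).
have : has (fun p => has (ok p) (iota 1 5)) (iota 0 6).
  by move: s2 s3 s4 s5 c nalt ncst @ok => [] [] [] [] [].
move=> /hasP[p _ /hasP[k]]; rewrite mem_iota => k16 /allP okpk.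
exists p, k; split; first by move: k16; lia.
by move=> j j6; apply/eqP/okpk; rewrite mem_iota.
Qed.

Lemma dot_tilt_l (a b : V) :
  dot (cross (cross a b) (a - b)) a = dot (cross a b) (cross a b).
Proof. by rewrite /cross !vecE; ring. Qed.

Lemma dot_tilt_r (a b : V) :
  dot (cross (cross a b) (a - b)) b = dot (cross a b) (cross a b).
Proof. by rewrite /cross !vecE; ring. Qed.

Section Generic.
Variable e : pol R.
Hypothesis ge : ~ degenerate e.
Let F := edgen e.
Let u := cross (F 0) (F 1).
Let s j := 0 < dot u (F j).

(** The vector [z] has inner products of the sign of [u.e_2] with [e_0] and
    [e_1], and [u] is orthogonal to both; so [w1 = u + eps z] realizes the
    word of [two_block_pattern] if [eps] is small. A second perturbation makes
    the middle coordinate nonzero, and replacing [w] by [- w] makes it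
    positive, as [unimodal_unknot] requires. *)
Lemma not_alternating_unknot : ~~ [&& s 2 != s 3, s 3 != s 4 & s 4 != s 5] -> is_unknot e.
Proof.
move=> nalt.
have a0 j : (j < 4)%N -> dot u (F j.+2) != 0 by move=> j4; apply: edgen_triple => //; lia.
have tot : dot u (F 2) + dot u (F 3) + dot u (F 4) + dot u (F 5) = 0.
  have := congr1 (dot u) (node_edgen_sum e); rewrite !dotDr dot0r.
  by rewrite -/F dot_cross_l dot_cross_r !add0r.
have ncst : ~~ [&& s 2 == s 3, s 3 == s 4 & s 4 == s 5].
  apply/negP => /and3P[/eqP s23 /eqP s34 /eqP s45].
  have [p2|n2] := boolP (s 2).
    have [p3 [p4 p5]] : s 3 /\ s 4 /\ s 5 by rewrite -s45 -s34 -s23.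
    by move: p2 p3 p4 p5; rewrite /s; lra.
  have neg j : (j < 4)%N -> s j.+2 = s 2 -> dot u (F j.+2) < 0.
    by move=> j4 sj; rewrite lt_neqAle a0 // leNgt -/(s j.+2) sj.
  have := neg 0%N isT erefl; have := neg 1%N isT (esym s23).
  have := neg 2%N isT (esym (etrans s23 s34)); have := neg 3%N isT (esym (etrans s23 (etrans s34 s45))).
  by lra.
have u0 : 0 < dot u u.
  apply: dot_gt0; apply/eqP => u0; have := a0 0%N isT.
  by rewrite u0 dotC dot0r eqxx.
pose z := dot u (F 2) *: cross u (F 0 - F 1).
have z0 : dot z (F 0) = dot u (F 2) * dot u u.
  by rewrite /z dotC dotZr; congr (_ * _); rewrite dotC; exact: dot_tilt_l.
have z1 : dot z (F 1) = dot u (F 2) * dot u u.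
  by rewrite /z dotC dotZr; congr (_ * _); rewrite dotC; exact: dot_tilt_r.
pose word j := nth false [:: s 2; s 2; s 2; s 3; s 4; s 5] j.
have [eps e0 he] := sign_stable (fun j => dot z (F j.+2)) a0.
pose w1 := u + eps *: z.
have w1E j : dot w1 (F j) = dot u (F j) + eps * dot z (F j).
  by rewrite /w1 dotC dotDr dotZr ![dot (F j) _]dotC.
have w1s j : (j < 6)%N -> dot w1 (F j) != 0 /\ (0 < dot w1 (F j)) = word j.
  have e1 : 0 < eps * dot u u by rewrite mulr_gt0.
  have base x : dot u x = 0 -> dot z x = dot u (F 2) * dot u u ->
      dot w1 x != 0 /\ (0 < dot w1 x) = s 2.
    move=> ux zx; rewrite /w1 dotC dotDr dotZr ![dot x _]dotC ux zx add0r mulrCA.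
    by rewrite mulf_neq0 ?(gt_eqF e1) ?(a0 0%N) // pmulr_lgt0.
  case: j => [|[|j]] j6; first exact: (base _ (dot_cross_l _ _) z0).
    exact: (base _ (dot_cross_r _ _) z1).
  have := he j eps j6; rewrite (ltW e0) lexx -w1E => /(_ isT) h; split.
    by apply: contraTneq h => ->; rewrite mulr0 ltxx.
  rewrite -(same_sign h) /word; by move: j j6 {h}; do 4!case => //.
pose y : V := vec3 0 1 0.
have [eps' e0' he'] := sign_stable (fun j => dot y (F j)) (fun j j6 => (w1s j j6).1).
have [w w10 ws] : exists2 w : V, w 0 1 != 0 & forall j, (j < 6)%N -> dot w (F j) != 0 /\ (0 < dot w (F j)) = word j.
  have [w0|w0] := eqVneq (w1 0 1) 0; last by exists w1.
  exists (w1 + eps' *: y); first by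
    rewrite [X in X != 0]mxE w0 add0r mxE /y vec3E mulr1 gt_eqF.
  move=> j j6; have := he' j eps' j6; rewrite (ltW e0') lexx => /(_ isT).
  have -> : dot w1 (F j) + eps' * dot y (F j) = dot (w1 + eps' *: y) (F j).
    by rewrite [RHS]dotC dotDr dotZr ![dot (F j) _]dotC.
  move=> h; split; last by rewrite -(same_sign h) (w1s j j6).2.
  by apply: contraTneq h => ->; rewrite mulr0 ltxx.
have [p [k [k06 pat]]] := two_block_pattern (w 0 1 < 0) nalt ncst.
have signs j : (j < 6)%N -> let x := dot w (F ((j + p) %% 6)) in
    x != 0 /\ (0 < x) (+) (w 0 1 < 0) = (j < k)%N.
  by move=> j6; have [x0 xs] := ws _ (ltn_pmod (j + p) (isT : 0 < 6)%N); rewrite /= xs -pat.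
have [wn|wp] := ltP (w 0 1) 0; move: signs; [rewrite wn|rewrite ltNge wp /=] => signs.
  apply: (@cyclic_unimodal_unknot _ (- w) p k ge _ k06); first by rewrite mxE oppr_gt0.
    move=> j jk; have j6 : (j < 6)%N by case/andP: k06 => _; exact: ltn_trans.
    have [x0] := signs j j6; rewrite jk addbT -leNgt => x1.
    by rewrite dotC dotNr dotC oppr_gt0 lt_neqAle x0.
  move=> j /andP[kj j6]; have [x0] := signs j j6.
  by rewrite ltnNge kj addbT => /negbFE x1; rewrite dotC dotNr dotC oppr_lt0.
apply: (@cyclic_unimodal_unknot _ w p k ge _ k06); first by rewrite lt_neqAle eq_sym w10.
  move=> j jk; have j6 : (j < 6)%N by case/andP: k06 => _; exact: ltn_trans.
  by have [x0] := signs j j6; rewrite jk addbF.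
move=> j /andP[kj j6]; have [x0] := signs j j6.
by rewrite ltnNge kj addbF => /negbT; rewrite -leNgt lt_neqAle x0.
Qed.

End Generic.

Definition swap_edges e : pol R := perm_pol (tperm (2%:R : 'I_6) 3%:R) e.

(** The exchange keeps [u] and swaps the signs [s 2] and [s 3]. If both
    hexagons were alternating, then [s 2], [s 3] and [s 4] would be pairwise
    different. *)
Lemma unknot_or_swap e : ~ degenerate e -> is_unknot e \/ is_unknot (swap_edges e).
Proof.
move=> ge; have ge' : ~ degenerate (swap_edges e) by move/degenerate_perm.
have sw : [/\ edgen (swap_edges e) 0 = edgen e 0, edgen (swap_edges e) 1 = edgen e 1,
    edgen (swap_edges e) 2 = edgen e 3, edgen (swap_edges e) 3 = edgen e 2 &
    edgen (swap_edges e) 4 = edgen e 4].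
  by rewrite /edgen /= !edge_perm tpermL tpermR !tpermD.
case: sw => s0 s1 s2 s3 s4.
have := not_alternating_unknot ge; have := not_alternating_unknot ge'.
rewrite s0 s1 s2 s3 s4; move: (0 < _) (0 < _) (0 < _) (0 < _) (0 < _) => [] [] [] [] [] /= h h';
  (by left; apply: h') || (by right; apply: h).
Qed.

End Signs.

(** * The estimate *)

Section Half.
Context {R : realType}.

Let U : set (pol R) := [set e | is_unknot e].

Lemma total_le_twice_unknots : (pol_measure [set: pol R] <= pol_measure U + pol_measure U)%E.
Proof.
have cover : [set: pol R] `<=` degenerate `|` (U `|` swap_edges @^-1` U).
  move=> e _; have [de|ge] := pselect (degenerate e); first by left.
  by right; have [Ue|Ue] := unknot_or_swap ge; [left|right].
apply: (le_trans (le_hausdorff _ _ cover)).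
apply: (le_trans (hausdorffU _ _ _ _)).
rewrite (_ : hausdorff _ _ degenerate = 0%E) ?add0e; last exact: degenerate_null.
apply: (le_trans (hausdorffU _ _ _ _)).
by rewrite leeD2l //; exact: pol_measure_perm.
Qed.

End Half.

Theorem proposition16 (R : realType) : 1 / 2 <= hexagon_prob (unknots : set (hexagon_space R)).
Proof.
pose T : \bar R := pol_measure [set: pol R].
pose B : \bar R := hexagon_measure (unknots : set (hexagon_space R)).
have TB : (T <= B + B)%E.
  apply: le_trans total_le_twice_unknots _.
  (* The preimage of [unknots] consists of the rotated unknots. *)
  have UB : (pol_measure [set e : pol R | is_unknot e] <= B)%E.
    by apply: le_hausdorff => e Ue; exists e.
  exact: leeD.
have BT : (B <= T)%E by apply: le_hausdorff.
have T0 : (0 < T)%E := pol_measure_gt0.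
have Too : (T < +oo)%E := total_finite.
have Tfin : T \is a fin_num by rewrite ge0_fin_numE // ltW.
have Bfin : B \is a fin_num.
  by rewrite ge0_fin_numE ?(le_lt_trans BT) //; exact: hausdorff_ge0.
rewrite /hexagon_prob -/B (_ : hexagon_measure setT = T) //.
have t0 : 0 < fine T by rewrite fine_gt0 // T0.
rewrite ler_pdivlMr //.
by move: TB; rewrite -(fineK Tfin) -(fineK Bfin) -EFinD lee_fin => ?; lra.
Qed.
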